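(* Let $F|K$ be an algebraic function field and $\wp$ a place on $K$. The set of all places $P\in S(F|K;\wp)$ with value group $v_PF$ finitely generated modulo $v_\wp K$ and with residue field $FP$ finitely generated over $K\wp$ lies dense in $S(F|K;\wp)$ with respect to the patch topology. The same holds for its subset of all Abhyankar places.
   Context: An algebraic function field $F|K$ is a finitely generated field extension of positive transcendence degree; the characteristic is arbitrary. For a place $P$ on a field $L$: $\mathcal O_P$ is its valuation ring, $\mathcal M_P$ the maximal ideal, $LP$ the residue field, $v_P$ an associated valuation, $v_PL$ its value group. Equivalent places are identified. $S(F|K;\wp)$ is the set of all places of $F$ extending the given place $\wp$ of $K$ ($\wp$ may be trivial). For $P\in S(F|K;\wp)$ put $\dim P:=\operatorname{trdeg}(FP|K\wp)$ and $\operatorname{rr}P:=\dim_{\mathbb Q}\mathbb Q\otimes(v_PF/v_\wp K)$. One always has $\operatorname{trdeg}F|K\ge\dim P+\operatorname{rr}P$; $P$ is an Abhyankar place if equality holds (then $v_PF$ is finitely generated modulo $v_\wp K$ and $FP|K\wp$ is finitely generated). The patch topology on $S(F|K;\wp)$ has as basic open sets the sets $\{P\in S(F|K;\wp)\mid a_1,\ldots,a_k\in\mathcal O_P;\ b_1,\ldots,b_\ell\in\mathcal M_P\}$ with $k,\ell\ge0$ and $a_i,b_j\in F$. *)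

(* Defs.v *)
From HB Require Import structures.
From mathcomp Require Import all_boot all_order all_algebra.
From mathcomp Require Import all_classical topology.
(* The notations of mpoly are incompatible with those of the previous line. *)
From mathcomp Require mpoly.
Import -(notations) mpoly.

Set Implicit Arguments.
Unset Strict Implicit.
Unset Printing Implicit Defensive.

Import GRing.Theory.

Local Open Scope classical_set_scope.
Local Open Scope ring_scope.
Local Open Scope quotient_scope.

Definition is_subfield (L : fieldType) (E : set L) : Prop :=
  divring_closed (mem E).

(* The field [K(S)] inside [L]. *)
Definition adjoin (K L : fieldType) (i : {rmorphism K -> L}) (S : set L) :
    set L :=
  smallest (@is_subfield L) (range i `|` S).

Definition fin_gen_ext (K L : fieldType) (i : {rmorphism K -> L}) : Prop :=
  exists s : seq L, adjoin i [set` s] = setT.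

Definition alg_indep (K L : fieldType) (i : {rmorphism K -> L}) (n : nat)
    (t : 'I_n -> L) : Prop :=
  forall p : mpoly n K, mmap i t p = 0 -> p = 0.

Definition algebraic_over (L : fieldType) (E : set L) (y : L) : Prop :=
  exists p : {poly L}, [/\ p \is a polyOver (mem E), p != 0 & root p y].

Definition is_transcendence_basis (K L : fieldType) (i : {rmorphism K -> L})
    (n : nat) (t : 'I_n -> L) : Prop :=
  alg_indep i t /\ forall y : L, algebraic_over (adjoin i (range t)) y.

(* [trdeg L|K = n]; a relation, since the degree may be infinite in general. *)
Definition has_trdeg (K L : fieldType) (i : {rmorphism K -> L}) (n : nat) :
    Prop :=
  exists t : 'I_n -> L, is_transcendence_basis i t.

Definition algebraic_function_field (K F : fieldType)
    (i : {rmorphism K -> F}) : Prop :=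
  fin_gen_ext i /\ exists2 n : nat, (0 < n)%N & has_trdeg i n.

Definition fin_gen_group (A : zmodType) : Prop :=
  exists s : seq A, forall a : A,
    exists c : 'I_(size s) -> int, a = \sum_(k < size s) s`_k *~ c k.

Definition biadditive (A B C : zmodType) (b : A -> B -> C) : Prop :=
  (forall y, {morph (fun x => b x y) : x x' / x + x'}) /\
  (forall x, {morph b x : y y' / y + y'}).

(* [V], with [t q a] in the role of [q (x) a], is the tensor product of the
   abelian groups [rat] and [A], with its vector space structure over [rat]
   coming from the left factor. *)
Definition is_rat_tensor (A : zmodType) (V : lmodType rat)
    (t : rat -> A -> V) : Prop :=
  [/\ biadditive t,
      forall q r a, t (q * r) a = q *: t r a &
      forall (W : zmodType) (b : rat -> A -> W), biadditive b ->
        exists h : {additive V -> W},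
          (forall q a, h (t q a) = b q a) /\
          forall h' : {additive V -> W},
            (forall q a, h' (t q a) = b q a) -> h' =1 h].

Definition has_rational_rank (A : zmodType) (r : nat) : Prop :=
  exists (V : vectType rat) (t : rat -> A -> V),
    is_rat_tensor t /\ \dim {:V} = r.

(* Equivalent places are identified, so a place is its valuation ring [O_P].
   As [0^-1 = 0], the second axiom only has content at nonzero elements.  The
   trivial place, with [O_P = F], is allowed. *)
Record place (F : fieldType) := Place {
  place_ring : {pred F};
  place_ring_closed : subring_closed place_ring;
  place_ringV : forall x : F, (x \in place_ring) || (x^-1 \in place_ring)
}.

HB.instance Definition _ (F : fieldType) (P : place F) :=
  GRing.isSubringClosed.Build F (place_ring P) (place_ring_closed P).

(* The maximal ideal [M_P]; it lies in [O_P] by [place_maxW]. *)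
Definition place_max (F : fieldType) (P : place F) : {pred F} :=
  fun x => (x == 0) || (x^-1 \notin place_ring P).

Section PlaceMax.
Variables (F : fieldType) (P : place F).
Local Notation O := (place_ring P).
Local Notation M := (place_max P).

Lemma place_maxW x : M x -> x \in O.
Proof.
case/orP=> [/eqP-> | /negP xV]; first exact: rpred0.
by case/orP: (place_ringV P x) => // h; case: xV.
Qed.

Lemma place_max1 : ~~ M 1.
Proof. by rewrite /place_max oner_eq0 invr1 rpred1. Qed.

Lemma place_maxMl a x : a \in O -> M x -> M (a * x).
Proof.
move=> aO; rewrite /place_max; case: (eqVneq x 0) => [->|x0]; first by rewrite mulr0 eqxx.
case: (eqVneq a 0) => [->|a0] /=; first by rewrite mul0r eqxx.
rewrite mulf_eq0 (negPf a0) (negPf x0) /=; apply: contra => h.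
have -> : x^-1 = a * (a * x)^-1 by rewrite invfM mulrA divff ?mul1r.
exact: rpredM.
Qed.

Lemma place_maxD x y : M x -> M y -> M (x + y).
Proof.
wlog h : x y / x / y \in O.
  move=> W Mx My; case/orP: (place_ringV P (x / y)) => h; first exact: W.
  by rewrite addrC; apply: W => //; rewrite -invf_div.
move=> Mx My; case: (eqVneq y 0) => [->|y0]; first by rewrite addr0.
have -> : x + y = (x / y + 1) * y by rewrite mulrDl mul1r divfK.
by apply: place_maxMl => //; rewrite rpredD ?rpred1.
Qed.

End PlaceMax.

Definition vring (F : fieldType) (P : place F) : Type :=
  {x : F | x \in place_ring P}.

HB.instance Definition _ (F : fieldType) (P : place F) :=
  Choice.copy (vring P) {x : F | x \in place_ring P}.
HB.instance Definition _ (F : fieldType) (P : place F) :=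
  SubType.copy (vring P) {x : F | x \in place_ring P}.
HB.instance Definition _ (F : fieldType) (P : place F) :=
  [SubChoice_isSubComNzRing of vring P by <:].

Definition vring_max (F : fieldType) (P : place F) : {pred vring P} :=
  fun x => place_max P (val x).

Lemma vring_max_idealr (F : fieldType) (P : place F) :
  idealr_closed (@vring_max F P).
Proof.
split; first by rewrite -topredE /= /vring_max /place_max rmorph0 eqxx.
- by rewrite -topredE /= /vring_max rmorph1 place_max1.
- move=> a x y Mx My; rewrite -topredE /= /vring_max rmorphD rmorphM.
  by apply: place_maxD => //; apply: place_maxMl => //; apply: valP.
Qed.

HB.instance Definition _ (F : fieldType) (P : place F) :=
  isIdealr.Build (vring P) (@vring_max F P) (@vring_max_idealr F P).

Definition residue_field (F : fieldType) (P : place F) : Type :=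
  {ideal_quot (@vring_max F P)}.

HB.instance Definition _ (F : fieldType) (P : place F) :=
  GRing.ComNzRing.copy (residue_field P) {ideal_quot (@vring_max F P)}.

Definition residue (F : fieldType) (P : place F) (x : vring P) :
  residue_field P := \pi_{ideal_quot (@vring_max F P)} x.

Lemma residue_zmod_morphism (F : fieldType) (P : place F) :
  zmod_morphism (@residue F P).
Proof. exact: raddfB. Qed.

Lemma residue_monoid_morphism (F : fieldType) (P : place F) :
  monoid_morphism (@residue F P).
Proof. by split; [exact: rmorph1 | exact: rmorphM]. Qed.

HB.instance Definition _ (F : fieldType) (P : place F) :=
  GRing.isZmodMorphism.Build (vring P) (residue_field P) (@residue F P)
    (@residue_zmod_morphism F P).
HB.instance Definition _ (F : fieldType) (P : place F) :=
  GRing.isMonoidMorphism.Build (vring P) (residue_field P) (@residue F P)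
    (@residue_monoid_morphism F P).

Lemma residue_eq (F : fieldType) (P : place F) (x y : vring P) :
  (residue x == residue y) = place_max P (val x - val y).
Proof. by rewrite /residue -Quotient.idealrBE -topredE /= /vring_max rmorphB. Qed.

Lemma residue_eq0 (F : fieldType) (P : place F) (x : vring P) :
  (residue x == 0) = place_max P (val x).
Proof. by rewrite -(rmorph0 (@residue F P)) residue_eq rmorph0 subr0. Qed.

Lemma residue_surj (F : fieldType) (P : place F) (a : residue_field P) :
  exists x : vring P, residue x = a.
Proof. by exists (repr a); rewrite /residue reprK. Qed.

Lemma residue_field_inv (F : fieldType) (P : place F) (a : residue_field P) :
  a != 0 -> exists b, b * a = 1.
Proof.
have [x <-] := residue_surj a; rewrite residue_eq0 /place_max negb_or negbK.
case/andP=> x0 xV; exists (residue (exist _ (val x)^-1 xV : vring P)).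
apply/eqP; rewrite -rmorphM -(rmorph1 (@residue F P)) residue_eq rmorphM rmorph1 /=.
by rewrite mulVf // subrr /place_max eqxx.
Qed.

Definition residue_inv (F : fieldType) (P : place F) (a : residue_field P) :
    residue_field P :=
  xget 0 [set b | b * a = 1].

Lemma residue_mulVf (F : fieldType) (P : place F) (a : residue_field P) :
  a != 0 -> residue_inv a * a = 1.
Proof.
by move=> /residue_field_inv[b ba]; apply: (@xgetPex _ 0 [set b | b * a = 1]); exists b.
Qed.

Lemma residue_inv0 (F : fieldType) (P : place F) :
  residue_inv (0 : residue_field P) = 0.
Proof.
rewrite /residue_inv; case: xgetP => // b _ /=; rewrite mulr0 => /esym/eqP.
by rewrite oner_eq0.
Qed.

HB.instance Definition _ (F : fieldType) (P : place F) :=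
  GRing.ComNzRing_isField.Build (residue_field P)
    (@residue_mulVf F P) (@residue_inv0 F P).

(* The multiplicative group [F^*], written additively. *)
Definition mult_group (F : fieldType) : Type := {x : F | x != 0}.

HB.instance Definition _ (F : fieldType) :=
  Choice.copy (mult_group F) {x : F | x != 0}.
HB.instance Definition _ (F : fieldType) :=
  SubType.copy (mult_group F) {x : F | x != 0}.

Section MultGroup.
Variable F : fieldType.
Implicit Types x y : mult_group F.

Definition mg_zero : mult_group F := exist _ 1 (oner_neq0 F).
Definition mg_add x y : mult_group F :=
  exist _ (val x * val y) (mulf_neq0 (valP x) (valP y)).
Definition mg_opp x : mult_group F :=
  exist _ (val x)^-1 (invr_neq0 (valP x)).

Fact mg_addA : associative mg_add.
Proof. by move=> x y z; apply: val_inj; rewrite /= mulrA. Qed.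
Fact mg_addC : commutative mg_add.
Proof. by move=> x y; apply: val_inj; rewrite /= mulrC. Qed.
Fact mg_add0 : left_id mg_zero mg_add.
Proof. by move=> x; apply: val_inj; rewrite /= mul1r. Qed.
Fact mg_addN : left_inverse mg_zero mg_opp mg_add.
Proof. by move=> x; apply: val_inj; rewrite /= mulVf ?(valP x). Qed.

End MultGroup.

HB.instance Definition _ (F : fieldType) :=
  GRing.isZmodule.Build (mult_group F)
    (@mg_addA F) (@mg_addC F) (@mg_add0 F) (@mg_addN F).

Definition place_units (F : fieldType) (P : place F) : {pred mult_group F} :=
  fun x => (val x \in place_ring P) && ((val x)^-1 \in place_ring P).

Lemma place_units_closed (F : fieldType) (P : place F) :
  zmod_closed (@place_units F P).
Proof.
split=> [|x y]; rewrite -!topredE /= /place_units /= ?invr1 ?rpred1 //.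
case/andP=> xO xV /andP[yO yV]; rewrite rpredM //=.
by rewrite invfM invrK rpredM.
Qed.

HB.instance Definition _ (F : fieldType) (P : place F) :=
  GRing.isZmodClosed.Build (mult_group F) (@place_units F P)
    (@place_units_closed F P).

(* [v_P F = F^* / O_P^*], up to isomorphism the value group of any valuation
   associated with [P]; its ordering plays no role here. *)
Definition value_group (F : fieldType) (P : place F) : zmodType :=
  @Quotient.quot (mult_group F) (@place_units F P).

Definition valuation (F : fieldType) (P : place F) (x : mult_group F) :
    value_group P :=
  \pi_(@Quotient.quot (mult_group F) (@place_units F P)) x.

Section PlacesOver.
Variables (K F : fieldType) (i : {rmorphism K -> F}) (wp : place K).

Record places_over := PlaceOver {
  place_over :> place F;
  place_overE : forall c : K, (i c \in place_ring place_over) = (c \in place_ring wp)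
}.

Definition vring_map (P : places_over) (x : vring wp) : vring P :=
  exist _ (i (val x)) (etrans (place_overE P (val x)) (valP x)).

(* The embedding of [K wp] into [F P]. *)
Definition residue_map (P : places_over) (a : residue_field wp) :
    residue_field P :=
  residue (vring_map P (repr a)).

Lemma residue_mapE (P : places_over) (x : vring wp) :
  residue_map P (residue x) = residue (vring_map P x).
Proof.
have h : residue (repr (residue x)) = residue x by rewrite /residue reprK.
apply/eqP; move/eqP: h; rewrite /residue_map !residue_eq /= -rmorphB.
rewrite /place_max fmorph_eq0 -fmorphV.
by rewrite place_overE.
Qed.

Lemma residue_map_zmod_morphism (P : places_over) :
  zmod_morphism (residue_map P).
Proof.
move=> a b; have [x <-] := residue_surj a; have [y <-] := residue_surj b.
rewrite -rmorphB !residue_mapE -rmorphB; congr residue.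
by apply: val_inj; rewrite /= rmorphB.
Qed.

Lemma residue_map_monoid_morphism (P : places_over) :
  monoid_morphism (residue_map P).
Proof.
split=> [|a b].
  rewrite -(rmorph1 (@residue K wp)) residue_mapE -(rmorph1 (@residue F P)).
  by congr residue; apply: val_inj; rewrite /= rmorph1.
have [x <-] := residue_surj a; have [y <-] := residue_surj b.
rewrite -rmorphM !residue_mapE -rmorphM; congr residue.
by apply: val_inj; rewrite /= rmorphM.
Qed.

HB.instance Definition _ (P : places_over) :=
  GRing.isZmodMorphism.Build (residue_field wp) (residue_field P)
    (residue_map P) (residue_map_zmod_morphism P).
HB.instance Definition _ (P : places_over) :=
  GRing.isMonoidMorphism.Build (residue_field wp) (residue_field P)
    (residue_map P) (residue_map_monoid_morphism P).

Definition mult_group_map (c : mult_group K) : mult_group F :=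
  exist _ (i (val c)) (etrans (congr1 negb (fmorph_eq0 i (val c))) (valP c)).

(* [v_wp K] as a subgroup of [v_P F]: since [P] extends [wp], it consists of
   the values under [v_P] of the nonzero elements of [K]. *)
Definition base_values (P : places_over) : {pred value_group P} :=
  fun g => `[< exists c : mult_group K, g = valuation P (mult_group_map c) >].

Lemma base_values_closed (P : places_over) : zmod_closed (@base_values P).
Proof.
split=> [|g h].
  apply/asboolP; exists 0; rewrite /valuation -[LHS](raddf0 (\pi_(@Quotient.quot (mult_group F) (@place_units F P)))).
  by congr (\pi_(_) _); apply: val_inj; rewrite /= rmorph1.
move=> /asboolP[c ->] /asboolP[d ->]; apply/asboolP; exists (c - d).
rewrite /valuation -raddfB; congr (\pi_(_) _); apply: val_inj.
by rewrite /= rmorphM fmorphV.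
Qed.

HB.instance Definition _ (P : places_over) :=
  GRing.isZmodClosed.Build (value_group P) (@base_values P)
    (@base_values_closed P).

Definition relative_value_group (P : places_over) : zmodType :=
  @Quotient.quot (value_group P) (@base_values P).

Definition value_group_fg (P : places_over) : Prop :=
  fin_gen_group (relative_value_group P).

Definition residue_field_fg (P : places_over) : Prop :=
  fin_gen_ext (residue_map P).

Definition has_dim (P : places_over) (d : nat) : Prop :=
  has_trdeg (residue_map P) d.

Definition has_rr (P : places_over) (r : nat) : Prop :=
  has_rational_rank (relative_value_group P) r.

Definition abhyankar (P : places_over) : Prop :=
  exists n d r : nat,
    [/\ has_trdeg i n, has_dim P d, has_rr P r & n = (d + r)%N].

Definition patch_index : Type := (seq F * seq F)%type.
HB.instance Definition _ := Choice.copy patch_index (seq F * seq F)%type.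
HB.instance Definition _ := isPointed.Build patch_index ([::], [::]).

Definition patch_base (ab : patch_index) : set places_over :=
  [set P | (forall a, a \in ab.1 -> a \in place_ring P) /\
           (forall b, b \in ab.2 -> b \in place_max P)].

Lemma patch_base_cover : \bigcup_(ab in setT) patch_base ab = setT.
Proof. by apply/seteqP; split=> // P _; exists ([::], [::]). Qed.

Lemma patch_base_join ab cd (P : places_over) :
  setT ab -> setT cd -> patch_base ab P -> patch_base cd P ->
  exists ef, [/\ setT ef, patch_base ef P &
    patch_base ef `<=` patch_base ab `&` patch_base cd].
Proof.
move=> _ _ [a1 a2] [b1 b2]; exists (ab.1 ++ cd.1, ab.2 ++ cd.2); split=> //.
  by split=> x /=; rewrite mem_cat => /orP[]; auto.
move=> Q /= [h1 h2]; split; split=> x xs;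
  by [apply: h1; rewrite /= mem_cat xs ?orbT | apply: h2; rewrite /= mem_cat xs ?orbT].
Qed.

HB.instance Definition _ := gen_eqMixin places_over.
HB.instance Definition _ := gen_choiceMixin places_over.
HB.instance Definition _ := @isBaseTopological.Build places_over
  patch_index setT patch_base patch_base_cover patch_base_join.

End PlacesOver.

(* Main.v *)
Require Import Defs.
From HB Require Import structures.
From mathcomp Require Import all_boot all_order all_algebra.
From mathcomp Require Import fieldext.
From mathcomp Require Import all_classical topology.
From mathcomp Require mpoly.
Import -(notations) mpoly.

Set Implicit Arguments.
Unset Strict Implicit.
Unset Printing Implicit Defensive.

Import GRing.Theory Num.Theory.

Local Open Scope classical_set_scope.
Local Open Scope ring_scope.
Local Open Scope quotient_scope.

(** Both parts follow from the second.  Let [P] be a place of [F] over [wp] and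
    let finitely many conditions [a \in O], [b \in M] hold at [P].

    Suppose first that [P] is nontrivial on a subfield [E] of [F] containing [K].
    The main result, [residually_transcendental_near], gives a place [Q] that
    agrees with [P] on [E], satisfies the conditions, and has as many elements
    [z] with algebraically independent residues over the residue field of [E] as
    the transcendence degree of [F] over [E].  Such a [Q] is a Gauss valuation
    on [E(z)]: it has the same values there as on [E], and the residue field is
    generated by the residues of [z].  Since [F] is a finite extension of [E(z)],
    the values of [F] are finitely many modulo those of [E], and the residue
    field is finite over that of [E(z)]; this proves finite generation.  If [P]
    is nontrivial on [K] take for [E] the image of [K]; the rational rank is 0
    and the dimension is the transcendence degree.  If [P] is trivial on [K] but
    not on [F], take [E = K(t)] with [t] in the maximal ideal of [P], on which
    [P] is [t]-adic, so that the rational rank is 1.  If [P] is trivial on [F],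
    it is itself an Abhyankar place, with residue field [F].

    For the main result, [F] is embedded in an algebraically closed field, [P] is
    extended to it, and a list [ts] such that [F] is algebraic over [E(ts)] gives
    a tower of algebraically closed subfields, each the algebraic closure of [L(t)] for
    the previous one [L].  It is enough to push finitely many conditions at [P]
    down one storey of the tower, in such a way that each place satisfying the
    new conditions on [L] can be modified above [L] so as to satisfy the old ones
    and to have a residue transcendental over that of [L] ([tower_open]).

    Conditions on the closure of [L(t)] are first replaced with conditions on
    [L(t)] ([alg_open]): finitely many conditions on algebraic elements follow
    from the single condition that some algebraic [r] be integral, and for this
    it is enough that a primitive multiple of the minimal polynomial of [r] be
    nonconstant modulo the maximal ideal.  In [L(t)] every nonzero element
    is a constant times a product of powers of linear factors.  With [e] in [L] a root for which [t - e] has the largest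
    value, each of the given elements has the same value as a monomial [D (t - e)^N]
    with [D] in [L], and the conditions become linear inequalities on the value
    of [t - e].  The value group of [L] is divisible and nontrivial, so these
    inequalities have a solution which is the value of some [w] in [L]
    ([constr_solve]).  The inequalities satisfied by [w] are conditions on [L],
    and a place satisfying them has a Gauss extension to [L(t)] for which the
    residue of [(t - e) / w] is transcendental; it satisfies the old conditions
    ([transc_open]). *)

(** * Places with prescribed rings and ideals: Chevalley's theorem *)

Section PlaceBasics.
Variables (F : fieldType) (P : place F).
Local Notation O := (place_ring P).
Local Notation M := (place_max P).

Lemma place_maxE x : (x \in M) = (x \in O) && ((x == 0) || (x^-1 \notin O)).
Proof.
rewrite -topredE /=; apply/idP/andP => [Mx|[]//].
by split=> //; apply: place_maxW.
Qed.

Lemma place_max0 : 0 \in M.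
Proof. by rewrite -topredE /= /place_max eqxx. Qed.

Lemma place_max1F : (1 \in M) = false.
Proof. by apply: negbTE; rewrite -topredE /= place_max1. Qed.

Lemma place_max_oppr : oppr_closed M.
Proof. by move=> x; rewrite -!topredE /= /place_max oppr_eq0 invrN rpredN. Qed.

Lemma place_max_zmod : zmod_closed M.
Proof.
split=> [|x y Mx My]; first exact: place_max0.
by apply: place_maxD => //; apply: place_max_oppr.
Qed.

HB.instance Definition _ := GRing.isZmodClosed.Build F (place_max P) place_max_zmod.

Lemma place_maxMr a x : a \in O -> x \in M -> a * x \in M.
Proof. by move=> aO xM; apply: place_maxMl. Qed.

Lemma place_max_ring x : x \in M -> x \in O.
Proof. exact: place_maxW. Qed.

Lemma place_unitV x : x \in O -> x \notin M -> x^-1 \in O.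
Proof. by move=> xO; rewrite place_maxE xO /= negb_or negbK => /andP[]. Qed.

Lemma place_unit_neq0 x : x \notin M -> x != 0.
Proof. by apply: contraNneq => ->; apply: place_max0. Qed.

Lemma place_notinV x : x \notin O -> x^-1 \in M.
Proof.
move=> xO; rewrite place_maxE invrK xO orbT andbT.
by have := place_ringV P x; rewrite (negPf xO).
Qed.

Lemma place_maxV x : x != 0 -> (x^-1 \in M) = (x \notin O).
Proof.
move=> x0; rewrite place_maxE invrK invr_eq0 (negPf x0) /=.
by have := place_ringV P x; case: (x \in O) => /= [_|->]; rewrite ?andbF.
Qed.

Lemma place_prime x y : x \in O -> y \in O -> x * y \in M -> (x \in M) || (y \in M).
Proof.
move=> xO yO xyM; apply: contraT; rewrite negb_or => /andP[xM yM].
have xV := place_unitV xO xM.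
by rewrite -(mulKf (place_unit_neq0 xM) y) place_maxMr in yM.
Qed.

Lemma place_unitM x y : x \in O -> y \in O -> x \notin M -> y \notin M ->
  x * y \notin M.
Proof.
by move=> xO yO xM yM; apply/negP => /place_prime -/(_ xO yO); rewrite (negPf xM) (negPf yM).
Qed.

Lemma place_unitD x y : x \notin M -> y \in M -> x + y \notin M.
Proof. by move=> xM yM; rewrite rpredDr. Qed.

End PlaceBasics.

Section Chevalley.
Variable F : fieldType.

(** A subring with a proper ideal of it.  Both are plain sets, so that the members
    of a chain can be united. *)
Record ideal_pair (A I : set F) : Prop := IdealPair {
  pi_1 : A 1;
  pi_B : forall x y, A x -> A y -> A (x - y);
  pi_M : forall x y, A x -> A y -> A (x * y);
  pi_sub : I `<=` A;
  pi_0 : I 0;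
  pi_IB : forall x y, I x -> I y -> I (x - y);
  pi_IM : forall x y, A x -> I y -> I (x * y);
  pi_proper : ~ I 1 }.

Section Ideal.
Variables (A I : set F) (AI : ideal_pair A I).

Lemma pi_A0 : A 0. Proof. exact/(pi_sub AI)/(pi_0 AI). Qed.
Lemma pi_AN x : A x -> A (- x).
Proof. by rewrite -sub0r; apply: (pi_B AI); apply: pi_A0. Qed.
Lemma pi_AD x y : A x -> A y -> A (x + y).
Proof. by move=> Ax Ay; rewrite -[y]opprK; apply: (pi_B AI) => //; apply: pi_AN. Qed.
Lemma pi_IN x : I x -> I (- x).
Proof. by rewrite -sub0r; apply: (pi_IB AI); apply: (pi_0 AI). Qed.
Lemma pi_ID x y : I x -> I y -> I (x + y).
Proof. by move=> Ax Ay; rewrite -[y]opprK; apply: (pi_IB AI) => //; apply: pi_IN. Qed.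
Lemma pi_Asum (J : finType) (f : J -> F) : (forall j, A (f j)) -> A (\sum_j f j).
Proof. by move=> h; apply: (big_ind A) => //; [apply: pi_A0|apply: pi_AD]. Qed.
Lemma pi_Isum (J : finType) (f : J -> F) : (forall j, I (f j)) -> I (\sum_j f j).
Proof. by move=> h; apply: (big_ind I) => //; [apply: (pi_0 AI)|apply: pi_ID]. Qed.
Lemma pi_AX x k : A x -> A (x ^+ k).
Proof.
by move=> Ax; elim: k => [|k IH]; rewrite ?expr0 ?exprS; [apply: (pi_1 AI)|apply: (pi_M AI)].
Qed.
Lemma pi_1X j k : I j -> I (1 - (1 - j) ^+ k).
Proof.
move=> Ij; elim: k => [|k IH]; first by rewrite expr0 subrr; apply: (pi_0 AI).
have -> : 1 - (1 - j) ^+ k.+1 = (1 - (1 - j) ^+ k) + (1 - j) ^+ k * j.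
  by rewrite exprSr mulrBr mulr1 opprB addrA addrAC.
apply: pi_ID => //; apply: (pi_IM AI) => //; apply: pi_AX.
by apply: (pi_B AI); [apply: (pi_1 AI)|apply: (pi_sub AI)].
Qed.

(** The ring [A[x]] for a ring [S = A], and the ideal generated by [I] in it for
    an ideal [S = I] of [A]. *)
Definition poly_values (S : set F) (x : F) : set F :=
  [set y | exists2 p : {poly F}, forall k, S p`_k & y = p.[x]].

Lemma poly_values_sub S x : S 0 -> S `<=` poly_values S x.
Proof.
move=> S0 y Sy; exists y%:P; last by rewrite hornerC.
by move=> k; rewrite coefC; case: ifP.
Qed.

Lemma poly_values_ideal x : ~ poly_values I x 1 -> ideal_pair (poly_values A x) (poly_values I x).
Proof.
move=> I1; split=> //.
- by apply: poly_values_sub; [apply: pi_A0|apply: (pi_1 AI)].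
- move=> _ _ [p Ap ->] [q Aq ->]; exists (p - q); last by rewrite !hornerE.
  by move=> k; rewrite coefB; apply: (pi_B AI).
- move=> _ _ [p Ap ->] [q Aq ->]; exists (p * q); last by rewrite hornerM.
  by move=> k; rewrite coefM; apply: pi_Asum => j; apply: (pi_M AI).
- by move=> _ [p Ap ->]; exists p => // k; apply: (pi_sub AI).
- exists 0; first by move=> k; rewrite coef0; apply: (pi_0 AI).
  by rewrite horner0.
- move=> _ _ [p Ap ->] [q Aq ->]; exists (p - q); last by rewrite !hornerE.
  by move=> k; rewrite coefB; apply: (pi_IB AI).
- move=> _ _ [p Ap ->] [q Aq ->]; exists (p * q); last by rewrite hornerM.
  by move=> k; rewrite coefM; apply: pi_Isum => j; apply: (pi_IM AI).
Qed.

End Ideal.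

Section Maximal.
Variables (A I : set F) (AI : ideal_pair A I).
Hypothesis max_AI : forall B J, ideal_pair B J -> A `<=` B -> I `<=` J ->
  B `<=` A /\ J `<=` I.

(** By maximality, the ideal generated by [I] in [A[x]] is not proper unless
    [A[x] = A]. *)
Lemma max_ideal_adjoin x : A x \/ poly_values I x 1.
Proof.
case: (pselect (poly_values I x 1)) => [|h]; [by right|left].
have [] := max_AI (poly_values_ideal AI h).
- exact/poly_values_sub/(pi_A0 AI).
- exact/poly_values_sub/(pi_0 AI).
move=> + _; apply; exists 'X; last by rewrite hornerX.
move=> k; rewrite coefX; case: eqP => _; [exact: (pi_1 AI)|exact: (pi_A0 AI)].
Qed.

(** Otherwise [1] is a polynomial in [(1 - j)^-1] with coefficients in [I], and
    clearing denominators puts a power of [1 - j], hence [1], in [I]. *)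
Lemma max_ideal_unit_1B j : I j -> A (1 - j)^-1.
Proof.
move=> Ij; have j1 : 1 - j != 0.
  by rewrite subr_eq0; apply/eqP => e; apply: (pi_proper AI); rewrite e.
have Aj : A (1 - j) by apply: (pi_B AI); [apply: (pi_1 AI)|apply: (pi_sub AI)].
case: (max_ideal_adjoin (1 - j)^-1) => // -[p Ip] /(congr1 (fun y => y * (1 - j) ^+ size p)).
rewrite mul1r horner_coef mulr_suml => e; case: (pi_proper AI).
rewrite -[1](subrK ((1 - j) ^+ size p)); apply: (pi_ID AI); first exact: (pi_1X AI).
rewrite e; apply: (pi_Isum AI) => k; rewrite -mulrA mulrC; apply: (pi_IM AI) => //.
case: k => k /= /ltnW kp; rewrite exprVn -(subnKC kp) exprD mulKf ?expf_neq0 //.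
exact: (pi_AX AI).
Qed.

(** The relation [q.[x^-1] = 1] expresses a power of [x] through smaller ones, as
    [1 - q`_0] is invertible; substituting it for the leading term of [p] lowers
    the degree of [p].  This rules out that neither [x] nor [x^-1] is in [A]. *)
Lemma max_ideal_no_pair N x (p q : {poly F}) : (size p + size q <= N)%N ->
  (forall k, I p`_k) -> (forall k, I q`_k) -> x != 0 ->
  p.[x] = 1 -> q.[x^-1] = 1 -> False.
Proof.
elim: N x p q => [|N IH] x p q.
  rewrite leqn0 addn_eq0 size_poly_eq0 => /andP[/eqP-> _] _ _ _ /eqP.
  by rewrite horner0 eq_sym oner_eq0.
move=> hN; wlog hs : x p q hN / (size q <= size p)%N.
  move=> W Ip Iq x0 p1 q1; case: (leqP (size q) (size p)) => [|/ltnW] h.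
    exact: (W x p q).
  by apply: (W x^-1 q p) => //; rewrite ?invrK ?invr_eq0 // addnC.
move=> Ip Iq x0 p1 q1.
have Iq0 := Iq 0%N; set c := (1 - q`_0)^-1.
have Ac : A c by apply: max_ideal_unit_1B.
have c0 : 1 - q`_0 != 0.
  by rewrite subr_eq0; apply/eqP => e; apply: (pi_proper AI); rewrite e.
have sq : (1 < size q)%N.
  rewrite ltnNge; apply/negP => /size1_polyC e; move: q1; rewrite e hornerC => e1.
  by apply: (pi_proper AI); rewrite -e1.
have sp := leq_trans sq hs.
pose n := (size p).-1; have Dn : size p = n.+1 by rewrite prednK // ltnW.
pose m := (size q).-1; have Dm : size q = m.+1 by rewrite prednK // ltnW.
have mn : (m <= n)%N by rewrite -ltnS -Dm -Dn.
(* The sum of the terms [c q_k x^(n-k)] for [0 < k <= m]. *)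
pose r := \poly_(i < n) (if (n - m <= i)%N then c * q`_(n - i) else 0).
have rx : r.[x] = x ^+ n.
  move: q1; rewrite horner_coef Dm big_ord_recl /= expr0 mulr1 => q1.
  have {}q1 : \sum_(i < m) q`_i.+1 * x^-1 ^+ i.+1 = 1 - q`_0 by rewrite -q1 addrC addKr.
  have -> : x ^+ n = c * (\sum_(i < m) q`_i.+1 * x^-1 ^+ i.+1) * x ^+ n.
    by rewrite q1 mulVf // mul1r.
  rewrite /r horner_poly -(subnK mn) -mulrA mulr_suml mulr_sumr big_split_ord /=.
  rewrite subnK // big1 ?add0r; last first.
    by move=> i _; rewrite leqNgt ltn_ord mul0r.
  rewrite (reindex_inj rev_ord_inj) /=; apply: eq_bigr => i _.
  rewrite leq_addr.
  have im : (i.+1 <= m)%N := ltn_ord i.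
  have -> : (n - (n - m + (m - i.+1)) = i.+1)%N by rewrite subnDA subKn // subKn.
  rewrite -!mulrA; congr (_ * (_ * _)).
  rewrite exprVn addnBA // subnK //.
  by rewrite -[in RHS](subnKC (leq_trans im mn)) exprD mulKf ?expf_neq0.
have sr : (size r <= n)%N by apply: size_poly.
pose p' := (\poly_(i < n) p`_i) + p`_n *: r.
apply: (IH x p' q) => //.
- have : (size p' <= n)%N.
    rewrite (leq_trans (size_polyD _ _)) // geq_max size_poly /=.
    exact: leq_trans (size_scale_leq _ _) sr.
  by move=> h; rewrite -ltnS (leq_trans _ hN) // Dn addSn ltnS leq_add2r.
- move=> k; rewrite coefD coefZ !coef_poly; apply: (pi_ID AI).
    by case: ifP => // _; apply: (pi_0 AI).
  case: ifP => _; last by rewrite mulr0; apply: (pi_0 AI).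
  case: ifP => _; last by rewrite mulr0; apply: (pi_0 AI).
  rewrite mulrC; apply: (pi_IM AI) => //; apply: (pi_M AI) => //.
  exact: (pi_sub AI).
- rewrite hornerD hornerZ rx -p1 horner_poly [in RHS]horner_coef Dn big_ord_recr /=.
  by [].
Qed.

Lemma max_ideal_valuation x : A x \/ A x^-1.
Proof.
case: (eqVneq x 0) => [->|x0]; first by left; apply: (pi_A0 AI).
case: (max_ideal_adjoin x) => [|[p Ip p1]]; first by left.
case: (max_ideal_adjoin x^-1) => [|[q Iq q1]]; first by right.
by have := max_ideal_no_pair (leqnn _) Ip Iq x0 (esym p1) (esym q1).
Qed.

End Maximal.

(** The valuation ring is a subring that is maximal for the domination order on
    pairs.  To apply Zorn's lemma to unions of sets, a pair is encoded as one set
    of tagged elements; the empty set is included as the union of the empty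
    chain. *)
Theorem chevalley (A I : set F) : ideal_pair A I ->
  exists P : place F, (forall x, A x -> x \in place_ring P) /\
                      (forall x, I x -> x \in place_max P).
Proof.
move=> AI; pose B1 (X : set (F * bool)) : set F := [set x | X (x, true)].
pose J1 (X : set (F * bool)) : set F := [set x | X (x, false)].
pose good X := X = set0 \/ [/\ ideal_pair (B1 X) (J1 X), A `<=` B1 X & I `<=` J1 X].
have [X [gX maxX]] : exists X, good X /\ forall Y, X `<` Y -> ~ good Y.
  apply: Zorn_bigcup => C Cg Ctot.
  case: (pselect (exists2 X, C X & X <> set0)) => [[X0 CX0 X0n]|h]; last first.
    left; rewrite -subset0 => z [X CX Xz]; apply: h; exists X => // X0.
    by rewrite X0 in Xz.
  right.
  have C2 X Y z w : C X -> C Y -> X z -> Y w ->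
    exists Z, [/\ C Z, Z z, Z w & ideal_pair (B1 Z) (J1 Z)].
    move=> CX CY Xz Yw; case: (Ctot X Y CX CY) => h.
      case: (Cg _ CY) => [Y0|[gY _ _]]; first by rewrite Y0 in Yw.
      by exists Y; split=> //; apply: h.
    case: (Cg _ CX) => [X00|[gX _ _]]; first by rewrite X00 in Xz.
    by exists X; split=> //; apply: h.
  have [gX0 AX0 IX0] : [/\ ideal_pair (B1 X0) (J1 X0), A `<=` B1 X0 & I `<=` J1 X0].
    by case: (Cg _ CX0).
  split; first last.
  - by move=> x Ix; exists X0 => //; apply: IX0.
  - by move=> x Ax; exists X0 => //; apply: AX0.
  split.
  - by exists X0 => //; apply: (pi_1 gX0).
  - move=> x y [X CX Xx] [Y CY Yy]; have [Z [CZ Zx Zy gZ]] := C2 _ _ _ _ CX CY Xx Yy.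
    by exists Z => //; apply: (pi_B gZ).
  - move=> x y [X CX Xx] [Y CY Yy]; have [Z [CZ Zx Zy gZ]] := C2 _ _ _ _ CX CY Xx Yy.
    by exists Z => //; apply: (pi_M gZ).
  - move=> x [X CX Xx]; have [Z [CZ Zx _ gZ]] := C2 _ _ _ _ CX CX Xx Xx.
    by exists Z => //; apply: (pi_sub gZ).
  - by exists X0 => //; apply: (pi_0 gX0).
  - move=> x y [X CX Xx] [Y CY Yy]; have [Z [CZ Zx Zy gZ]] := C2 _ _ _ _ CX CY Xx Yy.
    by exists Z => //; apply: (pi_IB gZ).
  - move=> x y [X CX Xx] [Y CY Yy]; have [Z [CZ Zx Zy gZ]] := C2 _ _ _ _ CX CY Xx Yy.
    by exists Z => //; apply: (pi_IM gZ).
  - move=> [X CX Xx]; have [Z [CZ Zx _ gZ]] := C2 _ _ _ _ CX CX Xx Xx.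
    exact: (pi_proper gZ).
case: gX => [X0|[gX AX IX]].
  pose Y : set (F * bool) := [set z | if z.2 then A z.1 else I z.1].
  case: (maxX Y); last by right; split; [exact: AI|exact: subset_refl|exact: subset_refl].
  rewrite X0; split; first exact: sub0set.
  by move=> /(_ (1, true) (pi_1 AI)).
have mX B J : ideal_pair B J -> B1 X `<=` B -> J1 X `<=` J -> B `<=` B1 X /\ J `<=` J1 X.
  move=> gB sB sJ; pose Y : set (F * bool) := [set z | if z.2 then B z.1 else J z.1].
  have XY : X `<=` Y by move=> [x []] /= Xx; [apply: sB|apply: sJ].
  case: (pselect (Y `<=` X)) => [h|h].
    by split=> x xB; [apply: (h (x, true))|apply: (h (x, false))].
  case: (maxX Y) => //; right; split=> // x h'; [exact/sB/AX|exact/sJ/IX].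
pose O : {pred F} := fun x => `[< B1 X x >].
have Oc : subring_closed O.
  split=> [|x y|x y]; rewrite -!topredE /=.
  - by apply/asboolP; apply: (pi_1 gX).
  - by move=> /asboolP hx /asboolP hy; apply/asboolP; apply: (pi_B gX).
  - by move=> /asboolP hx /asboolP hy; apply/asboolP; apply: (pi_M gX).
have OV x : (x \in O) || (x^-1 \in O).
  rewrite -!topredE /=; apply/orP.
  by case: (max_ideal_valuation gX mX x) => h; [left|right]; apply/asboolP.
exists (Place Oc OV); split=> x h; first exact/asboolP/AX.
rewrite place_maxE; apply/andP; split.
  exact/asboolP/(pi_sub gX)/IX.
case: eqP => //= /eqP x0; apply/negP => /asboolP xV.
apply: (pi_proper gX); rewrite -(mulVf x0); apply: (pi_IM gX) => //; exact: IX.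
Qed.

End Chevalley.

(** * Subfields and algebraic elements *)

(** Bundled, so that the closure properties of predicates and [polyOver] apply. *)
Record subfield (F : fieldType) := Subfield {
  subfield_pred :> {pred F};
  subfield_closed : divring_closed subfield_pred
}.

HB.instance Definition _ (F : fieldType) (E : subfield F) :=
  GRing.isDivringClosed.Build F (subfield_pred E) (subfield_closed E).

Definition subfield_type (F : fieldType) (E : subfield F) : Type :=
  {x : F | x \in subfield_pred E}.

HB.instance Definition _ (F : fieldType) (E : subfield F) :=
  Choice.copy (subfield_type E) {x : F | x \in subfield_pred E}.
HB.instance Definition _ (F : fieldType) (E : subfield F) :=
  SubType.copy (subfield_type E) {x : F | x \in subfield_pred E}.
HB.instance Definition _ (F : fieldType) (E : subfield F) :=
  [SubChoice_isSubIntegralDomain of subfield_type E by <:].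
HB.instance Definition _ (F : fieldType) (E : subfield F) :=
  [SubIntegralDomain_isSubField of subfield_type E by <:].

Section Algebraic.
Variable F : fieldType.
Implicit Types (E : subfield F) (p q : {poly F}).

Definition alg E (y : F) : Prop :=
  exists p : {poly F}, [/\ p \is a polyOver E, p != 0 & root p y].

Lemma polyOver_lift E p : p \is a polyOver E ->
  exists q : {poly subfield_type E}, p = map_poly val q.
Proof.
move=> /polyOverP pE; exists (\poly_(k < size p) (exist _ p`_k (pE k) : subfield_type E)).
apply/polyP => k; rewrite coef_map coef_poly /=; case: ltnP => // h.
by rewrite nth_default // rmorph0.
Qed.

Lemma polyOver_map E (q : {poly subfield_type E}) : map_poly val q \is a polyOver E.
Proof. by apply/polyOverP => k; rewrite coef_map /=; case: q`_k. Qed.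

Lemma algP E y : alg E y <-> algebraicOver (val : subfield_type E -> F) y.
Proof.
split=> [[p [pE p0 py]]|[q q0 qy]].
  have [q Dp] := polyOver_lift pE; exists q; last by rewrite -Dp.
  by move: p0; rewrite Dp map_poly_eq0.
by exists (map_poly val q); split; rewrite ?polyOver_map ?map_poly_eq0.
Qed.

Lemma algI E y : alg E y <-> integralOver (val : subfield_type E -> F) y.
Proof. by rewrite algP; apply: integral_algebraic. Qed.

Lemma alg_id E y : y \in E -> alg E y.
Proof.
move=> yE; exists ('X - y%:P); split; first by rewrite polyOverXsubC.
- by rewrite polyXsubC_eq0.
- by rewrite root_XsubC.
Qed.

Lemma alg_closed_subproof E : divring_closed (fun y => `[< alg E y >] : bool).
Proof.
split=> [|x y|x y]; rewrite -!topredE /=.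
- by apply/asboolP/alg_id; rewrite rpred1.
- move=> /asboolP/algI hx /asboolP/algI hy; apply/asboolP/algI.
  exact: integral_sub.
- move=> /asboolP/algI hx /asboolP/algI hy; apply/asboolP/algI.
  exact: integral_div.
Qed.

(** The closure is relative to [F]. *)
Definition alg_closure E : subfield F := Subfield (@alg_closed_subproof E).

Lemma alg_closureP E y : reflect (alg E y) (y \in alg_closure E).
Proof. exact: asboolP. Qed.

(** This is the transitivity of algebraicity: the coefficients of [p] are only
    assumed to be algebraic over [E]. *)
Lemma alg_trans E p y : (forall k, alg E p`_k) -> p != 0 -> root p y -> alg E y.
Proof.
move=> pE p0 py; apply/algI/(integral_root p0 py).
apply/integral_poly => k; exact/algI.
Qed.

Lemma algS E1 E2 y : {subset E1 <= E2} -> alg E1 y -> alg E2 y.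
Proof.
move=> s [p [pE p0 py]]; exists p; split=> //; exact: polyOverS pE.
Qed.

Lemma alg_closure_sub E : {subset E <= alg_closure E}.
Proof. by move=> y yE; apply/alg_closureP/alg_id. Qed.

Lemma alg_closure_idem E y : alg (alg_closure E) y -> alg E y.
Proof.
move=> [p [/polyOverP pE p0 py]]; apply: (alg_trans _ p0 py) => k.
exact/alg_closureP.
Qed.

(** The field [E(x)]. *)
Definition ratf_pred E (x : F) : {pred F} := fun y =>
  `[< exists p q, [/\ p \is a polyOver E, q \is a polyOver E, q.[x] != 0
                    & y = p.[x] / q.[x]] >].

Lemma ratf_closed E x : divring_closed (ratf_pred E x).
Proof.
split=> [|y z|y z]; rewrite -!topredE /=.
- apply/asboolP; exists 1, 1; rewrite !hornerC divr1 oner_neq0; split=> //;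
  by rewrite rpred1.
- move=> /asboolP[p [q [pE qE q0 ->]]] /asboolP[r [s [rE sE s0 ->]]].
  apply/asboolP; exists (p * s - r * q), (q * s); split.
  + by rewrite rpredB ?rpredM.
  + by rewrite rpredM.
  + by rewrite hornerM mulf_neq0.
  + by rewrite !hornerE -mulNr addf_div // mulNr.
- move=> /asboolP[p [q [pE qE q0 ->]]] /asboolP[r [s [rE sE s0 ->]]].
  apply/asboolP; case: (eqVneq r.[x] 0) => [->|r0].
    exists 0, 1; rewrite !hornerC !(mul0r, invr0, mulr0) oner_neq0.
    by split=> //; rewrite ?rpred1 ?rpred0.
  exists (p * s), (q * r); split; rewrite ?rpredM //.
    by rewrite hornerM mulf_neq0.
  by rewrite !hornerM invf_div mulf_div.
Qed.

Definition ratf E x : subfield F := Subfield (ratf_closed E x).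

Lemma ratfP E x y : reflect (exists p q, [/\ p \is a polyOver E, q \is a polyOver E,
  q.[x] != 0 & y = p.[x] / q.[x]]) (y \in ratf E x).
Proof. exact: asboolP. Qed.

Lemma ratf_sub E x : {subset E <= ratf E x}.
Proof.
move=> y yE; apply/ratfP; exists y%:P, 1; split; rewrite ?polyOverC ?rpred1 //.
  by rewrite hornerC oner_neq0.
by rewrite !hornerC divr1.
Qed.

Lemma ratf_gen E x : x \in ratf E x.
Proof.
apply/ratfP; exists 'X, 1; split; rewrite ?polyOverX ?rpred1 //.
  by rewrite hornerC oner_neq0.
by rewrite hornerX hornerC divr1.
Qed.

Lemma ratf_min E x (E' : subfield F) :
  {subset E <= E'} -> x \in E' -> {subset ratf E x <= E'}.
Proof.
move=> s xE' y /ratfP[p [q [pE qE _ ->]]].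
by rewrite rpred_div // rpred_horner // (polyOverS s).
Qed.

(** A minimal polynomial up to a constant factor: normalising it to be primitive
    at a place will matter more than making it monic. *)
Lemma alg_minpoly E y : alg E y ->
  exists p, [/\ p \is a polyOver E, p != 0, root p y &
    forall g, g \is a polyOver E -> root g y ->
      exists2 h, h \is a polyOver E & g = p * h].
Proof.
move=> [p0 [p0E p00 p0y]].
pose S n := `[< exists p, [/\ p \is a polyOver E, p != 0, root p y & size p = n] >].
have [|n /asboolP[p [pE pn0 py sp]] mn] := @ex_minnP S.
  by exists (size p0); apply/asboolP; exists p0.
exists p; split=> // g gE gy.
have [p' Dp] := polyOver_lift pE; have [g' Dg] := polyOver_lift gE.
have p'0 : p' != 0 by move: pn0; rewrite Dp map_poly_eq0.
have eg := divp_eq g' p'.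
suff r0 : g' %% p' = 0.
  exists (map_poly val (g' %/ p')); first exact: polyOver_map.
  by rewrite Dp Dg -rmorphM {1}eg r0 addr0 mulrC.
apply: contraTeq (ltn_modpN0 g' p'0) => r0; rewrite -leqNgt.
have -> : size p' = n by rewrite -sp Dp size_map_poly.
apply: mn; apply/asboolP; exists (map_poly val (g' %% p')); split.
- exact: polyOver_map.
- by rewrite map_poly_eq0.
- move: gy; rewrite Dg {1}eg rmorphD rmorphM /= -Dp !rootE hornerD hornerM.
  by rewrite (rootP py) mulr0 add0r.
- by rewrite size_map_poly.
Qed.

End Algebraic.

(** * Splitting fields and ultraproducts of fields *)

Section Splitting.

Definition splits (L : fieldType) (p : {poly L}) : Prop :=
  exists rs : seq L, p = lead_coef p *: \prod_(z <- rs) ('X - z%:P).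

Lemma splits_map (L M : fieldType) (k : {rmorphism L -> M}) (p : {poly L}) :
  splits p -> splits (map_poly k p).
Proof.
move=> [rs e]; exists (map k rs).
rewrite {1}e map_polyZ /= lead_coef_map; congr (_ *: _).
rewrite rmorph_prod big_map; apply: eq_bigr => z _ /=.
by rewrite rmorphB /= map_polyX map_polyC.
Qed.

Lemma irreducible_dvd (L : fieldType) (p : {poly L}) : (1 < size p)%N ->
  exists2 q, irreducible_poly q & q %| p.
Proof.
move=> sp.
pose S n := `[< exists q : {poly L}, [/\ q %| p, (1 < size q)%N & size q = n] >].
have [|n /asboolP[q [qp q1 sq]] mn] := @ex_minnP S.
  by exists (size p); apply/asboolP; exists p.
have p0 : p != 0 by rewrite -size_poly_gt0 ltnW.
have q0 : q != 0 by rewrite -size_poly_gt0 ltnW.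
exists q => //; split=> // r r1 rq.
have rp := dvdp_trans rq qp.
have r0 : r != 0 by apply: contraNneq p0 => e; rewrite -dvd0p -e.
have sr : (1 < size r)%N by rewrite ltn_neqAle eq_sym r1 size_poly_gt0.
rewrite -dvdp_size_eqp // eqn_leq dvdp_leq //= sq.
by apply: mn; apply/asboolP; exists r.
Qed.

Lemma exists_root_ext (L : fieldType) (p : {poly L}) : (1 < size p)%N ->
  exists (M : fieldType) (k : {rmorphism L -> M}) (z : M), root (map_poly k p) z.
Proof.
move=> /irreducible_dvd[q /irredp_FAdjoin[M _ [z rz _]] /dvdpP[h ->]].
exists M, (in_alg M : {rmorphism L -> M}), z.
by rewrite rmorphM rootM rz orbT.
Qed.

Lemma splits_of_roots (L : fieldType) (p : {poly L}) : p != 0 ->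
  (forall q : {poly L}, q %| p -> (1 < size q)%N -> exists z, root q z) -> splits p.
Proof.
elim: {p}(size p) {-2}p (leqnn (size p)) => [|n IH] p sp p0 h.
  by rewrite leqn0 size_poly_eq0 (negPf p0) in sp.
case: (ltnP 1 (size p)) => [s1|/size1_polyC Dp]; last first.
  by exists [::]; rewrite big_nil Dp lead_coefC alg_polyC.
have [z /factor_theorem[q Dq]] := h p (dvdpp p) s1.
have q0 : q != 0 by apply: contraNneq p0 => e; rewrite Dq e mul0r.
have [||rs e] := IH q _ q0.
- by move: sp; rewrite Dq size_Mmonic ?monicXsubC // size_XsubC addn2.
- by move=> r rq; apply: h; rewrite Dq dvdp_mulr.
exists (z :: rs); rewrite {1}Dq {1}e big_cons Dq lead_coefM lead_coefXsubC mulr1.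
by rewrite -scalerAl mulrC.
Qed.

Lemma exists_split_ext (L : fieldType) (p : {poly L}) : p != 0 ->
  exists (M : fieldType) (k : {rmorphism L -> M}), splits (map_poly k p).
Proof.
move: {2}(size p) (leqnn (size p)) => n; elim: n L p => [|n IH] L p sp p0.
  by rewrite leqn0 size_poly_eq0 (negPf p0) in sp.
case: (ltnP 1 (size p)) => [s1|/size1_polyC Dp]; last first.
  exists L, idfun; exists [::].
  by rewrite map_poly_id // big_nil Dp lead_coefC alg_polyC.
have [M [k [z /factor_theorem[q Dq]]]] := exists_root_ext s1.
have kp0 : map_poly k p != 0 by rewrite map_poly_eq0.
have q0 : q != 0 by apply: contraNneq kp0 => e; rewrite Dq e mul0r.
have [|M' [k' [rs e]]] := IH M q _ q0.
  move: sp; rewrite -(size_map_poly k) Dq size_Mmonic ?monicXsubC // size_XsubC addn2.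
  by [].
exists M', (k' \o k : {rmorphism L -> M'}); exists (k' z :: rs).
rewrite map_poly_comp Dq rmorphM /= {1}e big_cons lead_coefM rmorphB /= map_polyX map_polyC /=.
by rewrite lead_coefXsubC mulr1 -scalerAl mulrC.
Qed.

(** Splitting persists under extension, so that the polynomials can be split one
    after the other. *)
Lemma exists_split_ext_seq (L : fieldType) (s : seq {poly L}) :
  exists (M : fieldType) (k : {rmorphism L -> M}),
    {in s, forall p, p != 0 -> splits (map_poly k p)}.
Proof.
elim: s => [|p s [M [k h]]]; first by exists L, idfun.
case: (eqVneq p 0) => [->|p0].
  by exists M, k => q; rewrite inE => /orP[/eqP->|/h //]; rewrite eqxx.
have kp0 : map_poly k p != 0 by rewrite map_poly_eq0.
have [M' [k' h']] := exists_split_ext kp0.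
exists M', (k' \o k : {rmorphism L -> M'}) => q; rewrite map_poly_comp inE.
by move=> /orP[/eqP->|/h hq q0] //; apply/splits_map/hq.
Qed.

End Splitting.

Section Ultraproduct.
Variables (T : eqType) (L : seq T -> fieldType).

(** The indices are finite sequences: [d] will be a finite set of polynomials, and
    [L d] a field in which they all split. *)
Definition field_product : Type := forall d, L d.

HB.instance Definition _ := gen_eqMixin field_product.
HB.instance Definition _ := gen_choiceMixin field_product.

Implicit Types x y z : field_product.

Let fp0 : field_product := fun d => 0.
Let fp1 : field_product := fun d => 1.
Let fp_opp x : field_product := fun d => - x d.
Let fp_add x y : field_product := fun d => x d + y d.
Let fp_mul x y : field_product := fun d => x d * y d.

Fact fp_addA : associative fp_add.
Proof. by move=> x y z; apply: functional_extensionality_dep => d; apply: addrA. Qed.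
Fact fp_addC : commutative fp_add.
Proof. by move=> x y; apply: functional_extensionality_dep => d; apply: addrC. Qed.
Fact fp_add0 : left_id fp0 fp_add.
Proof. by move=> x; apply: functional_extensionality_dep => d; apply: add0r. Qed.
Fact fp_addN : left_inverse fp0 fp_opp fp_add.
Proof. by move=> x; apply: functional_extensionality_dep => d; apply: addNr. Qed.

HB.instance Definition _ :=
  GRing.isZmodule.Build field_product fp_addA fp_addC fp_add0 fp_addN.

Fact fp_mulA : associative fp_mul.
Proof. by move=> x y z; apply: functional_extensionality_dep => d; apply: mulrA. Qed.
Fact fp_mulC : commutative fp_mul.
Proof. by move=> x y; apply: functional_extensionality_dep => d; apply: mulrC. Qed.
Fact fp_mul1 : left_id fp1 fp_mul.
Proof. by move=> x; apply: functional_extensionality_dep => d; apply: mul1r. Qed.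
Fact fp_mulDl : left_distributive fp_mul fp_add.
Proof. by move=> x y z; apply: functional_extensionality_dep => d; apply: mulrDl. Qed.
Fact fp_oner_neq0 : fp1 != 0.
Proof. by apply/eqP => /(congr1 (fun x => x [::])) /eqP; rewrite oner_eq0. Qed.

HB.instance Definition _ :=
  GRing.Zmodule_isComNzRing.Build field_product fp_mulA fp_mulC fp_mul1 fp_mulDl fp_oner_neq0.

Definition fp_eval d x : L d := x d.
Fact fp_eval_zmod d : zmod_morphism (fp_eval d). Proof. by []. Qed.
Fact fp_eval_monoid d : monoid_morphism (fp_eval d). Proof. by []. Qed.
HB.instance Definition _ d :=
  GRing.isZmodMorphism.Build field_product (L d) (fp_eval d) (fp_eval_zmod d).
HB.instance Definition _ d :=
  GRing.isMonoidMorphism.Build field_product (L d) (fp_eval d) (fp_eval_monoid d).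

Section Quotient.
Variables (U : set_system (seq T)) (UF : UltraFilter U).

(** For an ultrafilter [U] this ideal is maximal, so that the quotient is a field. *)
Definition null_ideal : {pred field_product} := fun x => `[< U [set d | x d = 0] >].

Lemma null_idealP x : reflect (U [set d | x d = 0]) (x \in null_ideal).
Proof. exact: asboolP. Qed.

Lemma null_idealr : idealr_closed null_ideal.
Proof.
split.
- by apply/null_idealP; apply: filterS filterT => d _.
- apply/null_idealP => h; apply: (@filter_not_empty _ U _).
  by apply: filterS h => d /= /eqP; rewrite oner_eq0.
- move=> a x y /null_idealP hx /null_idealP hy; apply/null_idealP.
  apply: filterS2 hx hy => d /= xd yd.
  by rewrite -[LHS]/(a d * x d + y d) xd yd mulr0 addr0.
Qed.

HB.instance Definition _ := isIdealr.Build field_product null_ideal null_idealr.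

Definition ultraproduct : Type := {ideal_quot null_ideal}.
HB.instance Definition _ := GRing.ComNzRing.copy ultraproduct {ideal_quot null_ideal}.

Definition up_proj (x : field_product) : ultraproduct := \pi_{ideal_quot null_ideal} x.

Lemma up_proj_zmod : zmod_morphism up_proj. Proof. exact: raddfB. Qed.
Lemma up_proj_monoid : monoid_morphism up_proj.
Proof. by split; [exact: rmorph1 | exact: rmorphM]. Qed.
HB.instance Definition _ :=
  GRing.isZmodMorphism.Build field_product ultraproduct up_proj up_proj_zmod.
HB.instance Definition _ :=
  GRing.isMonoidMorphism.Build field_product ultraproduct up_proj up_proj_monoid.

Lemma up_proj_eq x y : (up_proj x == up_proj y) = (x - y \in null_ideal).
Proof. by rewrite /up_proj -Quotient.idealrBE. Qed.

Lemma up_proj_eq0 x : (up_proj x == 0) = (x \in null_ideal).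
Proof. by rewrite -(rmorph0 up_proj) up_proj_eq subr0. Qed.

Lemma up_proj_surj (a : ultraproduct) : exists x, up_proj x = a.
Proof. by exists (repr a); rewrite /up_proj reprK. Qed.

Lemma up_inv_exists (a : ultraproduct) : a != 0 -> exists b, b * a = 1.
Proof.
have [x <-] := up_proj_surj a; rewrite up_proj_eq0 => /null_idealP nx.
exists (up_proj (fun d => (x d)^-1)); apply/eqP.
rewrite -rmorphM -(rmorph1 up_proj) up_proj_eq; apply/null_idealP.
have [//|] := in_ultra_setVsetC [set d | x d = 0] UF; apply: filterS => d /= /eqP xd.
by rewrite -[LHS]/((x d)^-1 * x d - 1) mulVf // subrr.
Qed.

Definition up_inv (a : ultraproduct) : ultraproduct :=
  if a == 0 then 0 else xget 0 [set b | b * a = 1].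

Lemma up_mulVf (a : ultraproduct) : a != 0 -> up_inv a * a = 1.
Proof.
move=> a0; rewrite /up_inv (negPf a0); have [b ba] := up_inv_exists a0.
by apply: (@xgetPex _ 0 [set b | b * a = 1]); exists b.
Qed.

Lemma up_inv0 : up_inv 0 = 0. Proof. by rewrite /up_inv eqxx. Qed.

HB.instance Definition _ :=
  GRing.ComNzRing_isField.Build ultraproduct up_mulVf up_inv0.

End Quotient.
End Ultraproduct.

(** * Algebraically closed extensions *)

Section ClosedExtension.

(** Take for [U] an ultrafilter on the finite sets of polynomials over [F] that
    contains, for every [p], the sets having [p] as an element.  On these sets of
    indices [p] splits componentwise, and so it does in the ultraproduct. *)
Lemma exists_splitting_ext (F : fieldType) :
  exists (M : fieldType) (k : {rmorphism F -> M}),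
    forall p : {poly F}, p != 0 -> splits (map_poly k p).
Proof.
pose I := seq {poly F}.
have /choice[e eP] : forall d : I, exists e : {L : fieldType & {rmorphism F -> L}},
    {in d, forall p, p != 0 -> splits (map_poly (projT2 e) p)}.
  by move=> d; have [L [k h]] := exists_split_ext_seq d; exists (existT _ L k).
pose L d := projT1 (e d); pose j d : {rmorphism F -> L d} := projT2 (e d).
pose Fl : set_system I := filter_from [set: I] (fun d0 => [set d | {subset d0 <= d}]).
have FlF : ProperFilter Fl.
  apply: filter_from_proper; last by move=> d _; exists d => x.
  apply: filter_from_filter; first by exists [::].
  move=> d1 d2 _ _; exists (d1 ++ d2) => // d h.
  by split=> x xs; apply: h; rewrite mem_cat xs ?orbT.
have [U [UF FlU]] := ultraFilterLemma FlF.
pose c (a : F) : field_product L := fun d => j d a.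
have c_zmod : zmod_morphism c.
  by move=> a b; apply: functional_extensionality_dep => d; rewrite /c rmorphB.
have c_mon : monoid_morphism c.
  split; first by apply: functional_extensionality_dep => d; rewrite /c rmorph1.
  by move=> a b; apply: functional_extensionality_dep => d; rewrite /c rmorphM.
pose cZ := GRing.isZmodMorphism.Build F (field_product L) c c_zmod.
pose cM := GRing.isMonoidMorphism.Build F (field_product L) c c_mon.
pose cR : {rmorphism F -> field_product L} := HB.pack c cZ cM.
pose kk : {rmorphism F -> @ultraproduct _ L U UF} := @up_proj _ L U UF \o cR.
exists (@ultraproduct _ L U UF), kk => p p0.
pose good (d : I) (s : seq (L d)) := size s = (size p).-1 /\
  map_poly (j d) p = lead_coef (map_poly (j d) p) *: \prod_(z <- s) ('X - z%:P).
have exs : forall d : I, exists s : seq (L d), p \in d -> good d s.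
  move=> d; case: (boolP (p \in d)) => pd; last by exists [::].
  have [s hs] := eP d p pd p0; exists s => _; split=> //.
  have := congr1 (fun q : {poly L d} => size q) hs.
  rewrite size_map_poly size_scale ?lead_coef_eq0 ?map_poly_eq0 // => ->.
  by rewrite size_prod_XsubC.
pose rs d := projT1 (cid (exs d)); have rsP d := projT2 (cid (exs d)).
pose n := (size p).-1.
pose zs (i : 'I_n) : field_product L := fun d => nth 0 (rs d) i.
exists [seq @up_proj _ L U UF (zs i) | i <- enum 'I_n].
pose R : {poly field_product L} := map_poly cR p - cR (lead_coef p) *: \prod_(i < n) ('X - (zs i)%:P).
have Rnull k : R`_k \in null_ideal U.
  apply/null_idealP; apply: FlU; exists [:: p] => // d /(_ _ (mem_head _ _)) pd.
  have [sz sp] := rsP d pd; rewrite /=.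
  have -> : R`_k d = (map_poly (@fp_eval _ L d) R)`_k by rewrite coef_map.
  suff -> : map_poly (@fp_eval _ L d) R = 0 by rewrite coef0.
  rewrite rmorphB /= map_polyZ rmorph_prod /= -map_poly_comp /=.
  have -> : map_poly (fp_eval d (L:=L) \o c) p = map_poly (j d) p by apply: eq_map_poly.
  rewrite sp lead_coef_map; apply/eqP; rewrite subr_eq0; apply/eqP.
  congr (_ *: _); rewrite (big_nth 0) sz big_mkord; apply: eq_bigr => i _.
  by rewrite rmorphB /= map_polyX map_polyC.
have R0 : map_poly (@up_proj _ L U UF) R = 0.
  by apply/polyP => k; rewrite coef_map coef0 /=; apply/eqP; rewrite up_proj_eq0.
move: R0; rewrite rmorphB /= map_polyZ rmorph_prod /= -map_poly_comp => /eqP.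
rewrite subr_eq0 => /eqP e1; rewrite [LHS]e1; congr (_ *: _).
  by rewrite -[RHS]/(lead_coef (map_poly kk p)) lead_coef_map.
rewrite big_map big_enum /=; apply: eq_bigr => i _.
by rewrite rmorphB /= map_polyX map_polyC.
Qed.

(** If every polynomial over [F] splits in [M], then the closure of [F] in [M] is
    algebraically closed: a root, in some extension of [M], of a polynomial over
    the closure is algebraic over [F], hence already lies in [M]. *)
Theorem exists_closed_ext (F : fieldType) :
  exists (M : fieldType) (k : {rmorphism F -> M}),
    forall p : {poly M}, p != 0 -> splits p.
Proof.
have [M [k hk]] := exists_splitting_ext F.
pose im : {pred M} := fun y => `[< exists x, y = k x >].
have imc : divring_closed im.
  split=> [|x y|x y]; rewrite -!topredE /=.
  - by apply/asboolP; exists 1; rewrite rmorph1.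
  - by move=> /asboolP[a ->] /asboolP[b ->]; apply/asboolP; exists (a - b); rewrite rmorphB.
  - by move=> /asboolP[a ->] /asboolP[b ->]; apply/asboolP; exists (a / b); rewrite fmorph_div.
pose E : subfield M := Subfield imc.
have kE x : k x \in E by apply/asboolP; exists x.
have kC x : k x \in alg_closure E by apply: alg_closure_sub.
pose N := subfield_type (alg_closure E).
pose k' (x : F) : N := exist _ (k x) (kC x).
have k'_zmod : zmod_morphism k' by move=> a b; apply: val_inj; rewrite /= !rmorphB.
have k'_mon : monoid_morphism k'.
  by split=> [|a b]; apply: val_inj; rewrite /= ?rmorph1 ?rmorphM.
pose kZ := GRing.isZmodMorphism.Build F N k' k'_zmod.
pose kM := GRing.isMonoidMorphism.Build F N k' k'_mon.
pose kR : {rmorphism F -> N} := HB.pack k' kZ kM.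
exists N, kR => p p0; apply: splits_of_roots => // q qp s1.
have q0 : q != 0 by rewrite -size_poly_gt0 ltnW.
have [|M' [h [r qr]]] := @exists_root_ext M (map_poly val q); first by rewrite size_map_poly.
have algF (y : M) : y \in alg_closure E -> integralOver k y.
  move=> /alg_closureP[g [gE g0 gy]]; apply/integral_algebraic.
  have /choice[f fP] : forall i, exists a, g`_i = k a.
    by move=> i; move/polyOverP: gE => /(_ i)/asboolP.
  pose f' := \poly_(i < size g) f i.
  have Dg : g = map_poly k f'.
    apply/polyP => i; rewrite coef_map coef_poly; case: ltnP => gi; first by rewrite fP.
    by rewrite nth_default // raddf0.
  by exists f'; [rewrite -(map_poly_eq0 k) -Dg|rewrite -Dg].
have /integral_algebraic[g g0 gr] : integralOver (h \o k) r.
  apply: (integral_root _ qr); first by rewrite !map_poly_eq0.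
  apply/integral_poly => i; rewrite !coef_map /=.
  by apply: integral_rmorph; apply: algF; case: (q`_i).
have [zs Dz] := hk g g0.
have : root (map_poly h (map_poly k g)) r by rewrite -map_poly_comp.
rewrite Dz map_polyZ /= rootZ ?fmorph_eq0 ?lead_coef_eq0 ?map_poly_eq0 //.
rewrite rmorph_prod /=.
have -> : \prod_(i <- zs) map_poly h ('X - i%:P) = \prod_(w <- map h zs) ('X - w%:P).
  by rewrite big_map; apply: eq_bigr => i _; rewrite rmorphB /= map_polyX map_polyC.
rewrite root_prod_XsubC => /mapP[z zz Dr].
have zC : z \in alg_closure E.
  apply/alg_closureP; exists (map_poly k g); rewrite map_poly_eq0; split=> //.
    by apply/polyOverP => i; rewrite coef_map; apply: kE.
  by rewrite Dz rootZ ?lead_coef_eq0 ?map_poly_eq0 // root_prod_XsubC.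
exists (exist _ z zC : N).
move: qr; rewrite Dr.
by rewrite -(fmorph_root (val : N -> M)) -(fmorph_root h).
Qed.

End ClosedExtension.

(** * Gauss's lemma for a place *)

Section Gauss.
Variables (F : fieldType) (P : place F).
Local Notation O := (place_ring P).
Local Notation M := (place_max P).
Implicit Types p q f g h : {poly F}.

Definition primitive p := (p \is a polyOver O) && (p \isn't a polyOver M).

Lemma polyOverMO p : p \is a polyOver M -> p \is a polyOver O.
Proof. by move/polyOverP => h; apply/polyOverP => k; apply: place_max_ring. Qed.

Lemma primitiveO p : primitive p -> p \is a polyOver O.
Proof. by case/andP. Qed.

Lemma not_polyOver_max p : p \isn't a polyOver M -> exists k, p`_k \notin M.
Proof.
by apply: contraNP => h; apply/polyOverP => k; apply/contraT => hk; case: h; exists k.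
Qed.

Lemma primitive_coef p k : p \is a polyOver O -> p`_k \notin M -> primitive p.
Proof. by move=> pO pk; rewrite /primitive pO; apply: contra pk => /polyOverP. Qed.

Lemma primitive_neq0 p : primitive p -> p != 0.
Proof. by case/andP=> _; apply: contraNneq => ->; rewrite rpred0. Qed.

Lemma primitive_low p : primitive p ->
  exists2 k, p`_k \notin M & forall j, (j < k)%N -> p`_j \in M.
Proof.
case/andP=> pO /not_polyOver_max ek; have [k pk mk] := ex_minnP ek.
by exists k => // j; apply: contraTT; rewrite -leqNgt; apply: mk.
Qed.

Lemma primitive_high p : primitive p ->
  exists2 k, p`_k \notin M & forall j, (k < j)%N -> p`_j \in M.
Proof.
case/andP=> pO /not_polyOver_max ek.
have bk k : p`_k \notin M -> (k <= size p)%N.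
  by apply: contraR; rewrite -ltnNge => /ltnW h; rewrite nth_default // rpred0.
have [k pk mk] := ex_maxnP ek bk.
by exists k => // j; apply: contraTT; rewrite -leqNgt; apply: mk.
Qed.

(** In the product, the coefficient whose index is the sum of the lowest indices of
    units is a unit plus elements of the maximal ideal. *)
Lemma primitiveM p q : primitive p -> primitive q -> primitive (p * q).
Proof.
move=> hp hq; have [k pk mk] := primitive_low hp; have [l ql ml] := primitive_low hq.
have /polyOverP pO := primitiveO hp; have /polyOverP qO := primitiveO hq.
apply: (@primitive_coef _ (k + l)); first by rewrite rpredM ?primitiveO.
have hk : (k < (k + l).+1)%N by rewrite ltnS leq_addr.
rewrite coefM (bigD1 (Ordinal hk)) //= addKn; apply: place_unitD.
  exact: place_unitM.
apply: rpred_sum => j; rewrite -val_eqE /= => jk.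
case: (ltnP j k) => h; first by rewrite mulrC place_maxMr ?mk.
apply: place_maxMr => //; apply: ml.
have jl : (j <= k + l)%N by rewrite -ltnS ltn_ord.
by rewrite -(ltn_add2r j) subnK // [(l + j)%N]addnC ltn_add2r ltn_neqAle eq_sym jk.
Qed.

(** One divides by a coefficient of least value. *)
Lemma primitive_content p : p != 0 ->
  exists2 k, p`_k != 0 & primitive ((p`_k)^-1 *: p).
Proof.
move=> p0; pose le x y := y / x \in O.
have [k pk mk] : exists2 k, p`_k != 0 & forall j, (j < size p)%N -> p`_j / p`_k \in O.
  have : exists2 k, p`_k != 0 & forall j, (j < (size p))%N -> p`_j != 0 -> p`_j / p`_k \in O.
    elim: (size p) => [|n [k pk mk]]; first by exists (size p).-1; rewrite // -lead_coefE lead_coef_eq0.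
    case: (boolP (p`_n / p`_k \in O)) => h.
      exists k => // j; rewrite ltnS leq_eqVlt => /orP[/eqP->//|]; exact: mk.
    have pn : p`_n != 0 by apply: contraNneq h => ->; rewrite mul0r rpred0.
    exists n => // j; rewrite ltnS leq_eqVlt => /orP[/eqP-> _|jn pj].
      by rewrite divff // rpred1.
    have := rpredM (mk j jn pj) (place_max_ring (place_notinV h)).
    by rewrite invf_div mulrA divfK.
  move=> [k pk mk]; exists k => // j jp; case: (eqVneq p`_j 0) => [->|pj].
    by rewrite mul0r rpred0.
  exact: mk.
exists k => //; apply: (@primitive_coef _ k).
  apply/polyOverP => j; rewrite coefZ mulrC; case: (ltnP j (size p)) => h; first exact: mk.
  by rewrite nth_default // mul0r rpred0.
by rewrite coefZ mulVf // place_max1F.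
Qed.

(** Write [h] as a constant times a primitive polynomial; the product of the latter
    with [f] has a unit among its coefficients, so that the constant is integral. *)
Lemma gauss_dvd f h : primitive f -> f * h \is a polyOver O -> h \is a polyOver O.
Proof.
move=> pf fhO; case: (eqVneq h 0) => [->|h0]; first exact: rpred0.
have [k hk ph] := primitive_content h0.
have pfh := primitiveM pf ph.
have [j cj _] := primitive_low pfh.
have cO : h`_k \in O.
  have : (f * h)`_j \in O by move/polyOverP: fhO.
  have -> : f * h = h`_k *: (f * ((h`_k)^-1 *: h)).
    by rewrite -scalerAr scalerA mulfV // scale1r.
  rewrite coefZ => hO; rewrite -[h`_k](mulfK (place_unit_neq0 cj)) rpredM //.
  by apply: place_unitV => //; move/polyOverP: (primitiveO pfh).
have -> : h = h`_k *: ((h`_k)^-1 *: h) by rewrite scalerA mulfV // scale1r.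
by apply: polyOverZ => //; apply: primitiveO.
Qed.

Lemma horner_place p x : p \is a polyOver O -> x \in O -> p.[x] \in O.
Proof. exact: rpred_horner. Qed.

Lemma horner_place_max p x : p \is a polyOver M -> x \in O -> p.[x] \in M.
Proof.
move=> /polyOverP pM xO; rewrite horner_coef; apply: rpred_sum => k _.
by rewrite mulrC place_maxMr // rpredX.
Qed.

End Gauss.

(** * Openness of restriction along an algebraic extension *)

Section Openness.
Variable F : fieldType.
Implicit Types (E L : subfield F) (P Q : place F) (A B : seq F) (p f g h : {poly F}).

(** Membership of [P] in a basic open set of the patch topology. *)
Definition satisfies P A B : Prop :=
  {subset A <= place_ring P} /\ {subset B <= place_max P}.

Definition agree E P Q : Prop :=
  forall x, x \in E -> (x \in place_ring P) = (x \in place_ring Q).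

Lemma agree_max E P Q x : agree E P Q -> x \in E ->
  (x \in place_max P) = (x \in place_max Q).
Proof. by move=> h xE; rewrite !place_maxE !h // rpredV. Qed.

Lemma agree_intro E P Q :
  (forall x, x \in E -> x \in place_ring P -> x \in place_ring Q) ->
  (forall x, x \in E -> x \in place_max P -> x \in place_max Q) -> agree E P Q.
Proof.
move=> hO hM x xE; apply/idP/idP; first exact: hO.
apply: contraTT => xP; have x0 : x != 0 by apply: contraNneq xP => ->; rewrite rpred0.
have := hM _ (rpredVr xE) (place_notinV xP).
by rewrite place_maxV.
Qed.

Lemma agreeS E E' P Q : {subset E <= E'} -> agree E' P Q -> agree E P Q.
Proof. by move=> s h x /s; apply: h. Qed.

Lemma agree_trans E P Q R : agree E P Q -> agree E Q R -> agree E P R.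
Proof. by move=> h1 h2 x xE; rewrite h1 // h2. Qed.

Lemma agree_satisfies E P Q A B : agree E P Q -> {subset A <= E} -> {subset B <= E} ->
  satisfies P A B -> satisfies Q A B.
Proof.
move=> h AE BE [sA sB]; split=> x xs; first by rewrite -h ?sA ?AE.
by rewrite -(agree_max h) ?sB ?BE.
Qed.

Lemma satisfies_cat P A1 A2 B1 B2 :
  satisfies P (A1 ++ A2) (B1 ++ B2) <-> satisfies P A1 B1 /\ satisfies P A2 B2.
Proof.
split=> [[hA hB]|[[hA1 hB1] [hA2 hB2]]].
  by split; split=> x xs; (apply: hA || apply: hB); rewrite mem_cat xs ?orbT.
split=> x; rewrite mem_cat => /orP[]; by [apply: hA1|apply: hA2|apply: hB1|apply: hB2].
Qed.

Lemma primitive_high_coefM P f h k l :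
  f \is a polyOver (place_ring P) -> h \is a polyOver (place_ring P) ->
  f`_k \notin place_max P -> (forall j, (k < j)%N -> f`_j \in place_max P) ->
  h`_l \notin place_max P -> (forall j, (l < j)%N -> h`_j \in place_max P) ->
  (f * h)`_(k + l) \notin place_max P.
Proof.
move=> /polyOverP fO /polyOverP hO fk mk hl ml.
have hk : (k < (k + l).+1)%N by rewrite ltnS leq_addr.
rewrite coefM (bigD1 (Ordinal hk)) //= addKn; apply: place_unitD.
  exact: place_unitM.
apply: rpred_sum => j; rewrite -val_eqE /= => jk.
case: (ltnP k j) => kj; first by rewrite mulrC place_maxMr ?mk.
apply: place_maxMr => //; apply: ml.
have {jk}jk : (j < k)%N by rewrite ltn_neqAle jk.
by rewrite ltn_subRL ltn_add2r.
Qed.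

(** By Chevalley's theorem it is enough that no polynomial [p] with coefficients in
    the maximal ideal takes the value [1] at [r].  Otherwise [f] divides [p - 1],
    which is constant in the residue field; by Gauss's lemma the quotient is
    integral, and comparing highest surviving terms makes [f] constant there. *)
Lemma place_extend E Q r f : f \is a polyOver E ->
  (forall g, g \is a polyOver E -> root g r -> exists2 h, h \is a polyOver E & g = f * h) ->
  f \is a polyOver (place_ring Q) ->
  (exists2 j, (0 < j)%N & f`_j \notin place_max Q) ->
  exists2 Q', agree E Q Q' & r \in place_ring Q'.
Proof.
move=> fE fmin fO [j j0 fj].
pose A : set F := [set y | exists p, [/\ p \is a polyOver E,
  p \is a polyOver (place_ring Q) & y = p.[r]]].
pose I : set F := [set y | exists p, [/\ p \is a polyOver E,
  p \is a polyOver (place_max Q) & y = p.[r]]].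
have AI : ideal_pair A I.
  split.
  - by exists 1; rewrite !rpred1 hornerC.
  - move=> _ _ [p [pE pO ->]] [q [qE qO ->]]; exists (p - q).
    by rewrite hornerD hornerN !rpredB.
  - move=> _ _ [p [pE pO ->]] [q [qE qO ->]]; exists (p * q).
    by rewrite hornerM !rpredM.
  - by move=> _ [p [pE pO ->]]; exists p; split=> //; apply: polyOverMO.
  - by exists 0; rewrite !rpred0 horner0.
  - move=> _ _ [p [pE pO ->]] [q [qE qO ->]]; exists (p - q).
    by rewrite hornerD hornerN !rpredB.
  - move=> _ _ [p [pE /polyOverP pO ->]] [q [qE /polyOverP qO ->]]; exists (p * q).
    rewrite hornerM rpredM //; split=> //; apply/polyOverP => k.
    by rewrite coefM; apply: rpred_sum => i _; apply: place_maxMr.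
  - move=> [p [pE pM p1]].
    have [||h hE Dg] := fmin (p - 1); first by rewrite rpredB ?rpred1.
      by rewrite rootE !hornerE -p1 subrr.
    have gO : f * h \is a polyOver (place_ring Q).
      by rewrite -Dg rpredB ?rpred1 // polyOverMO.
    have pf : primitive Q f := primitive_coef fO fj.
    have hO := gauss_dvd pf gO.
    have ph : primitive Q h.
      rewrite /primitive hO; apply/negP => hM.
      have : (f * h)`_0 \in place_max Q.
        by rewrite coef0M place_maxMr //; [move/polyOverP: fO|move/polyOverP: hM].
      rewrite -Dg coefB coef1 /= rpredBl; last by move/polyOverP: pM.
      by rewrite place_max1F.
    have [k fk mk] := primitive_high pf; have [l hl ml] := primitive_high ph.
    have := primitive_high_coefM fO hO fk mk hl ml.
    have k0 : (0 < k)%N.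
      by rewrite (leq_trans j0) // leqNgt; apply: contra fj; apply: mk.
    rewrite -Dg coefB coef1 addn_eq0 -[k == 0%N]negbK -lt0n k0 subr0.
    by move/polyOverP: pM => ->.
have [Q' [QA QI]] := chevalley AI.
exists Q'.
  apply: agree_intro => x xE h; [apply: QA|apply: QI]; exists x%:P;
  by rewrite !polyOverC hornerC.
apply: QA; exists 'X; rewrite hornerX !polyOverX //.
Qed.

(** The truncated equation [(drop_poly k p).[y]] tests whether [y] is integral.  It
    is a polynomial in [y], and by the equation also [-(take_poly k p).[y] / y ^+ k],
    a polynomial in [y^-1] without constant term. *)
Lemma drop_test Q p y k : p \is a polyOver (place_ring Q) -> root p y ->
  (drop_poly k p).[y] \in place_ring Q /\
  ((drop_poly k p).[y] \notin place_max Q -> y \in place_ring Q).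
Proof.
move=> /polyOverP pO py.
have dO : drop_poly k p \is a polyOver (place_ring Q).
  by apply/polyOverP => j; rewrite coef_drop_poly.
case: (boolP (y \in place_ring Q)) => yO; first by split=> //; apply: horner_place.
suff tM : (drop_poly k p).[y] \in place_max Q.
  by rewrite tM; split=> //; apply: place_max_ring.
have yV := place_notinV yO.
have y0 : y != 0 by apply: contraNneq yO => ->; rewrite rpred0.
have -> : (drop_poly k p).[y] = - \sum_(j < k) p`_j * y^-1 ^+ (k - j).
  have := rootP py; rewrite -{1}(poly_take_drop k p) hornerD hornerM hornerXn.
  move/eqP; rewrite addrC addr_eq0 => /eqP e.
  rewrite -[LHS](mulfK (expf_neq0 k y0)) e mulNr; congr (- _).
  rewrite /take_poly horner_poly mulr_suml; apply: eq_bigr => j _.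
  rewrite -mulrA; congr (_ * _).
  case: j => j /= /ltnW jk; rewrite -{1}(subnK jk) exprD invfM mulrCA mulfV ?expf_neq0 //.
  by rewrite mulr1 exprVn.
rewrite rpredN; apply: rpred_sum => j _; apply: place_maxMr => //.
case: j => j /= jk; rewrite -(subnSK jk) exprS mulrC.
by apply: place_maxMr; rewrite // rpredX // place_max_ring.
Qed.

(** Near [P], in the sense of conditions on [E], the conditions [A], [B] are
    consequences of a single one: that the integral element [t] be a unit. *)
Definition testable E P A B : Prop := exists A' B' t,
  [/\ {subset A' <= E}, {subset B' <= E} & satisfies P A' B'] /\
  [/\ alg E t, t \notin place_max P & forall Q, satisfies Q A' B' ->
    t \in place_ring Q /\ (t \notin place_max Q -> satisfies Q A B)].

Lemma alg_primitive E P y : alg E y ->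
  exists p, [/\ p \is a polyOver E, primitive P p & root p y].
Proof.
move=> [p [pE p0 py]]; have [k pk pp] := primitive_content P p0.
exists ((p`_k)^-1 *: p); split=> //.
- by rewrite polyOverZ // rpredV; move/polyOverP: pE.
- by rewrite rootZ // invr_eq0.
Qed.

Lemma alg_drop E p y k : p \is a polyOver E -> alg E y -> alg E (drop_poly k p).[y].
Proof.
move=> /polyOverP pE yE; apply/alg_closureP; apply: rpred_horner; last exact/alg_closureP.
by apply/polyOverP => j; rewrite coef_drop_poly; apply: alg_closure_sub.
Qed.

Lemma mem_coefs_polyOver (S : {pred F}) p : p \is a polyOver S ->
  {subset (p : seq F) <= S}.
Proof. by move=> /allP h x /h. Qed.

Lemma coefs_polyOver (S : subringClosed F) p : {subset (p : seq F) <= S} ->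
  p \is a polyOver S.
Proof.
move=> h; apply/polyOverP => k; case: (ltnP k (size p)) => hk; first exact/h/mem_nth.
by rewrite nth_default // rpred0.
Qed.

(** Truncate a primitive equation of [y] at its last unit coefficient [p`_k]: the
    result is congruent to [p`_k] when [y] is integral, hence a unit at [P]. *)
Lemma testable_ring E P y : alg E y -> y \in place_ring P -> testable E P [:: y] [::].
Proof.
move=> ya yO; have [p [pE pp py]] := alg_primitive P ya.
have [k pk mk] := primitive_high pp; have pO := primitiveO pp.
exists (p : seq F), [::], (drop_poly k p).[y]; split; split=> //.
- exact: mem_coefs_polyOver.
- by split=> // x; apply: mem_coefs_polyOver.
- exact: alg_drop.
- have -> : (drop_poly k p).[y] = p`_k + (drop_poly k p - (p`_k)%:P).[y].
    by rewrite hornerD hornerN hornerC addrC subrK.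
  apply: place_unitD => //; apply: horner_place_max => //.
  apply/polyOverP => j; rewrite coefB coef_drop_poly coefC.
  case: eqP => [->|/eqP j0]; first by rewrite add0n subrr rpred0.
  by rewrite subr0 mk // -{1}[k]add0n ltn_add2r lt0n.
- move=> Q [/coefs_polyOver qO _]; have [tO t1] := drop_test k qO py.
  by split=> // /t1 yQ; split=> // x; rewrite inE => /eqP->.
Qed.

(** Truncate at the first unit coefficient instead.  If the truncation [t] is a
    unit then [y] is integral, and [t * y ^+ k] is minus a sum of terms whose
    coefficients lie in the maximal ideal. *)
Lemma testable_max E P y : alg E y -> y \in place_max P -> testable E P [::] [:: y].
Proof.
move=> ya yM; have [p [pE pp py]] := alg_primitive P ya.
have [k pk mk] := primitive_low pp; have pO := primitiveO pp.
have yO := place_max_ring yM.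
exists (p : seq F), (take k p), (drop_poly k p).[y]; split; split=> //.
- exact: mem_coefs_polyOver.
- by move=> x /mem_take; apply: mem_coefs_polyOver.
- split=> x; first exact: mem_coefs_polyOver.
  move=> /(nthP 0)[j]; rewrite size_take_min leq_min => /andP[jk _].
  by rewrite nth_take // => <-; apply: mk.
- exact: alg_drop.
- have dO : drop_poly k p \is a polyOver (place_ring P).
    by apply/polyOverP => j; rewrite coef_drop_poly; move/polyOverP: pO.
  rewrite horner_coef; case E1: (size (drop_poly k p)) => [|n].
    case/negP: pk; rewrite -[k]add0n -coef_drop_poly nth_default ?E1 ?rpred0 //.
  rewrite big_ord_recl expr0 mulr1 coef_drop_poly add0n place_unitD //.
  apply: rpred_sum => j _; rewrite exprS mulrCA mulrC; apply: place_maxMr => //.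
  by rewrite rpredM ?rpredX //; move/polyOverP: dO.
- move=> Q [/coefs_polyOver qO qM]; have [tO t1] := drop_test k qO py.
  split=> // tM; have yQ := t1 tM; split=> // x; rewrite inE => /eqP->.
  have tk : (take_poly k p).[y] \in place_max Q.
    apply: horner_place_max => //; apply/polyOverP => j; rewrite coef_take_poly.
    case: ltnP => jk; last exact: rpred0.
    case: (ltnP j (size p)) => jp; last by rewrite nth_default // rpred0.
    by rewrite -(nth_take 0 jk); apply/qM/mem_nth; rewrite size_take_min leq_min jk.
  have := rootP py; rewrite -{1}(poly_take_drop k p) hornerD hornerM hornerXn.
  move/eqP; rewrite addr_eq0 => /eqP e.
  move: tk; rewrite e rpredN => /(place_prime tO (rpredX k yQ)).
  rewrite (negPf tM) /= => yk; apply: contraTT yk => yM'.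
  elim: k {pk mk qM tO t1 tM e} => [|k IH]; first by rewrite expr0 place_max1F.
  by rewrite exprS place_unitM // rpredX.
Qed.

Lemma testable_cat E P A1 B1 A2 B2 : testable E P A1 B1 -> testable E P A2 B2 ->
  testable E P (A1 ++ A2) (B1 ++ B2).
Proof.
move=> [C1 [D1 [t1 [[C1E D1E s1] [a1 tM1 h1]]]]] [C2 [D2 [t2 [[C2E D2E s2] [a2 tM2 h2]]]]].
have [t1O _] := h1 _ s1; have [t2O _] := h2 _ s2.
exists (C1 ++ C2), (D1 ++ D2), (t1 * t2); split; split.
- by move=> x; rewrite mem_cat => /orP[/C1E|/C2E].
- by move=> x; rewrite mem_cat => /orP[/D1E|/D2E].
- exact/satisfies_cat.
- by apply/alg_closureP; rewrite rpredM //; apply/alg_closureP.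
- exact: place_unitM.
- move=> Q /satisfies_cat[/h1[tQ1 k1] /h2[tQ2 k2]]; split; first exact: rpredM.
  move=> tM; apply/satisfies_cat; split.
    by apply: k1; apply: contra tM => tM; rewrite mulrC place_maxMr.
  by apply: k2; apply: contra tM => tM; rewrite place_maxMr.
Qed.

Lemma testable_all E P A B : {in A, forall a, alg E a} -> {in B, forall b, alg E b} ->
  satisfies P A B -> testable E P A B.
Proof.
move=> aA aB [hA hB]; rewrite -[A]cats0 -[B]cat0s; apply: testable_cat.
  elim: A aA hA {aB hB B} => [|a A IH] aA hA.
    exists [::], [::], 1; split; split=> //; first exact/alg_id/rpred1.
      by rewrite place_max1F.
    by move=> Q _; rewrite rpred1.
  rewrite -cat1s -[[::]]cats0; apply: testable_cat.
    by apply: testable_ring; [apply: aA|apply: hA]; rewrite mem_head.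
  by apply: IH => x xs; [apply: aA|apply: hA]; rewrite inE xs orbT.
elim: B aB hB {aA hA A} => [|b B IH] aB hB.
  exists [::], [::], 1; split; split=> //; first exact/alg_id/rpred1.
    by rewrite place_max1F.
  by move=> Q _; rewrite rpred1.
rewrite -(cat1s b) -[[::]]cats0; apply: testable_cat.
  by apply: testable_max; [apply: aB|apply: hB]; rewrite mem_head.
by apply: IH => x xs; [apply: aB|apply: hB]; rewrite inE xs orbT.
Qed.

(** Let [t] test the conditions and [r = t^-1].  All that is needed is a place
    agreeing with the given one on [E] at which [r] is integral.  By [place_extend]
    this holds as soon as a primitive multiple [f] of the minimal polynomial of
    [r] keeps integral coefficients, with one of positive degree a unit.  The unit
    is expressed by the integrality of its inverse. *)
Theorem alg_open E P A B : {in A, forall a, alg E a} -> {in B, forall b, alg E b} ->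
  satisfies P A B -> exists A' B', [/\ {subset A' <= E}, {subset B' <= E}, satisfies P A' B' &
    forall Q, satisfies Q A' B' -> exists2 Q', agree E Q Q' & satisfies Q' A B].
Proof.
move=> aA aB /(testable_all aA aB)[C [D [t [[CE DE s] [ta tM h]]]]].
have t0 := place_unit_neq0 tM; have [tO _] := h _ s.
pose r := t^-1; have rO : r \in place_ring P by apply: place_unitV.
have ra : alg E r by apply/alg_closureP; rewrite rpredV; apply/alg_closureP.
have [f0 [f0E f00 f0r f0min]] := alg_minpoly ra.
have [k fk pf] := primitive_content P f00.
have fkE : f0`_k \in E by move/polyOverP: f0E.
set f := (f0`_k)^-1 *: f0 in pf.
have fE : f \is a polyOver E by rewrite polyOverZ // rpredV.
have fr : root f r by rewrite rootZ // invr_eq0.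
have fmin g : g \is a polyOver E -> root g r -> exists2 h', h' \is a polyOver E & g = f * h'.
  move=> gE /(f0min _ gE)[h' h'E ->]; exists (f0`_k *: h'); first exact: polyOverZ.
  by rewrite -scalerCA scalerA mulfV // scale1r.
have fO := primitiveO pf.
have [j j0 fj] : exists2 j, (0 < j)%N & f`_j \notin place_max P.
  have [j fj _] := primitive_low pf.
  case: (pselect (exists2 j, (0 < j)%N & f`_j \notin place_max P)) => // hn.
  have f1 i : (0 < i)%N -> f`_i \in place_max P.
    by move=> i0; apply/contraT => fi; case: hn; exists i.
  have f0' : f`_0 \notin place_max P.
    by case: (posnP j) => [e|/f1]; [rewrite -e|rewrite (negPf fj)].
  case/negP: f0'; have := rootP fr.
  have -> : f = (f - (f`_0)%:P) + (f`_0)%:P by rewrite subrK.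
  rewrite hornerD hornerC => /eqP; rewrite addrC addr_eq0.
  rewrite coefD coefB !coefC /= subrr add0r => /eqP->; rewrite rpredN.
  apply: horner_place_max => //; apply/polyOverP => -[|i]; rewrite coefB coefC /=.
    by rewrite subrr rpred0.
  by rewrite subr0 f1.
exists (C ++ ((f`_j)^-1 :: f)), (D ++ [::]); split.
- move=> x; rewrite mem_cat => /orP[/CE//|]; rewrite inE => /orP[/eqP->|].
    by rewrite rpredV; move/polyOverP: fE.
  exact: mem_coefs_polyOver.
- by rewrite cats0.
- apply/satisfies_cat; split=> //; split=> // x; rewrite inE => /orP[/eqP->|].
    by apply: place_unitV => //; move/polyOverP: fO.
  exact: mem_coefs_polyOver.
- move=> Q /satisfies_cat[s1 [s2 _]].
  have qfO : f \is a polyOver (place_ring Q).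
    by apply: coefs_polyOver => x xs; apply: s2; rewrite inE xs orbT.
  have [|Q' ag rQ] := place_extend fE fmin qfO.
    have fj0 : (f`_j)^-1 != 0 by rewrite invr_eq0; apply: place_unit_neq0 fj.
    by exists j => //; rewrite -[f`_j]invrK place_maxV // s2 ?mem_head.
  exists Q' => //; apply: (proj2 (h Q' _)); first exact: (agree_satisfies ag CE DE s1).
  have r0 : r != 0 by rewrite invr_eq0.
  by rewrite -[t]invrK -/r place_maxV // rQ.
Qed.

End Openness.

(** * Gauss extensions, and conditions on a single value *)

Section OneVariable.
Variable F : fieldType.
Implicit Types (E L : subfield F) (P Q : place F) (A B : seq F) (p f g h : {poly F}).

Definition place_unit Q : {pred F} :=
  fun x => (x \in place_ring Q) && (x \notin place_max Q).

Lemma place_unitP Q x : reflect (x \in place_ring Q /\ x \notin place_max Q) (x \in place_unit Q).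
Proof. exact: andP. Qed.

Lemma place_unit_closed Q : divr_closed (place_unit Q).
Proof.
split=> [|x y]; first by apply/place_unitP; rewrite rpred1 place_max1F.
move=> /place_unitP[xO xM] /place_unitP[yO yM]; apply/place_unitP.
have y0 := place_unit_neq0 yM; have yV := place_unitV yO yM.
split; first exact: rpredM.
by apply: place_unitM => //; rewrite place_maxV // yO.
Qed.

HB.instance Definition _ Q :=
  GRing.isDivClosed.Build F (place_unit Q) (place_unit_closed Q).

Lemma place_unitO Q x : x \in place_unit Q -> x \in place_ring Q.
Proof. by case/place_unitP. Qed.

Lemma place_unit_nz Q x : x \in place_unit Q -> x != 0.
Proof. by case/place_unitP=> _; apply: place_unit_neq0. Qed.

Lemma place_unitE Q x : x != 0 ->
  (x \in place_unit Q) = (x \in place_ring Q) && (x^-1 \in place_ring Q).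
Proof.
move=> x0; rewrite -topredE /= /place_unit; congr (_ && _).
by rewrite -[x in LHS]invrK place_maxV ?invr_eq0 // negbK.
Qed.

Lemma place_ring_unitM Q w x : w \in place_unit Q ->
  (w * x \in place_ring Q) = (x \in place_ring Q).
Proof.
move=> wU; apply/idP/idP => h; last by rewrite rpredM // place_unitO.
by rewrite -(mulKf (place_unit_nz wU) x) rpredM // place_unitO // rpredV.
Qed.

Lemma place_max_unitM Q w x : w \in place_unit Q ->
  (w * x \in place_max Q) = (x \in place_max Q).
Proof.
move=> wU; apply/idP/idP => h; last by rewrite place_maxMr // place_unitO.
by rewrite -(mulKf (place_unit_nz wU) x) place_maxMr // place_unitO // rpredV.
Qed.

(** The residue of [u] is transcendental over the residue field of [L], expressed
    without residue fields. *)
Definition res_transc Q L u : Prop :=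
  u \in place_ring Q /\
  forall p, p \is a polyOver L -> primitive Q p -> p.[u] \notin place_max Q.

Lemma res_transc_unit Q L u p : res_transc Q L u -> p \is a polyOver L -> primitive Q p ->
  p.[u] \in place_unit Q.
Proof.
move=> [uO h] pL pp; apply/place_unitP; split; last exact: h.
by apply: horner_place => //; apply: primitiveO.
Qed.

Lemma agree_primitive L Q Q' p : agree L Q Q' -> p \is a polyOver L ->
  primitive Q p = primitive Q' p.
Proof.
move=> ag /polyOverP pL; rewrite /primitive; congr (_ && ~~ _).
  by apply/polyOverP/polyOverP => h k; move: (h k); rewrite (ag _ (pL k)).
by apply/polyOverP/polyOverP => h k; move: (h k); rewrite (agree_max ag (pL k)).
Qed.

(** This is the Gauss extension of [Q] to [L(u)], extended further.  Chevalley's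
    theorem is applied to the fractions with integral numerator and primitive
    denominator, and those with numerator in the maximal ideal. *)
Theorem gauss_extension L Q u : ~ alg L u ->
  exists2 Q', agree L Q Q' & res_transc Q' L u.
Proof.
move=> uL.
have nz p : p \is a polyOver L -> p != 0 -> p.[u] != 0.
  by move=> pL p0; apply/negP => pu; apply: uL; exists p.
pose G (S : {pred F}) : set F := [set y | exists p q, [/\ p \is a polyOver L,
  q \is a polyOver L, p \is a polyOver S, primitive Q q & y = p.[u] / q.[u]]].
have G1 S p : p \is a polyOver L -> p \is a polyOver S -> G S p.[u].
  move=> pL pS; exists p, 1; rewrite hornerC divr1; split=> //; first exact: rpred1.
  by apply: (@primitive_coef _ _ _ 0); rewrite ?rpred1 // coef1 place_max1F.
have GB (S : zmodClosed F) : {in place_ring Q & S, forall x y, x * y \in S} ->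
    forall x y, G S x -> G S y -> G S (x - y).
  move=> SM _ _ [p [q [pL qL /polyOverP pS qq ->]]] [r [s [rL sL /polyOverP rS ss ->]]].
  exists (p * s - r * q), (q * s); split.
  - by rewrite rpredB ?rpredM.
  - exact: rpredM.
  - apply/polyOverP => k; rewrite coefB; apply: rpredB; rewrite coefM;
    apply: rpred_sum => i _; rewrite mulrC; apply: SM => //.
      by move/polyOverP: (primitiveO ss).
    by move/polyOverP: (primitiveO qq).
  - exact: primitiveM.
  - have q0 := nz _ qL (primitive_neq0 qq); have s0 := nz _ sL (primitive_neq0 ss).
    by rewrite !hornerE -mulNr addf_div // mulNr.
have GM (S : zmodClosed F) : {in place_ring Q & S, forall x y, x * y \in S} ->
    forall x y, G (place_ring Q) x -> G S y -> G S (x * y).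
  move=> SM _ _ [p [q [pL qL /polyOverP pS qq ->]]] [r [s [rL sL /polyOverP rS ss ->]]].
  exists (p * r), (q * s); split; rewrite ?rpredM ?primitiveM //.
    by apply/polyOverP => k; rewrite coefM; apply: rpred_sum => i _; apply: SM.
  by rewrite !hornerM mulf_div.
have OM : {in place_ring Q & place_ring Q, forall x y, x * y \in place_ring Q}.
  by move=> x y xO yO; apply: rpredM.
have MM : {in place_ring Q & place_max Q, forall x y, x * y \in place_max Q}.
  by move=> x y xO yO; apply: place_maxMr.
have AI : ideal_pair (G (place_ring Q)) (G (place_max Q)).
  split.
  - by rewrite -(hornerC 1 u); apply: G1; rewrite ?polyOverC rpred1.
  - exact: GB.
  - exact: GM.
  - move=> _ [p [q [pL qL pS qq ->]]]; exists p, q; split=> //; exact: polyOverMO.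
  - by rewrite -(hornerC 0 u); apply: G1; rewrite ?polyOverC rpred0.
  - exact: GB.
  - exact: GM.
  - move=> [p [q [pL qL pS qq e]]].
    have q0 := nz _ qL (primitive_neq0 qq).
    have pq : p = q.
      apply/eqP; rewrite -subr_eq0; apply/contraT => /(nz _ (rpredB pL qL)).
      rewrite hornerD hornerN subr_eq0 => /eqP[].
      by rewrite -[LHS](divfK q0) -e mul1r.
    by case/andP: qq => _ /negP[]; rewrite -pq.
have [Q' [QA QI]] := chevalley AI.
have agr : agree L Q Q'.
  apply: agree_intro => x xE h; [apply: QA|apply: QI]; rewrite -(hornerC x u);
  by apply: G1; rewrite polyOverC.
exists Q' => //; split.
  by apply: QA; rewrite -[u]hornerX; apply: G1; rewrite polyOverX.
move=> p pL; rewrite -(agree_primitive agr pL) => pp.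
have p0 := nz _ pL (primitive_neq0 pp).
rewrite -[p.[u]]invrK place_maxV ?invr_eq0 // negbK; apply: QA.
by exists 1, p; rewrite !rpred1 hornerC div1r.
Qed.

Definition splits_within L : Prop := forall p, p \is a polyOver L -> p != 0 ->
  exists2 rs : seq F, {subset rs <= L} & p = lead_coef p *: \prod_(z <- rs) ('X - z%:P).

Lemma split_root L p : splits_within L -> p \is a polyOver L -> (1 < size p)%N ->
  exists2 z, z \in L & root p z.
Proof.
move=> Ls pL sp; have p0 : p != 0 by rewrite -size_poly_gt0 ltnW.
have [rs rsL Dp] := Ls p pL p0.
case: rs rsL Dp => [|z rs] rsL Dp.
  by move: sp; rewrite Dp big_nil size_scale ?lead_coef_eq0 // size_poly1.
exists z; first by rewrite rsL ?mem_head.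
by rewrite Dp rootZ ?lead_coef_eq0 // root_prod_XsubC mem_head.
Qed.

Lemma split_nth_root L n a : splits_within L -> a \in L ->
  exists2 z, z \in L & z ^+ n.+1 = a.
Proof.
move=> Ls aL; have [||z zL rz] := @split_root L ('X^(n.+1) - a%:P) Ls.
- by rewrite rpredB ?polyOverC // rpredX // polyOverX.
- by rewrite size_XnsubC.
- by exists z => //; move: rz; rewrite rootE !hornerE subr_eq0 => /eqP.
Qed.

(** [(D, N, strict)] stands for the condition [v(D z^N) >= 0], or [> 0], on the
    value of [z]. *)
Definition constr : Type := (F * int * bool)%type.

Definition cst_val (c : constr) (z : F) : F := c.1.1 * z ^ c.1.2.

Definition cst_ok Q (z : F) (c : constr) : bool :=
  if c.2 then cst_val c z \in place_max Q else cst_val c z \in place_ring Q.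

Definition csts_in L (cs : seq constr) : Prop := forall c, c \in cs -> c.1.1 \in L.

Lemma seq_max_value P (s : seq F) : s != [::] -> {in s, forall x, x != 0} ->
  exists2 x, x \in s & {in s, forall y, x / y \in place_ring P}.
Proof.
elim: s => // x [|y s] IH _ nz.
  exists x; rewrite ?mem_head // => y; rewrite inE => /eqP->.
  by rewrite divff ?rpred1 // nz ?mem_head.
have [//|z zs|z zs mz] := IH; first by rewrite nz // inE zs orbT.
have x0 : x != 0 by rewrite nz ?mem_head.
have z0 : z != 0 by rewrite nz // inE zs orbT.
case: (boolP (z / x \in place_ring P)) => h.
  exists z; first by rewrite inE zs orbT.
  by move=> w; rewrite inE => /orP[/eqP->|/mz].
exists x; first by rewrite mem_head.
move=> w; rewrite inE => /orP[/eqP->|/mz wz]; first by rewrite divff ?rpred1.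
have -> : x / w = (z / x)^-1 * (z / w) by rewrite invf_div mulrA divfK.
by rewrite rpredM // place_max_ring // place_notinV.
Qed.

Lemma sqr_in_max P x : x ^+ 2 \in place_max P -> x \in place_max P.
Proof.
move=> x2; case: (boolP (x \in place_ring P)) => xO.
  by have := place_prime xO xO; rewrite -expr2 => /(_ x2)/orP[].
have x0 : x != 0 by apply: contraNneq xO => ->; rewrite rpred0.
have := rpredM (place_max_ring (place_notinV xO)) (place_max_ring (place_notinV xO)).
rewrite -expr2 exprVn => h; move: x2.
by rewrite -[x ^+ 2]invrK place_maxV ?h // invr_eq0 expf_neq0.
Qed.

(** The value group of [L] is a divisible, nontrivial ordered group, hence a dense
    order without end points.  The square root of the product of the two bounds
    lies between them, and a missing bound is supplied by [t]. *)
Lemma value_between L P (lo hi : seq F) z t : splits_within L ->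
  t \in L -> t != 0 -> t \in place_max P -> z != 0 ->
  {subset lo <= L} -> {subset hi <= L} ->
  {in lo, forall r, r != 0 /\ z / r \in place_max P} ->
  {in hi, forall s, s != 0 /\ s / z \in place_max P} ->
  exists2 w, w \in L /\ w != 0 & {in lo, forall r, w / r \in place_max P} /\
    {in hi, forall s, s / w \in place_max P}.
Proof.
move=> Ls tL t0 tM z0 loL hiL hlo hhi.
have Hlo r w : {in lo, forall r', r / r' \in place_ring P} -> r \in lo ->
    w / r \in place_max P -> {in lo, forall r', w / r' \in place_max P}.
  move=> h rlo wr r' r'lo; have [r0 _] := hlo _ rlo.
  by rewrite -[w](divfK r0) -[_ * _ / r']mulrA mulrC place_maxMr ?h.
have Hhi s w : {in hi, forall s', s' / s \in place_ring P} -> s \in hi ->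
    s / w \in place_max P -> {in hi, forall s', s' / w \in place_max P}.
  move=> h shi wr s' s'hi; have [s0 _] := hhi _ shi.
  by rewrite -[s'](divfK s0) -[_ * _ / w]mulrA place_maxMr ?h.
have mhi : hi != [::] -> exists2 s, s \in hi & {in hi, forall s', s' / s \in place_ring P}.
  move=> hn; have [||s /mapP[s1 s1h ->] ms] := @seq_max_value P (map GRing.inv hi).
  - by case: (hi) hn.
  - by move=> _ /mapP[s sh ->]; rewrite invr_eq0; case: (hhi _ sh).
  - by exists s1 => // s' sh'; have := ms s'^-1; rewrite invrK mulrC; apply; apply: map_f.
have mlo : lo != [::] -> exists2 r, r \in lo & {in lo, forall r', r / r' \in place_ring P}.
  by move=> hn; apply: seq_max_value => // r /hlo[].
case: (eqVneq lo [::]) => [lo0|/mlo[r rlo mr]]; last first.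
  have [r0 zr] := hlo _ rlo.
  case: (eqVneq hi [::]) => [hi0|/mhi[s shi ms]].
    exists (t * r); first by split; [apply: rpredM; last exact: loL|rewrite mulf_neq0].
    by rewrite hi0; split=> //; apply: (Hlo r); rewrite ?mulfK.
  have [s0 sz] := hhi _ shi.
  have [w wL w2] : exists2 w, w \in L & w ^+ 2 = s * r.
    by apply: split_nth_root => //; apply: rpredM; [exact: hiL|exact: loL].
  have sr : s / r \in place_max P.
    rewrite -[s](divfK z0) -[_ * _ / r]mulrA.
    by apply: place_maxMr => //; apply: place_max_ring.
  have w0 : w != 0.
    by apply: contraNneq (mulf_neq0 s0 r0) => e; rewrite -w2 e expr0n.
  exists w => //; split; [apply: (Hlo r)|apply: (Hhi s)] => //; apply: sqr_in_max.
    by rewrite expr_div_n w2 expr2 invfM mulrA mulfK.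
  by rewrite expr_div_n w2 expr2 invfM mulrA mulfK.
case: (eqVneq hi [::]) => [hi0|/mhi[s shi ms]].
  by exists 1; rewrite ?rpred1 ?oner_neq0 // lo0 hi0.
have [s0 sz] := hhi _ shi.
exists (s / t); first by split; [apply: rpred_div; first exact: hiL|rewrite mulf_neq0 ?invr_eq0].
rewrite lo0; split=> //; apply: (Hhi s) => //.
by rewrite invf_div mulrC divfK.
Qed.

Lemma exprn_place_ring P x n : x ^+ n.+1 \in place_ring P -> x \in place_ring P.
Proof.
apply: contraTT => xO; have x0 : x != 0 by apply: contraNneq xO => ->; rewrite rpred0.
rewrite -place_maxV ?expf_neq0 // -exprVn exprS mulrC place_maxMr ?place_notinV //.
by rewrite rpredX // place_max_ring ?place_notinV.
Qed.

Lemma exprn_place_max P x n : x \in place_max P -> x ^+ n.+1 \in place_max P.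
Proof. by move=> xM; rewrite exprSr place_maxMr // rpredX // place_max_ring. Qed.

Lemma exprz_unit P w N : w \in place_unit P -> w ^ N \in place_unit P.
Proof.
by case: N => n wU; rewrite /exprz ?rpredV rpredX.
Qed.

(** The conditions [cs] on the value of an element of [L] follow from strict lower
    and upper bounds that hold at [z]. *)
Definition bracketing L P z (cs : seq constr) (lo hi : seq F) : Prop :=
  [/\ {subset lo <= L}, {subset hi <= L},
      {in lo, forall r, r != 0 /\ z / r \in place_max P},
      {in hi, forall s, s != 0 /\ s / z \in place_max P} &
      forall w, w \in L -> w != 0 -> {in lo, forall r, w / r \in place_max P} ->
        {in hi, forall s, s / w \in place_max P} -> {in cs, forall c, cst_ok P w c}].
(** If some element of [L] has the value of [z], it is a solution.  Otherwise the
    value of [z] is not torsion modulo that of [L], as the latter is divisible; a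
    condition with [N <> 0] then amounts to a strict bound by the value of an
    [N]-th root of [D] or its inverse. *)
Lemma constr_solve L P z t (cs : seq constr) : splits_within L ->
  t \in L -> t != 0 -> t \in place_max P -> z != 0 ->
  csts_in L cs -> {in cs, forall c, cst_ok P z c} ->
  exists2 w, w \in L /\ w != 0 & {in cs, forall c, cst_ok P w c}.
Proof.
move=> Ls tL t0 tM z0 csL csz.
case: (pselect (exists2 r, r \in L /\ r != 0 & z / r \in place_unit P)) => [[r [rL r0] zr]|nr].
  exists r => // c /csz; rewrite /cst_ok /cst_val.
  have -> : c.1.1 * z ^ c.1.2 = (z / r) ^ c.1.2 * (c.1.1 * r ^ c.1.2).
    by rewrite mulrCA -expfzMl divfK.
  have zrU := exprz_unit c.1.2 zr.
  by rewrite place_ring_unitM // place_max_unitM.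
have [lo [hi [loL hiL hlo hhi hcs]]] : exists lo hi : seq F, bracketing L P z cs lo hi.
  elim: cs csL csz => [|[[D N] st] cs IH] csL csz; first by exists [::], [::].
  have [lo [hi [loL hiL hlo hhi hcs]]] : exists lo hi : seq F, bracketing L P z cs lo hi.
    by apply: IH => c cc; [apply: csL|apply: csz]; rewrite inE cc orbT.
  have DL : D \in L by apply: (csL (D, N, st)); rewrite mem_head.
  have := csz (D, N, st) (mem_head _ _); rewrite /cst_ok /cst_val /= => ok.
  have okO : D * z ^ N \in place_ring P by case: (st) ok => //; apply: place_max_ring.
  case: (eqVneq D 0) => [D0|D0].
    exists lo, hi; split=> // w wL w0 wlo whi c; rewrite inE => /orP[/eqP->|]; last exact: hcs.
    by rewrite /cst_ok /cst_val /= D0 mul0r place_max0 rpred0 if_same.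
  case: N okO ok csL csz => [[|n]|n] okO ok csL csz.
  - exists lo, hi; split=> // w wL w0 wlo whi c; rewrite inE => /orP[/eqP->|]; last exact: hcs.
    by move: ok; rewrite /cst_ok /cst_val /= !expr0z.
  - have [r rL rn] := split_nth_root n Ls (rpredVr DL).
    have r0 : r != 0 by apply: contraNneq D0 => e; rewrite -[D]invrK -rn e expr0n invr0.
    have De w : D * w ^ n.+1 = (w / r) ^+ n.+1.
      by rewrite -exprnP -[D]invrK -rn expr_div_n mulrC.
    have zr : z / r \in place_max P.
      have zrO : z / r \in place_ring P by move: okO; rewrite De => /exprn_place_ring.
      by apply/contraT => h; case: nr; exists r => //; apply/place_unitP.
    exists (r :: lo), hi; split=> //.
    + by move=> x; rewrite inE => /orP[/eqP->//|/loL].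
    + by move=> x; rewrite inE => /orP[/eqP->//|/hlo].
    + move=> w wL w0 wlo whi c; rewrite inE => /orP[/eqP->|]; last first.
        by apply: hcs => // x xs; apply: wlo; rewrite inE xs orbT.
      have wr : (w / r) ^+ n.+1 \in place_max P by rewrite exprn_place_max // wlo ?mem_head.
      by rewrite /cst_ok /cst_val /= De wr place_max_ring // if_same.
  - have [s sL sn] := split_nth_root n Ls DL.
    have s0 : s != 0 by apply: contraNneq D0 => e; rewrite -sn e expr0n.
    have De w : D * w ^ (Negz n) = (s / w) ^+ n.+1.
      by rewrite /exprz -sn expr_div_n.
    have zr : s / z \in place_max P.
      have zrO : s / z \in place_ring P by move: okO; rewrite De => /exprn_place_ring.
      apply/contraT => h; case: nr; exists s => //; rewrite -invf_div rpredV.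
      exact/place_unitP.
    exists lo, (s :: hi); split=> //.
    + by move=> x; rewrite inE => /orP[/eqP->//|/hiL].
    + by move=> x; rewrite inE => /orP[/eqP->//|/hhi].
    + move=> w wL w0 wlo whi c; rewrite inE => /orP[/eqP->|]; last first.
        by apply: hcs => // x xs; apply: whi; rewrite inE xs orbT.
      have wr : (s / w) ^+ n.+1 \in place_max P by rewrite exprn_place_max // whi ?mem_head.
      by rewrite /cst_ok /cst_val /= De wr place_max_ring // if_same.
have [w [wL w0] [wlo whi]] := value_between Ls tL t0 tM z0 loL hiL hlo hhi.
by exists w => //; apply: hcs.
Qed.

End OneVariable.

(** * Approximating a place of a simple transcendental extension *)

Section Monomial.
Variables (F : fieldType) (L : subfield F) (P : place F) (z : F).
Hypothesis z0 : z != 0.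
Implicit Types (Q : place F) (A B : seq F) (f g h : F).

(** Up to units [f] is [D z^N] at [P], and [D w^N] at every Gauss extension for
    which [z / w] is residually transcendental, provided that the conditions [cs]
    hold for [w]. *)
Definition monomial_model (f D : F) (N : int) (cs : seq (constr F)) : Prop :=
  [/\ D \in L, csts_in L cs, {in cs, forall c, cst_ok P z c},
      f / (D * z ^ N) \in place_unit P &
      forall Q w, w \in L -> w != 0 -> res_transc Q L (z / w) ->
        {in cs, forall c, cst_ok Q w c} -> f / (D * w ^ N) \in place_unit Q].

Definition monomial_like f := exists D N cs, monomial_model f D N cs.

Lemma monomial_like_const c : c \in L -> c != 0 -> monomial_like c.
Proof.
move=> cL c0; exists c, 0%:Z, [::]; split=> // [|Q w wL w0 _ _];
by rewrite expr0z mulr1 divff // rpred1.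
Qed.

Lemma monomial_like_div f g : monomial_like f -> monomial_like g -> monomial_like (f / g).
Proof.
move=> [D [N [cs [DL csL csP fP fQ]]]] [D' [N' [cs' [DL' csL' csP' fP' fQ']]]].
exists (D / D'), (N - N'), (cs ++ cs').
have e (w : F) : w != 0 -> f / g / (D / D' * w ^ (N - N')) = f / (D * w ^ N) / (g / (D' * w ^ N')).
  move=> w0; rewrite expfzDr // -invr_expz.
  have -> : D / D' * (w ^ N / w ^ N') = (D * w ^ N) / (D' * w ^ N').
    by rewrite -mulf_div.
  by rewrite !invf_div !mulf_div [g * _]mulrC.
split.
- exact: rpred_div.
- by move=> c; rewrite mem_cat => /orP[/csL|/csL'].
- by move=> c; rewrite mem_cat => /orP[/csP|/csP'].
- by rewrite e // rpred_div.
- move=> Q w wL w0 rt ok; rewrite e // rpred_div //; [apply: fQ|apply: fQ'] => // c cc;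
  by apply: ok; rewrite mem_cat cc ?orbT.
Qed.

Lemma monomial_likeM f g : monomial_like f -> monomial_like g -> monomial_like (f * g).
Proof.
move=> hf hg; rewrite -[g]invrK; apply: monomial_like_div => //.
rewrite -[_^-1]div1r; apply: monomial_like_div => //.
by apply: monomial_like_const; rewrite ?rpred1 ?oner_neq0.
Qed.

Lemma monomial_like_prod (I : eqType) (s : seq I) (f : I -> F) :
  {in s, forall j, monomial_like (f j)} -> monomial_like (\prod_(j <- s) f j).
Proof.
elim: s => [|j s IH] h.
  by rewrite big_nil; apply: monomial_like_const; rewrite ?rpred1 ?oner_neq0.
rewrite big_cons; apply: monomial_likeM; first by apply: h; rewrite mem_head.
by apply: IH => i si; apply: h; rewrite inE si orbT.
Qed.

(** The hypothesis says that the value of [z + d] is at most that of [z]; hence it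
    is the smaller of the values of [z] and [d].  If this is the value of [d], or
    that of [z], it remains so for a Gauss extension when [w] satisfies the
    corresponding weak inequality, since [1 + (d^-1 w) X] and [X + d / w] are then
    primitive. *)
Lemma monomial_like_linear d : d \in L -> z / (z + d) \in place_ring P ->
  z + d != 0 -> monomial_like (z + d).
Proof.
move=> dL zd zd0; case: (boolP ((d != 0) && (z / d \in place_max P))) => [/andP[d0 zdM]|h].
  exists d, 0%:Z, [:: (d^-1, 1%:Z, false)]; split=> //.
  - by move=> c; rewrite inE => /eqP->; rewrite rpredV.
  - move=> c; rewrite inE => /eqP->; rewrite /cst_ok /cst_val /= expr1z mulrC.
    exact: place_max_ring.
  - rewrite expr0z mulr1 mulrDl divff // addrC; apply/place_unitP; split.
      by rewrite rpredD ?rpred1 // place_max_ring.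
    by apply: place_unitD; rewrite ?place_max1F.
  - move=> Q w wL w0 rt /(_ _ (mem_head _ _)); rewrite /cst_ok /cst_val /= expr1z => wO.
    have -> : (z + d) / (d * w ^ 0%:Z) = ((d^-1 * w) *: 'X + 1).[z / w].
      rewrite expr0z mulr1 hornerD hornerZ hornerX hornerC mulrDl divff //; congr (_ + _).
      by rewrite -mulrA [w * _]mulrC divfK // mulrC.
    apply: res_transc_unit rt _ _.
      by rewrite rpredD ?rpred1 // polyOverZ ?polyOverX // rpredM // rpredV.
    apply: (@primitive_coef _ _ _ 0).
      by rewrite rpredD ?rpred1 // polyOverZ ?polyOverX.
    by rewrite !coefE mulr0 add0r place_max1F.
have dz : d / z \in place_ring P.
  case: (eqVneq d 0) h => [->|d0] /=; first by rewrite mul0r rpred0.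
  by rewrite -(invf_div d z) place_maxV ?negbK // mulf_neq0 ?invr_eq0.
exists 1, 1%:Z, [:: (d, Negz 0, false)]; split=> //.
- by rewrite rpred1.
- by move=> c; rewrite inE => /eqP->.
- by move=> c; rewrite inE => /eqP->; exact: dz.
- rewrite mul1r expr1z place_unitE ?invf_div ?mulf_neq0 ?invr_eq0 // zd andbT.
  by rewrite mulrDl divff // rpredD ?rpred1.
- move=> Q w wL w0 rt /(_ _ (mem_head _ _)) wO; have {}wO : d / w \in place_ring Q := wO.
  have -> : (z + d) / (1 * w ^ 1%:Z) = ('X + (d / w)%:P).[z / w].
    by rewrite mul1r expr1z hornerD hornerX hornerC mulrDl.
  apply: res_transc_unit rt _ _.
    by rewrite rpredD ?polyOverX // polyOverC rpred_div.
  apply: (@primitive_coef _ _ _ 1).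
    by rewrite rpredD ?polyOverX // polyOverC.
  by rewrite !coefE addr0 place_max1F.
Qed.

End Monomial.

Section Step.
Variables (F : fieldType) (L : subfield F) (x : F).
Hypotheses (Ls : splits_within L) (xL : ~ alg L x).
Implicit Types (P Q : place F) (A B S : seq F).

Lemma transc_sub_neq0 e : e \in L -> x - e != 0.
Proof. by move=> eL; apply: contra_notN xL => /eqP/subr0_eq->; apply: alg_id. Qed.

Definition splits_over S (f : F) : Prop := exists c rs rs',
  [/\ c \in L, {subset rs <= S}, {subset rs' <= S} &
   f = c * \prod_(e <- rs) (x - e) / \prod_(e <- rs') (x - e)].

Lemma ratf_split f : f \in ratf L x ->
  exists2 S : seq F, {subset S <= L} & splits_over S f.
Proof.
move=> /ratfP[p [q [pL qL q0 ->]]].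
have hz (p' : {poly F}) : p' \is a polyOver L -> p' != 0 ->
    exists c rs, [/\ c \in L, {subset rs <= L} & p'.[x] = c * \prod_(e <- rs) (x - e)].
  move=> p'L p'0; have [rs rsL e] := Ls p'L p'0; exists (lead_coef p'), rs; split=> //.
    by rewrite lead_coefE; move/polyOverP: p'L.
  rewrite {1}e hornerZ horner_prod; congr (_ * _); apply: eq_bigr => i _.
  by rewrite hornerXsubC.
have q0' : q != 0 by apply: contraNneq q0 => ->; rewrite horner0.
have [c' [rs' [c'L rs'L ->]]] := hz q qL q0'.
case: (eqVneq p 0) => [->|p0].
  by exists [::] => //; exists 0, [::], [::]; split; rewrite ?rpred0 // horner0 !mul0r.
have [c [rs [cL rsL ->]]] := hz p pL p0.
exists (rs ++ rs'); first by move=> e; rewrite mem_cat => /orP[/rsL|/rs'L].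
exists (c / c'), rs, rs'; split.
- exact: rpred_div.
- by move=> e ers; rewrite mem_cat ers.
- by move=> e ers; rewrite mem_cat ers orbT.
- by rewrite invfM -!mulrA; congr (_ * _); rewrite mulrCA.
Qed.

Lemma ratf_split_all (fs : seq F) : {subset fs <= ratf L x} ->
  exists2 S : seq F, {subset S <= L} & {in fs, forall f, splits_over S f}.
Proof.
elim: fs => [|f fs IH] h; first by exists [::].
have [|S SL hS] := IH; first by move=> g gs; apply: h; rewrite inE gs orbT.
have [S' S'L hS'] := ratf_split (h _ (mem_head _ _)).
exists (S' ++ S); first by move=> e; rewrite mem_cat => /orP[/S'L|/SL].
move=> g; rewrite inE => /orP[/eqP->|/hS].
  case: hS' => [c [rs [rs' [cL rsS rs'S ->]]]]; exists c, rs, rs'; split=> // e ers.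
    by rewrite mem_cat rsS.
  by rewrite mem_cat rs'S.
case=> [c [rs [rs' [cL rsS rs'S ->]]]]; exists c, rs, rs'; split=> // e ers.
  by rewrite mem_cat rsS ?orbT.
by rewrite mem_cat rs'S ?orbT.
Qed.

(** The centre [e] is chosen among the roots, with [x - e] of largest value; the
    element 0 is added to the roots to have at least one candidate. *)
Lemma ratf_monomial P (fs : seq F) : {subset fs <= ratf L x} ->
  exists2 e, e \in L & {in fs, forall f, f != 0 -> monomial_like L P (x - e) f}.
Proof.
move=> /ratf_split_all[S SL hS].
have S0L : {subset 0 :: S <= L} by move=> e; rewrite inE => /orP[/eqP->|/SL //]; rewrite rpred0.
have [//||_ /mapP[e eS ->] me] := @seq_max_value _ P [seq x - e | e <- 0 :: S].
  by move=> _ /mapP[e /S0L eL ->]; rewrite transc_sub_neq0.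
have eL := S0L _ eS; exists e => // f /hS[c [rs [rs' [cL rsS rs'S Df]]]] f0.
have z0 := transc_sub_neq0 eL.
have hl e' : e' \in S -> monomial_like L P (x - e) (x - e').
  move=> e'S; have e'L := SL _ e'S.
  have -> : x - e' = (x - e) + (e - e') by rewrite addrA subrK.
  apply: monomial_like_linear; rewrite ?rpredB // addrA subrK; last exact: transc_sub_neq0.
  by apply: me; apply/mapP; exists e' => //; rewrite inE e'S orbT.
have c0 : c != 0 by apply: contraNneq f0 => c0; rewrite Df c0 !mul0r.
rewrite Df; apply: monomial_like_div => //; last first.
  by apply: monomial_like_prod => // e' /rs'S; apply: hl.
apply: monomial_likeM => //; first exact: monomial_like_const.
by apply: monomial_like_prod => // e' /rsS; apply: hl.
Qed.

(** For an element like a monomial [D z^N], its place in the valuation ring or the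
    maximal ideal is the condition [(D, N)], to be added to those on which the
    likeness depends. *)
Lemma satisfies_constr P z A B : z != 0 ->
  {in A ++ B, forall f, f != 0 -> monomial_like L P z f} -> satisfies P A B ->
  exists cs, [/\ csts_in L cs, {in cs, forall c, cst_ok P z c} &
    forall Q w, w \in L -> w != 0 -> res_transc Q L (z / w) ->
      {in cs, forall c, cst_ok Q w c} -> satisfies Q A B].
Proof.
move=> z0 hm [hA hB].
have one b f : (f != 0 -> monomial_like L P z f) ->
    (if b then f \in place_max P else f \in place_ring P) ->
    exists cs, [/\ csts_in L cs, {in cs, forall c, cst_ok P z c} &
      forall Q w, w \in L -> w != 0 -> res_transc Q L (z / w) ->
      {in cs, forall c, cst_ok Q w c} -> if b then f \in place_max Q else f \in place_ring Q].
  case: (eqVneq f 0) => [-> _ _|f0 /(_ isT)[D [N [cs [DL csL csP fP fQ]]]] fb].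
    by exists [::]; split=> // Q w _ _ _ _; rewrite place_max0 rpred0 if_same.
  have D0 w : f / (D * w ^ N) != 0 -> D * w ^ N != 0.
    by apply: contraNneq => ->; rewrite invr0 mulr0.
  have e w : f / (D * w ^ N) != 0 -> f = f / (D * w ^ N) * cst_val (D, N, b) w.
    by move/D0 => h; rewrite divfK.
  exists ((D, N, b) :: cs); split.
  - by move=> c; rewrite inE => /orP[/eqP->|/csL].
  - move=> c; rewrite inE => /orP[/eqP->|/csP //].
    move: fb; rewrite /cst_ok /= (e z (place_unit_nz fP)).
    by rewrite (place_max_unitM _ fP) (place_ring_unitM _ fP).
  - move=> Q w wL w0 rt ok; have := ok _ (mem_head _ _).
    have fU : f / (D * w ^ N) \in place_unit Q.
      by apply: fQ => // c cc; apply: ok; rewrite inE cc orbT.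
    rewrite [f in X in _ -> X](e w (place_unit_nz fU)) /cst_ok /=.
    by rewrite (place_max_unitM _ fU) (place_ring_unitM _ fU).
have many b (s : seq F) : {in s, forall f, f != 0 -> monomial_like L P z f} ->
    {in s, forall f, if b then f \in place_max P else f \in place_ring P} ->
    exists cs, [/\ csts_in L cs, {in cs, forall c, cst_ok P z c} &
      forall Q w, w \in L -> w != 0 -> res_transc Q L (z / w) ->
      {in cs, forall c, cst_ok Q w c} ->
      {in s, forall f, if b then f \in place_max Q else f \in place_ring Q}].
  elim: s => [|a s IH] hs sP; first by exists [::].
  have [||cs [csL csP csQ]] := IH.
  - by move=> f fs; apply: hs; rewrite inE fs orbT.
  - by move=> f fs; apply: sP; rewrite inE fs orbT.
  have [||cs' [csL' csP' csQ']] := one b a.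
  - by apply: hs; rewrite mem_head.
  - by apply: sP; rewrite mem_head.
  exists (cs' ++ cs); split.
  - by move=> c; rewrite mem_cat => /orP[/csL'|/csL].
  - by move=> c; rewrite mem_cat => /orP[/csP'|/csP].
  - move=> Q w wL w0 rt ok f; rewrite inE => /orP[/eqP->|].
      by apply: (csQ' Q w) => // c cc; apply: ok; rewrite mem_cat cc.
    by apply: (csQ Q w) => // c cc; apply: ok; rewrite mem_cat cc orbT.
have [||csA [csAL csAP csAQ]] := many false A; last first.
have [||csB [csBL csBP csBQ]] := many true B; last first.
exists (csA ++ csB); split.
- by move=> c; rewrite mem_cat => /orP[/csAL|/csBL].
- by move=> c; rewrite mem_cat => /orP[/csAP|/csBP].
- move=> Q w wL w0 rt ok; split.
    by apply: (csAQ Q w) => // c cc; apply: ok; rewrite mem_cat cc.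
  by apply: (csBQ Q w) => // c cc; apply: ok; rewrite mem_cat cc orbT.
- exact: hB.
- by move=> f fB; apply: hm; rewrite mem_cat fB orbT.
- exact: hA.
- by move=> f fA; apply: hm; rewrite mem_cat fA.
Qed.

(** Solve in [L] the conditions that hold for [z = x - e] at [P]; for the solution
    [w], they are conditions on [L].  Any place satisfying them extends to a Gauss
    extension with [z / w] residually transcendental. *)
Theorem transc_open P t A B :
  t \in L -> t != 0 -> t \in place_max P ->
  {subset A <= ratf L x} -> {subset B <= ratf L x} -> satisfies P A B ->
  exists A' B', [/\ {subset A' <= L}, {subset B' <= L}, satisfies P A' B' &
    forall Q, satisfies Q A' B' -> exists2 Q', agree L Q Q' /\ satisfies Q' A B &
      exists2 u, u \in ratf L x & res_transc Q' L u].
Proof.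
move=> tL t0 tM AE BE sP.
have ABE : {subset A ++ B <= ratf L x} by move=> f; rewrite mem_cat => /orP[/AE|/BE].
have [e eL hm] := ratf_monomial P ABE.
have z0 := transc_sub_neq0 eL.
have [cs [csL csP csQ]] := satisfies_constr z0 hm sP.
have [w [wL w0] wP] := constr_solve Ls tL t0 tM z0 csL csP.
have cvL c : c \in cs -> cst_val c w \in L.
  by move=> cc; rewrite rpredM ?csL //; case: c.1.2 => n; rewrite /exprz ?rpredV rpredX.
pose cA := [seq c <- cs | ~~ c.2]; pose cB := [seq c <- cs | c.2].
exists [seq cst_val c w | c <- cA], [seq cst_val c w | c <- cB]; split.
- by move=> _ /mapP[c + ->]; rewrite mem_filter => /andP[_ /cvL].
- by move=> _ /mapP[c + ->]; rewrite mem_filter => /andP[_ /cvL].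
- split=> _ /mapP[c + ->]; rewrite mem_filter => /andP[cb /wP]; rewrite /cst_ok.
    by rewrite (negPf cb).
  by rewrite cb.
move=> Q [sA sB]; have uL : ~ alg L ((x - e) / w).
  move=> ua; apply: xL; have -> : x = (x - e) / w * w + e by rewrite divfK // subrK.
  apply/alg_closureP/rpredD; last exact: alg_closure_sub.
  by apply: rpredM; [apply/alg_closureP|apply: alg_closure_sub].
have [Q' ag rt] := gauss_extension Q uL.
exists Q'; last first.
  exists ((x - e) / w) => //; rewrite rpred_div ?rpredB ?ratf_gen ?ratf_sub //.
split=> //; apply: (csQ Q' w) => // c cc; rewrite /cst_ok -(ag _ (cvL _ cc)) -(agree_max ag (cvL _ cc)).
case: ifP => cb; [apply: sB|apply: sA]; apply/map_f; rewrite mem_filter cc ?cb //.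
Qed.

End Step.

(** * Towers of algebraically closed subfields *)

Section Chain.
Variable F : fieldType.
Implicit Types (E L G : subfield F) (P Q : place F) (A B : seq F) (p f g h : {poly F}).

Lemma subfield_ext E E' : E =i E' -> E = E'.
Proof.
case: E E' => [S hS] [T hT] /= e.
have {}e : S = T by apply: funext => x; have := e x; rewrite -!topredE.
by case: _ / e hT => hT; congr Subfield; apply: Prop_irrelevance.
Qed.

(** The residue field of [L] is algebraically closed too.  A primitive polynomial
    over [L] is a unit times a product of factors [X - e] with [e] integral and
    [1 - e^-1 X] with [e] not integral, the latter being units at [y]. *)
Lemma not_res_transc L Q y : splits_within L -> y \in place_ring Q -> ~ res_transc Q L y ->
  exists2 l, l \in L /\ l \in place_ring Q & y - l \in place_max Q.
Proof.
move=> Ls yO nrt; apply: contrapT => hn; apply: nrt; split=> // p pL pp.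
have unitL l : l \in L -> l \in place_ring Q -> y - l \in place_unit Q.
  move=> lL lO; apply/place_unitP; rewrite rpredB //; split=> //.
  by apply/negP => h; apply: hn; exists l.
have [rs rsL Dp] := Ls p pL (primitive_neq0 pp).
have [C [g [C0 pg gU Dg]]] : exists C g, [/\ C != 0, primitive Q g, g.[y] \in place_unit Q
    & \prod_(e <- rs) ('X - e%:P) = C *: g].
  elim: rs rsL {Dp} => [|e rs IH] rsL.
    exists 1, 1; rewrite oner_neq0 hornerC rpred1 big_nil scale1r; split=> //.
    by apply: (@primitive_coef _ _ _ 0); rewrite ?rpred1 // coef1 place_max1F.
  have eL : e \in L by rewrite rsL ?mem_head.
  have [|C [g [C0 pg gU Dg]]] := IH; first by move=> x xs; apply: rsL; rewrite inE xs orbT.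
  case: (boolP (e \in place_ring Q)) => eO.
    exists C, (('X - e%:P) * g); split=> //.
    - apply: primitiveM => //; apply: (@primitive_coef _ _ _ 1).
        by rewrite polyOverXsubC.
      by rewrite !coefE subr0 place_max1F.
    - by rewrite hornerM hornerXsubC rpredM // unitL.
    - by rewrite big_cons Dg scalerAr.
  have e0 : e != 0 by apply: contraNneq eO => ->; rewrite rpred0.
  have eV := place_notinV eO.
  have dO : 1 - e^-1 *: 'X \is a polyOver (place_ring Q).
    by rewrite rpredB ?rpred1 // polyOverZ ?polyOverX // place_max_ring.
  exists (- e * C), ((1 - e^-1 *: 'X) * g); split=> //.
  - by rewrite mulf_neq0 // oppr_eq0.
  - apply: primitiveM => //; apply: (@primitive_coef _ _ _ 0) => //.
    by rewrite !coefE mulr0 subr0 place_max1F.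
  - rewrite hornerM rpredM // hornerD hornerN hornerZ hornerX hornerC.
    have eyM : e^-1 * y \in place_max Q by rewrite mulrC place_maxMr.
    apply/place_unitP; split; first by rewrite rpredB ?rpred1 // place_max_ring.
    by rewrite place_unitD ?rpredN // place_max1F.
  - rewrite big_cons Dg -scalerAr [- e * C]mulrC -scalerA; congr (_ *: _).
    rewrite scalerAl; congr (_ * _).
    by rewrite scalerBr scalerA mulNr mulfV // scaleN1r opprK scaleNr alg_polyC addrC.
have {}Dp : p = (lead_coef p * C) *: g by rewrite {1}Dp Dg scalerA.
set c := _ * C in Dp; suff cU : c \in place_unit Q.
  by rewrite Dp hornerZ; have := rpredM cU gU => /place_unitP[].
have [k gk _] := primitive_low pg; have [l pl _] := primitive_low pp.
have /polyOverP gO := primitiveO pg; have /polyOverP pO := primitiveO pp.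
apply/place_unitP; split.
  have := pO k; rewrite Dp coefZ mulrC place_ring_unitM //; exact/place_unitP.
by apply: contra pl => cM; rewrite Dp coefZ mulrC place_maxMr.
Qed.

(** Some coefficient of a primitive equation of [u] over [G] will do.  Otherwise all
    the coefficients are congruent to elements of [L], and replacing them by these
    makes the residue of [u] algebraic over that of [L]. *)
Lemma res_transc_descend L G Q u : splits_within L -> res_transc Q L u -> alg G u ->
  exists2 y, y \in G & res_transc Q L y.
Proof.
move=> Ls [uO ut] uG; have [p [/polyOverP pG pp pu]] := alg_primitive Q uG.
have /polyOverP pO := primitiveO pp.
apply: contrapT => hn.
have /choice[l lP] : forall k, exists l, [/\ l \in L, l \in place_ring Q & p`_k - l \in place_max Q].
  move=> k; have [|l [lL lO] h] := not_res_transc Ls (pO k); last by exists l.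
  by move=> rt; apply: hn; exists p`_k.
pose p' := \poly_(k < size p) l k.
have p'L : p' \is a polyOver L.
  by apply/polyOverP => k; rewrite coef_poly; case: ifP => _; [case: (lP k)|rewrite rpred0].
have dM : p - p' \is a polyOver (place_max Q).
  apply/polyOverP => k; rewrite coefB coef_poly; case: ltnP => kp; first by case: (lP k).
  by rewrite nth_default // subr0 rpred0.
have p'O : p' \is a polyOver (place_ring Q).
  by rewrite -[p'](subKr p); apply: rpredB; [apply: primitiveO|apply: polyOverMO].
have pp' : primitive Q p'.
  have [k pk _] := primitive_low pp; apply: (primitive_coef (k := k)) => //.
  apply: contra pk => p'k; rewrite -[p`_k](subrK p'`_k) rpredD // -coefB.
  by move/polyOverP: dM.
case/negP: (ut p' p'L pp'); rewrite -[p'](subKr p) hornerD hornerN (rootP pu) sub0r rpredN.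
exact: horner_place_max.
Qed.

(** Clear denominators in an equation of [y] over [E(t)] and read it as an equation
    of [t] over [E(y)]; it is nonzero because [y] is transcendental over [E]. *)
Lemma alg_exchange E t y : alg (ratf E t) y -> ~ alg E y -> alg (ratf E y) t.
Proof.
move=> [p [/polyOverP pE p0 py]] yE; set n := size p.
have /choice[ab abP] : forall k, exists ab : {poly F} * {poly F},
   [/\ ab.1 \is a polyOver E, ab.2 \is a polyOver E, ab.2.[t] != 0 & p`_k = ab.1.[t] / ab.2.[t]].
  by move=> k; have /ratfP[a [b [aE bE b0 e]]] := pE k; exists (a, b).
pose R (k : 'I_n) := (ab k).1 * \prod_(j < n | j != k) (ab j).2.
pose q := \prod_(j < n) (ab j).2.
have q0 : q.[t] != 0.
  by rewrite horner_prod; apply/prodf_neq0 => j _; case: (abP j).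
have RE k : R k \is a polyOver E.
  rewrite rpredM //; first by case: (abP k).
  by apply: rpred_prod => j _; case: (abP j).
have Rt k : (R k).[t] = q.[t] * p`_k.
  have [_ _ b0 ->] := abP k; rewrite /q (bigD1 k) //= !hornerM.
  by rewrite mulrC mulrAC mulrA [_ / _]mulrC mulrA mulVf // mul1r mulrC.
pose S := \sum_(k < n) y ^+ k *: R k.
have yEy : y \in ratf E y by apply: ratf_gen.
exists S; split.
- apply: rpred_sum => k _; apply: polyOverZ; first exact: rpredX.
  exact: (polyOverS (@ratf_sub _ E y)) (RE k).
- apply: contra_not_neq yE => S0.
  have /existsNP[k /eqP pk] : ~ forall k : 'I_n, p`_k = 0.
    move=> h; case/eqP: p0; apply/polyP => k; rewrite coef0.
    by case: (ltnP k n) => kn; [apply: (h (Ordinal kn))|rewrite nth_default].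
  have Rk : R k != 0.
    by apply: contraNneq (mulf_neq0 q0 pk) => e; rewrite -Rt e horner0.
  have [i Ri] : exists i, (R k)`_i != 0.
    by exists (size (R k)).-1; rewrite -lead_coefE lead_coef_eq0.
  pose r := \poly_(j < n) (if insub j is Some j' then (R j')`_i else 0).
  have rj (j : 'I_n) : r`_j = (R j)`_i by rewrite coef_poly ltn_ord valK.
  exists r; split.
  + apply/polyOverP => j; rewrite coef_poly; case: ifP => _; last exact: rpred0.
    by case: insub => [j'|]; [move/polyOverP: (RE j')|rewrite rpred0].
  + by apply: contraNneq Ri => e; rewrite -rj e coef0.
  + rewrite rootE horner_poly; apply/eqP.
    have := congr1 (fun h : {poly F} => h`_i) S0; rewrite coef0 coef_sum => e0.
    rewrite -[RHS]e0; apply: eq_bigr => j _.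
    by rewrite coefZ valK mulrC.
- rewrite rootE horner_sum; apply/eqP.
  have -> : \sum_(k < n) (y ^+ k *: R k).[t] = q.[t] * p.[y].
    rewrite [p.[y]]horner_coef mulr_sumr; apply: eq_bigr => k _.
    by rewrite hornerZ Rt mulrC mulrA.
  by rewrite (rootP py) mulr0.
Qed.

Lemma res_transc_transc Q L y : res_transc Q L y -> ~ alg L y.
Proof.
move=> [yO h] /(alg_primitive Q)[p [pL pp py]].
by have := h p pL pp; rewrite (rootP py) rpred0.
Qed.

Lemma res_transc_agree E L Q Q' u : {subset L <= E} -> u \in E -> agree E Q Q' ->
  res_transc Q L u -> res_transc Q' L u.
Proof.
move=> LE uE ag [uO h]; split; first by rewrite -(ag _ uE).
move=> p pL pp; rewrite -(agree_max ag); last by rewrite rpred_horner // (polyOverS LE).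
by apply: h => //; rewrite (agree_primitive (agreeS LE ag)).
Qed.

(** The algebraic closure of [L(ys)], if [L] is algebraically closed in [F]. *)
Fixpoint alg_adjoin L (ys : seq F) : subfield F :=
  if ys is y :: ys' then alg_adjoin (alg_closure (ratf L y)) ys' else L.

(** The residues of [ys] are algebraically independent over those of [L]. *)
Fixpoint res_indep Q L (ys : seq F) : Prop :=
  if ys is y :: ys' then res_transc Q L y /\ res_indep Q (alg_closure (ratf L y)) ys'
  else True.

Hypothesis closedF : forall p, p != 0 -> splits p.

Definition alg_closed_in L := forall y, alg L y -> y \in L.

Lemma alg_closure_closed L : alg_closed_in (alg_closure L).
Proof. by move=> y /alg_closure_idem yL; apply/alg_closureP. Qed.

Lemma alg_closed_splits L : alg_closed_in L -> splits_within L.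
Proof.
move=> Lc p pL p0; have [rs e] := closedF p0; exists rs => // z zrs; apply: Lc.
by exists p; split=> //; rewrite e rootZ ?lead_coef_eq0 // root_prod_XsubC.
Qed.

(** Only the lowest storey [L(x)] needs work; the others are covered by induction.
    The residually transcendental element [u] found in [L(x)] need not lie in
    [FF], but it is algebraic over the subfield [G(x)] of [FF], so that it can be
    traded for an element [y] of [G(x)]; by exchange [y] generates the same storey
    as [x].  If [x] already lies in [L], the storey is void. *)
Theorem tower_open P (FF : subfield F) (ts : seq F) L G t A B :
  alg_closed_in L -> {subset G <= L} -> {subset G <= FF} -> (forall y, y \in L -> alg G y) ->
  t \in L -> t != 0 -> t \in place_max P -> {subset ts <= FF} ->
  {subset A <= alg_adjoin L ts} -> {subset B <= alg_adjoin L ts} -> satisfies P A B ->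
  exists A' B' : seq F, [/\ {subset A' <= L}, {subset B' <= L}, satisfies P A' B' &
    forall Q, satisfies Q A' B' -> exists2 Q', agree L Q Q' /\ satisfies Q' A B &
      exists ys : seq F, [/\ {subset ys <= FF}, res_indep Q' L ys &
                     {subset alg_adjoin L ts <= alg_adjoin L ys}]].
Proof.
elim: ts L G t => [|x ts IH] L G t Lc GL GF LG tL t0 tM tsF AE BE sP.
  exists A, B; split=> // Q sQ; exists Q; first by split.
  by exists [::]; split.
set L1 := alg_closure (ratf L x) in AE BE.
have xF : x \in FF by rewrite tsF ?mem_head.
have LL1 : {subset L <= L1} by move=> y yL; apply/alg_closure_sub/ratf_sub.
have GG1 : {subset ratf G x <= ratf L x}.
  by apply: ratf_min; [move=> y /GL; apply: ratf_sub|apply: ratf_gen].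
have LG1 y : y \in ratf L x -> alg (ratf G x) y.
  move=> yL; apply/alg_closureP; apply: ratf_min yL.
    by move=> z /LG h; apply/alg_closureP; apply: algS h; apply: ratf_sub.
  exact/alg_closure_sub/ratf_gen.
have [|||||||||||A1 [B1 [A1L B1L sA1 hA1]]] := IH L1 (ratf G x) t.
- exact: alg_closure_closed.
- by move=> y /GG1; apply: alg_closure_sub.
- exact: ratf_min.
- move=> y /alg_closureP yL; apply: alg_closure_idem; apply: algS yL => z /LG1 h.
  exact/alg_closureP.
- exact: LL1.
- by [].
- by [].
- by move=> y ys; apply: tsF; rewrite inE ys orbT.
- exact: AE.
- exact: BE.
- exact: sP.
have Ls := alg_closed_splits Lc.
case: (boolP (x \in L)) => xL.
  have L1E : L1 = L.
    apply: subfield_ext => y; apply/idP/idP => [/alg_closureP yL|/LL1 //].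
    by apply: Lc; apply: algS yL; apply: ratf_min.
  rewrite L1E in A1L B1L hA1; exists A1, B1; split=> // Q /hA1[Q' ag [ys h]].
  by exists Q' => //; exists ys; rewrite /= -/L1 L1E.
have xLt : ~ alg L x by move/Lc; rewrite (negPf xL).
have [||A2 [B2 [A2L B2L sA2 hA2]]] := @alg_open _ (ratf L x) P A1 B1 _ _ sA1.
- by move=> a /A1L/alg_closureP.
- by move=> a /B1L/alg_closureP.
have [A3 [B3 [A3L B3L sA3 hA3]]] := transc_open Ls xLt tL t0 tM A2L B2L sA2.
exists A3, B3; split=> // Q /hA3[Q2 [ag2 sQ2] [u uL ru]].
have [Q1 ag1 sQ1] := hA2 _ sQ2.
have [Q' [ag' sQ'] [ys [ysF rys ysL]]] := hA1 _ sQ1.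
have agQ' : agree (ratf L x) Q2 Q'.
  by apply: agree_trans ag1 (agreeS _ ag') => z; apply: alg_closure_sub.
have Lx : {subset L <= ratf L x} by apply: ratf_sub.
have ru' : res_transc Q' L u := res_transc_agree Lx uL agQ' ru.
have [y yG ry] := res_transc_descend Ls ru' (LG1 _ uL).
have yL := GG1 _ yG.
have L1E : alg_closure (ratf L y) = L1.
  apply: subfield_ext => z; apply/alg_closureP/alg_closureP => hz.
    by apply: algS hz; apply: ratf_min.
  apply: alg_closure_idem; apply: algS hz; apply: ratf_min.
    by move=> w wL; apply/alg_closure_sub/ratf_sub.
  apply/alg_closureP/alg_exchange; first exact: alg_id.
  exact: res_transc_transc ry.
exists Q'.
  split=> //; apply: agree_trans ag2 _; exact: agreeS agQ'.
exists (y :: ys); rewrite /= L1E; split=> // z; rewrite inE => /orP[/eqP->|/ysF //].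
by move: yG; apply: ratf_min.
Qed.

End Chain.

(** * Residually transcendental places near a given place *)

Section Tower.
Variable F : fieldType.
Implicit Types (E L G : subfield F) (P Q : place F) (A B : seq F) (p f g h : {poly F}).

Fixpoint tower E (u : nat -> F) (k : nat) : subfield F :=
  if k is k'.+1 then ratf (tower E u k') (u k') else E.

Lemma tower_sub E u k : {subset E <= tower E u k}.
Proof. by elim: k => //= k IH x /IH; apply: ratf_sub. Qed.

Lemma tower_mem E u j k : (j < k)%N -> u j \in tower E u k.
Proof.
elim: k => //= k IH; rewrite ltnS leq_eqVlt => /orP[/eqP->|/IH]; first exact: ratf_gen.
exact: ratf_sub.
Qed.

Lemma tower_min E u k (E' : subfield F) : {subset E <= E'} ->
  (forall j, (j < k)%N -> u j \in E') -> {subset tower E u k <= E'}.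
Proof.
move=> EE'; elim: k => //= k IH h; apply: ratf_min; last exact: h.
by apply: IH => j jk; apply/h/ltnW.
Qed.

Lemma tower_eq E u v k : (forall j, (j < k)%N -> u j = v j) -> tower E u k = tower E v k.
Proof.
elim: k => //= k IH h; rewrite h //; congr (ratf _ _).
by apply: IH => j jk; apply/h/ltnW.
Qed.

Lemma tower_add E u k j : tower E u (k + j) = tower (tower E u k) (fun l => u (k + l)%N) j.
Proof. by elim: j => [|j IH]; rewrite ?addn0 // addnS /= IH. Qed.

(** Keep those elements which are transcendental over the field generated by the
    ones before. *)
Lemma transc_sublist E (ts : seq F) : exists zs : seq F,
  [/\ {subset zs <= ts},
      forall k, (k < size zs)%N -> ~ alg (tower E (nth 0 zs) k) (nth 0 zs k) &
      {in ts, forall x, alg (tower E (nth 0 zs) (size zs)) x}].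
Proof.
elim/last_ind: ts => [|ts x [zs [zts ztr zal]]]; first by exists [::].
case: (pselect (alg (tower E (nth 0 zs) (size zs)) x)) => h.
  exists zs; split=> // [y /zts|y]; rewrite mem_rcons inE; first by move=> ->; rewrite orbT.
  by move=> /orP[/eqP->//|/zal].
have tE k : (k <= size zs)%N -> tower E (nth 0 (rcons zs x)) k = tower E (nth 0 zs) k.
  move=> kz; apply: tower_eq => j jk; rewrite nth_rcons.
  by rewrite (leq_trans jk kz).
exists (rcons zs x); split.
- move=> y; rewrite !mem_rcons !inE => /orP[->//|/zts ->]; exact: orbT.
- move=> k; rewrite size_rcons ltnS => kz; rewrite tE // nth_rcons.
  move: kz; rewrite leq_eqVlt => /orP[/eqP->|kz]; first by rewrite ltnn eqxx.
  by rewrite kz; apply: ztr.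
- move=> y; rewrite mem_rcons inE size_rcons /= tE // nth_rcons ltnn eqxx => /orP[/eqP->|/zal].
    exact/alg_id/ratf_gen.
  by apply: algS; apply: ratf_sub.
Qed.

Lemma alg_adjoin_rcons L ys y :
  alg_adjoin L (rcons ys y) = alg_closure (ratf (alg_adjoin L ys) y).
Proof. by elim: ys L => [|z ys IH] L //=; rewrite IH. Qed.

Lemma res_indep_nth Q L ys k : res_indep Q L ys -> (k < size ys)%N ->
  res_transc Q (alg_adjoin L (take k ys)) (nth 0 ys k).
Proof.
by elim: ys L k => [|y ys IH] L [|k] //= [ry rys]; [|apply: IH].
Qed.

End Tower.

Section Image.
Variables (F M : fieldType) (j : {rmorphism F -> M}).

Definition image_pred (E : subfield F) : {pred M} := fun y => `[< exists2 x : F, x \in E & y = j x >].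

Lemma image_subfield_closed (E : subfield F) : divring_closed (image_pred E).
Proof.
split=> [|x y|x y]; rewrite -!topredE /=.
- by apply/asboolP; exists 1; rewrite ?rpred1 ?rmorph1.
- move=> /asboolP[a aE ->] /asboolP[b bE ->]; apply/asboolP.
  by exists (a - b); rewrite ?rpredB ?rmorphB.
- move=> /asboolP[a aE ->] /asboolP[b bE ->]; apply/asboolP.
  by exists (a / b); rewrite ?rpred_div ?fmorph_div.
Qed.

Definition image_subfield (E : subfield F) : subfield M := Subfield (image_subfield_closed E).

Lemma image_subfieldP (E : subfield F) y : reflect (exists2 x, x \in E & y = j x) (y \in image_subfield E).
Proof. exact: asboolP. Qed.

Lemma mem_image (E : subfield F) x : (j x \in image_subfield E) = (x \in E).
Proof.
by apply/image_subfieldP/idP => [[y yE /fmorph_inj ->]//|xE]; exists x.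
Qed.

Lemma image_poly E (p : {poly M}) : p \is a polyOver (image_subfield E) ->
  exists2 q : {poly F}, q \is a polyOver E & p = map_poly j q.
Proof.
move=> /polyOverP pE.
have /choice[c cP] : forall k, exists c, c \in E /\ p`_k = j c.
  by move=> k; have /image_subfieldP[x xE e] := pE k; exists x.
exists (\poly_(k < size p) c k).
  by apply/polyOverP => k; rewrite coef_poly; case: ifP; [case: (cP k)|rewrite rpred0].
apply/polyP => k; rewrite coef_map coef_poly; case: ltnP => kp; first by case: (cP k).
by rewrite nth_default // raddf0.
Qed.

Lemma polyOver_image (E : subfield F) (q : {poly F}) : q \is a polyOver E -> map_poly j q \is a polyOver (image_subfield E).
Proof. by move=> /polyOverP qE; apply/polyOverP => k; rewrite coef_map /= mem_image. Qed.

Lemma alg_image E x : alg (image_subfield E) (j x) <-> alg E x.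
Proof.
split=> [[p [/image_poly[q qE ->]]]|[q [qE q0 qx]]].
  by rewrite map_poly_eq0 fmorph_root => q0 qx; exists q.
by exists (map_poly j q); rewrite map_poly_eq0 fmorph_root polyOver_image.
Qed.

Lemma preimage_subfield_closed (E : subfield M) : divring_closed (fun x => j x \in E).
Proof.
split=> [|x y|x y]; rewrite -!topredE /= ?rmorph1 ?rpred1 //.
- by rewrite rmorphB => *; apply: rpredB.
- by rewrite fmorph_div => *; apply: rpred_div.
Qed.

Definition preimage_subfield (E : subfield M) : subfield F := Subfield (preimage_subfield_closed E).

Lemma mem_preimage E x : (x \in preimage_subfield E) = (j x \in E).
Proof. by []. Qed.

Variable Q : place M.

Definition comap_pred : {pred F} := fun x => j x \in place_ring Q.
Lemma comap_closed : subring_closed comap_pred.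
Proof.
split=> [|x y|x y]; rewrite -!topredE /= /comap_pred ?rmorph1 ?rpred1 //.
- by rewrite rmorphB => *; apply: rpredB.
- by rewrite rmorphM => *; apply: rpredM.
Qed.
Lemma comap_V x : (x \in comap_pred) || (x^-1 \in comap_pred).
Proof. by rewrite -!topredE /= /comap_pred fmorphV place_ringV. Qed.

Definition comap : place F := Place comap_closed comap_V.

Lemma comapE x : (x \in place_ring comap) = (j x \in place_ring Q).
Proof. by []. Qed.

Lemma comap_max x : (x \in place_max comap) = (j x \in place_max Q).
Proof. by rewrite !place_maxE !comapE fmorphV fmorph_eq0. Qed.

Lemma comap_primitive p : primitive comap p = primitive Q (map_poly j p).
Proof.
rewrite /primitive; congr (_ && ~~ _).
  by apply/polyOverP/polyOverP => h k; move: (h k); rewrite coef_map.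
by apply/polyOverP/polyOverP => h k; move: (h k); rewrite coef_map comap_max.
Qed.

Lemma comap_res_transc (E : subfield F) (L : subfield M) x : {subset image_subfield E <= L} -> res_transc Q L (j x) -> res_transc comap E x.
Proof.
move=> EL [xO h]; split=> // p pE; rewrite comap_primitive => pp.
rewrite comap_max -horner_map; apply: h => //.
exact: polyOverS EL _ (polyOver_image pE).
Qed.

End Image.

Lemma alg_adjoin_closed (M : fieldType) (L : subfield M) ys :
  alg_closed_in L -> alg_closed_in (alg_adjoin L ys).
Proof. by elim: ys L => //= y ys IH L _; apply/IH/alg_closure_closed. Qed.

(** This lemma and the next compare the tower of fields generated by elements of [F]
    with its algebraically closed counterpart in an extension of [F]. *)
Lemma tower_alg_adjoin (F M : fieldType) (j : {rmorphism F -> M}) (E : subfield F)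
  (L : subfield M) (zs : seq F) k x : {subset image_subfield j E <= L} -> (k <= size zs)%N ->
  x \in tower E (nth 0 zs) k -> j x \in alg_adjoin L (map j (take k zs)).
Proof.
move=> EL; elim: k x => [|k IH] x kz.
  by rewrite take0 /= => xE; apply: EL; rewrite mem_image.
rewrite (take_nth 0) // map_rcons alg_adjoin_rcons -mem_preimage.
move: x; apply: ratf_min => [y /(IH _ (ltnW kz)) yA|]; rewrite mem_preimage; apply: alg_closure_sub.
  exact: ratf_sub.
exact: ratf_gen.
Qed.

Lemma alg_adjoin_tower (F M : fieldType) (j : {rmorphism F -> M}) (E : subfield F)
  (zs : seq F) k : (k <= size zs)%N ->
  {subset alg_adjoin (alg_closure (image_subfield j E)) (map j (take k zs)) <=
          alg_closure (image_subfield j (tower E (nth 0 zs) k))}.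
Proof.
elim: k => [|k IH] kz; first by rewrite take0.
rewrite (take_nth 0) // map_rcons alg_adjoin_rcons => y /alg_closureP yA.
apply/alg_closureP/alg_closure_idem; apply: algS yA; apply: ratf_min => [z|].
  move=> /(IH (ltnW kz))/alg_closureP zT; apply/alg_closureP; apply: algS zT.
  by move=> _ /image_subfieldP[w wT ->]; rewrite mem_image; apply: ratf_sub.
by apply: alg_closure_sub; rewrite mem_image; apply: ratf_gen.
Qed.

Section Core.
Variables (F : fieldType).

Lemma place_lift (M : fieldType) (j : {rmorphism F -> M}) (P : place F) :
  exists Q : place M, forall x, (j x \in place_ring Q) = (x \in place_ring P).
Proof.
have [|Q [QA QI]] := @chevalley M [set y | exists2 x, x \in place_ring P & y = j x]
   [set y | exists2 x, x \in place_max P & y = j x].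
  split.
  - by exists 1; rewrite ?rpred1 ?rmorph1.
  - by move=> _ _ [x xP ->] [y yP ->]; exists (x - y); rewrite ?rpredB ?rmorphB.
  - by move=> _ _ [x xP ->] [y yP ->]; exists (x * y); rewrite ?rpredM ?rmorphM.
  - by move=> _ [x xP ->]; exists x => //; apply: place_max_ring.
  - by exists 0; rewrite ?rpred0 ?rmorph0.
  - by move=> _ _ [x xP ->] [y yP ->]; exists (x - y); rewrite ?rpredB ?rmorphB.
  - by move=> _ _ [x xP ->] [y yP ->]; exists (x * y); rewrite ?place_maxMr ?rmorphM.
  - by move=> [x xP]; rewrite -(rmorph1 j) => /fmorph_inj e; rewrite -e place_max1F in xP.
exists Q => x; apply/idP/idP => [|xP]; last by apply: QA; exists x.
apply: contraTT => xP; have x0 : x != 0 by apply: contraNneq xP => ->; rewrite rpred0.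
have : j x^-1 \in place_max Q by apply: QI; exists x^-1 => //; apply: place_notinV.
by rewrite fmorphV place_maxV ?fmorph_eq0.
Qed.

Definition full_subfield_pred : {pred F} := fun=> true.
Lemma full_subfield_closed : divring_closed full_subfield_pred. Proof. by []. Qed.
Definition full_subfield : subfield F := Subfield full_subfield_closed.

(** Apply [tower_open] in an algebraically closed extension of [F], starting from
    the algebraic closure of [E]; the elements [ys] that it provides come from [F],
    to which the place is restricted again. *)
Theorem residually_transcendental_near (E : subfield F) (P : place F) t (ts A B : seq F) :
  t \in E -> t != 0 -> t \in place_max P ->
  (forall x, alg (tower E (nth 0 ts) (size ts)) x) -> satisfies P A B ->
  exists2 Q, agree E P Q /\ satisfies Q A B &
  exists zs : seq F,
    (forall k, (k < size zs)%N -> res_transc Q (tower E (nth 0 zs) k) (nth 0 zs k)) /\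
    forall x, alg (tower E (nth 0 zs) (size zs)) x.
Proof.
move=> tE t0 tM tsF [sA sB].
have [M [j hM]] := exists_closed_ext F.
have [P' P'E] := place_lift j P.
have P'M x : (j x \in place_max P') = (x \in place_max P).
  by rewrite !place_maxE -fmorphV !P'E fmorph_eq0.
pose L := alg_closure (image_subfield j E).
have EL : {subset image_subfield j E <= L} by apply: alg_closure_sub.
have hts : {subset image_subfield j full_subfield <= alg_adjoin L (map j ts)}.
  move=> _ /image_subfieldP[x _ ->]; apply: (alg_adjoin_closed (@alg_closure_closed _ _)).
  have /alg_image h := tsF x; apply: algS (h M j) => _ /image_subfieldP[y yT ->].
  by have := tower_alg_adjoin EL (leqnn _) yT; rewrite take_size.
have [|||||||||||A' [B' [_ _ sAB' hQ]]] := @tower_open M hM P' (image_subfield j full_subfield) (map j ts) L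
    (image_subfield j E) (j t) (map j A) (map j B).
- exact: alg_closure_closed.
- exact: EL.
- by move=> _ /image_subfieldP[x _ ->]; rewrite mem_image.
- by move=> y /alg_closureP.
- by apply: EL; rewrite mem_image.
- by rewrite fmorph_eq0.
- by rewrite P'M.
- by move=> _ /mapP[x _ ->]; rewrite mem_image.
- by move=> _ /mapP[x _ ->]; apply: hts; rewrite mem_image.
- by move=> _ /mapP[x _ ->]; apply: hts; rewrite mem_image.
- by split=> _ /mapP[x xs ->]; rewrite ?P'E ?P'M; [apply: sA|apply: sB].
have [Q [agQ [sAQ sBQ]] [ys [ysF rys ysL]]] := hQ _ sAB'.
have [zs Dys] : exists zs, ys = map j zs.
  elim: ys ysF {rys ysL} => [|y ys IH] h; first by exists [::].
  have [|zs ->] := IH; first by move=> z zys; apply: h; rewrite inE zys orbT.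
  by have /image_subfieldP[z _ ->] := h y (mem_head _ _); exists (z :: zs).
rewrite {ys}Dys in ysF rys ysL.
exists (comap j Q).
  split; first by move=> x xE; rewrite comapE -agQ ?P'E //; apply: EL; rewrite mem_image.
  by split=> x xs; rewrite ?comapE ?comap_max; [apply: sAQ|apply: sBQ]; apply: map_f.
exists zs; split=> [k kz|x].
  have := res_indep_nth rys (k := k); rewrite size_map => /(_ kz).
  rewrite (nth_map 0) // -map_take; apply: comap_res_transc => _ /image_subfieldP[y yT ->].
  exact: (tower_alg_adjoin EL (ltnW kz) yT).
apply/(alg_image j)/alg_closureP.
apply: (alg_adjoin_tower (leqnn _)); rewrite take_size; apply/ysL/hts.
by rewrite mem_image.
Qed.

End Core.

(** * Residue fields in Gauss and t-adic extensions *)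

Section Residues.
Variables (F : fieldType) (Q : place F).
Local Notation O := (place_ring Q).
Local Notation M := (place_max Q).
Implicit Types (E : subfield F) (p : {poly F}).

(** The residue map, with a junk value outside the valuation ring. *)
Definition res (x : F) : residue_field Q := residue (insubd (0 : vring Q) x).

Lemma res_val (x : vring Q) : res (val x) = residue x.
Proof. by rewrite /res valKd. Qed.

Lemma resE x (xO : x \in O) : res x = residue (exist _ x xO : vring Q).
Proof. by rewrite -res_val. Qed.

Lemma resD x y : x \in O -> y \in O -> res (x + y) = res x + res y.
Proof.
move=> xO yO; rewrite (resE xO) (resE yO) -rmorphD /= -res_val; congr res.
Qed.

Lemma resB x y : x \in O -> y \in O -> res (x - y) = res x - res y.
Proof.
move=> xO yO; rewrite (resE xO) (resE yO) -rmorphB /= -res_val; congr res.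
Qed.

Lemma resM x y : x \in O -> y \in O -> res (x * y) = res x * res y.
Proof.
move=> xO yO; rewrite (resE xO) (resE yO) -rmorphM /= -res_val; congr res.
Qed.

Lemma res1 : res 1 = 1.
Proof. by rewrite -(rmorph1 (@residue F Q)) /= -res_val. Qed.

Lemma res_eq0 x : x \in O -> (res x == 0) = (x \in M).
Proof. by move=> xO; rewrite (resE xO) residue_eq0. Qed.

Lemma res0 : res 0 = 0.
Proof. by apply/eqP; rewrite res_eq0 ?rpred0. Qed.

Lemma res_surj (a : residue_field Q) : exists2 x, x \in O & res x = a.
Proof.
have [x <-] := residue_surj a; exists (val x); last exact: res_val.
by case: x.
Qed.

Lemma resV x : x \in place_unit Q -> res x^-1 = (res x)^-1.
Proof.
move=> xU; have xO := place_unitO xU; have x0 := place_unit_nz xU.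
have xVO : x^-1 \in O by apply: place_unitO; rewrite rpredV.
have r0 : res x != 0 by rewrite res_eq0 //; case/place_unitP: xU.
by apply: (mulfI r0); rewrite -resM // !mulfV // res1.
Qed.

Lemma res_sum (I : Type) (s : seq I) (f : I -> F) : (forall j, f j \in O) ->
  res (\sum_(j <- s) f j) = \sum_(j <- s) res (f j).
Proof.
move=> fO; elim: s => [|j s IH]; first by rewrite !big_nil res0.
by rewrite !big_cons resD ?IH // rpred_sum.
Qed.

Lemma resX x n : x \in O -> res (x ^+ n) = res x ^+ n.
Proof.
by move=> xO; elim: n => [|n IH]; rewrite ?expr0 ?res1 // !exprS resM ?rpredX // IH.
Qed.

Definition res_poly p : {poly residue_field Q} := \poly_(k < size p) res p`_k.

Lemma coef_res_poly p k : (res_poly p)`_k = res p`_k.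
Proof. by rewrite coef_poly; case: ltnP => // h; rewrite nth_default // res0. Qed.

Lemma res_horner p x : p \is a polyOver O -> x \in O -> res p.[x] = (res_poly p).[res x].
Proof.
move=> /polyOverP pO xO; rewrite horner_poly horner_coef res_sum.
  by apply: eq_bigr => k _; rewrite resM ?rpredX // resX.
by move=> k; rewrite rpredM ?rpredX.
Qed.

Lemma res_poly_neq0 p : primitive Q p -> res_poly p != 0.
Proof.
move=> pp; have [k pk _] := primitive_low pp; apply: contraNneq pk => e.
rewrite -res_eq0; first by rewrite -coef_res_poly e coef0.
by move/polyOverP: (primitiveO pp).
Qed.

Definition res_subfield_pred E : {pred residue_field Q} :=
  fun a => `[< exists2 x, x \in E /\ x \in O & a = res x >].

Lemma res_subfield_closed E : divring_closed (res_subfield_pred E).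
Proof.
split=> [|a b|a b]; rewrite -!topredE /=.
- by apply/asboolP; exists 1; rewrite ?rpred1 ?res1.
- move=> /asboolP[x [xE xO] ->] /asboolP[y [yE yO] ->]; apply/asboolP.
  by exists (x - y); rewrite ?rpredB ?resB.
- move=> /asboolP[x [xE xO] ->] /asboolP[y [yE yO] ->]; apply/asboolP.
  case: (boolP (y \in M)) => yM.
    exists 0; rewrite ?rpred0 // res0; have /eqP-> : res y == 0 by rewrite res_eq0.
    by rewrite invr0 mulr0.
  have yU : y \in place_unit Q by apply/place_unitP.
  have yVO : y^-1 \in O by apply: place_unitO; rewrite rpredV.
  by exists (x / y); [rewrite rpred_div ?rpredM|rewrite resM // resV].
Qed.

Definition res_subfield E : subfield (residue_field Q) := Subfield (res_subfield_closed E).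

Lemma res_subfieldP E a : reflect (exists2 x, x \in E /\ x \in O & a = res x)
  (a \in res_subfield E).
Proof. exact: asboolP. Qed.

Lemma res_subfield_mem E x : x \in E -> x \in O -> res x \in res_subfield E.
Proof. by move=> xE xO; apply/res_subfieldP; exists x. Qed.

Lemma res_subfieldS E E' : {subset E <= E'} -> {subset res_subfield E <= res_subfield E'}.
Proof. by move=> s a /res_subfieldP[x [/s xE xO] ->]; apply: res_subfield_mem. Qed.

Lemma polyOver_res E p : p \is a polyOver E -> p \is a polyOver O ->
  res_poly p \is a polyOver (res_subfield E).
Proof.
move=> /polyOverP pE /polyOverP pO; apply/polyOverP => k; rewrite coef_res_poly.
exact: res_subfield_mem.
Qed.

Lemma res_poly_lift E (r : {poly residue_field Q}) : r \is a polyOver (res_subfield E) ->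
  exists p, [/\ p \is a polyOver E, p \is a polyOver O & r = res_poly p].
Proof.
move=> /polyOverP rE.
have /choice[c cP] : forall k, exists c, [/\ c \in E, c \in O & r`_k = res c].
  by move=> k; have /res_subfieldP[x [xE xO] e] := rE k; exists x.
exists (\poly_(k < size r) c k); split.
- by apply/polyOverP => k; rewrite coef_poly; case: ifP; [case: (cP k)|rewrite rpred0].
- by apply/polyOverP => k; rewrite coef_poly; case: ifP; [case: (cP k)|rewrite rpred0].
- apply/polyP => k; rewrite coef_res_poly coef_poly; case: ltnP => h; first by case: (cP k).
  by rewrite nth_default // res0.
Qed.

Lemma res_transc_res E y : res_transc Q E y -> ~ alg (res_subfield E) (res y).
Proof.
move=> [yO h] [r [/res_poly_lift[p [pE pO ->]] r0 ry]].
have pp : primitive Q p.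
  rewrite /primitive pO; apply: contra r0 => /polyOverP pM; apply/eqP/polyP => k.
  by rewrite coef_res_poly coef0; apply/eqP; rewrite res_eq0 //; apply: place_max_ring.
by case/negP: (h p pE pp); rewrite -res_eq0 ?res_horner // ?horner_place.
Qed.

Lemma alg_res E x : alg E x -> x \in O -> alg (res_subfield E) (res x).
Proof.
move=> /(alg_primitive Q)[p [pE pp px]] xO; exists (res_poly p); split.
- by apply: polyOver_res => //; apply: primitiveO.
- exact: res_poly_neq0.
- by rewrite rootE -res_horner ?primitiveO // (rootP px) res0.
Qed.

Section Gauss.
Variables (E : subfield F) (y : F).
Hypothesis ry : res_transc Q E y.

(** Divide numerator and denominator by their contents. *)
Lemma gauss_form f : f \in ratf E y -> f != 0 -> exists c p q,
  [/\ c \in E /\ c != 0, p \is a polyOver E /\ primitive Q p,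
      q \is a polyOver E /\ primitive Q q & f = c * (p.[y] / q.[y])].
Proof.
move=> /ratfP[p [q [pE qE q0 ->]]] f0.
have pn : p != 0 by apply: contraNneq f0 => ->; rewrite horner0 mul0r.
have qn : q != 0 by apply: contraNneq q0 => ->; rewrite horner0.
have [k pk pp] := primitive_content Q pn; have [l ql qq] := primitive_content Q qn.
have pkE : p`_k \in E by move/polyOverP: pE.
have qlE : q`_l \in E by move/polyOverP: qE.
exists (p`_k / q`_l), ((p`_k)^-1 *: p), ((q`_l)^-1 *: q); split.
- by rewrite rpred_div // mulf_neq0 ?invr_eq0.
- by rewrite polyOverZ ?rpredV.
- by rewrite polyOverZ ?rpredV.
- by rewrite !hornerZ [RHS]mulf_div !mulVKf.
Qed.

Lemma gauss_value f : f \in ratf E y -> f != 0 ->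
  exists2 c, c \in E /\ c != 0 & f / c \in place_unit Q.
Proof.
move=> fE f0; have [c [p [q [[cE c0] [pE pp] [qE qq] ->]]]] := gauss_form fE f0.
exists c => //; rewrite mulrAC divff // mul1r rpred_div //; exact: res_transc_unit ry _ _.
Qed.

Lemma gauss_res : {subset res_subfield (ratf E y) <= ratf (res_subfield E) (res y)}.
Proof.
move=> a /res_subfieldP[f [fE fO] ->].
case: (eqVneq f 0) => [->|f0]; first by rewrite res0 rpred0.
have [c [p [q [[cE c0] [pE pp] [qE qq] Df]]]] := gauss_form fE f0.
have pU := res_transc_unit ry pE pp; have qU := res_transc_unit ry qE qq.
have qVU : (q.[y])^-1 \in place_unit Q by rewrite rpredV.
have cO : c \in O.
  have wU : p.[y] / q.[y] \in place_unit Q by rewrite rpredM.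
  by move: fO; rewrite Df mulrC place_ring_unitM.
have yO : y \in O by case: ry.
have pO := place_unitO pU; have qVO := place_unitO qVU.
rewrite Df (resM cO (rpredM pO qVO)) (resM pO qVO) resV //.
rewrite rpredM //; first by apply/ratf_sub/res_subfield_mem.
rewrite !res_horner ?primitiveO //.
have h r : r \is a polyOver E -> primitive Q r ->
    (res_poly r).[res y] \in ratf (res_subfield E) (res y).
  move=> rE rr; apply: rpred_horner; last exact: ratf_gen.
  apply: (polyOverS (@ratf_sub _ (res_subfield E) (res y))).
  by apply: polyOver_res => //; apply: primitiveO.
by rewrite rpred_div // h.
Qed.

End Gauss.

Section Tadic.
Variables (E : subfield F) (t : F).
Hypotheses (EO : {subset E <= O}) (t0 : t != 0) (tM : t \in M).

Lemma trivial_unit c : c \in E -> c != 0 -> c \in place_unit Q.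
Proof. by move=> cE c0; rewrite place_unitE // !EO ?rpredV. Qed.

(** The lowest nonzero term of [p] dominates at [t]. *)
Lemma tadic_poly p : p \is a polyOver E -> p != 0 ->
  exists k c, [/\ c \in E, c != 0 & p.[t] / (t ^+ k * c) - 1 \in M].
Proof.
move=> pE p0; have pO : p \is a polyOver O by apply: polyOverS EO _ pE.
have pp : primitive Q p.
  have lE : lead_coef p \in E by rewrite lead_coefE; move/polyOverP: pE.
  have lc0 : lead_coef p != 0 by rewrite lead_coef_eq0.
  by apply: (primitive_coef (k := (size p).-1)) => //; case/place_unitP: (trivial_unit lE lc0).
have [k pk mk] := primitive_low pp.
have ckE j : p`_j \in E by move/polyOverP: pE.
have pk0 : p`_k != 0 by apply: place_unit_neq0 pk.
have low j : (j < k)%N -> p`_j = 0.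
  move=> /mk pM; apply/eqP/contraT => pj0.
  by case/place_unitP: (trivial_unit (ckE j) pj0); rewrite pM.
exists k, p`_k; split=> //.
have -> : p.[t] = (drop_poly k p).[t] * t ^+ k.
  rewrite -{1}(poly_take_drop k p) hornerD hornerM hornerXn.
  have -> : take_poly k p = 0; last by rewrite horner0 add0r.
  by apply/polyP => j; rewrite coef_take_poly coef0; case: ltnP => // /low.
have -> : (drop_poly k p).[t] * t ^+ k / (t ^+ k * p`_k) - 1 =
    (p`_k)^-1 * (drop_poly k p - (p`_k)%:P).[t].
  rewrite hornerD hornerN hornerC invfM mulrA mulfK ?expf_neq0 // mulrBr mulVf //.
  by rewrite mulrC.
apply: place_maxMr; first by rewrite EO // rpredV.
have -> : drop_poly k p - (p`_k)%:P = drop_poly 1 (drop_poly k p) * 'X.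
  apply/polyP => j; rewrite coefB coefMX coefC !coef_drop_poly.
  by case: j => [|j] /=; rewrite ?add0n ?subrr // subr0 addn1.
rewrite hornerM hornerX place_maxMr //; apply: horner_place; last exact: place_max_ring.
by apply/polyOverP => j; rewrite !coef_drop_poly; move/polyOverP: pO.
Qed.

Lemma unit_1M x : x - 1 \in M -> x \in place_unit Q.
Proof.
move=> xM; apply/place_unitP; rewrite -[x](subrK 1) rpredD ?rpred1 //; last exact: place_max_ring.
by rewrite addrC place_unitD // place_max1F.
Qed.

Lemma tadic_form f : f \in ratf E t -> f != 0 ->
  exists (k : int) c, [/\ c \in E, c != 0 & f / (t ^ k * c) - 1 \in M].
Proof.
move=> /ratfP[p [q [pE qE q0 ->]]] f0.
have pn : p != 0 by apply: contraNneq f0 => ->; rewrite horner0 mul0r.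
have qn : q != 0 by apply: contraNneq q0 => ->; rewrite horner0.
have [k [c [cE c0 hp]]] := tadic_poly pE pn; have [l [d [dE d0 hq]]] := tadic_poly qE qn.
exists (k%:Z - l%:Z), (c / d); split; [exact: rpred_div|by rewrite mulf_neq0 ?invr_eq0|].
set w := p.[t] / _ in hp; set v := q.[t] / _ in hq.
have -> : p.[t] / q.[t] / (t ^ (k%:Z - l%:Z) * (c / d)) = w / v.
  rewrite expfzDr // -invr_expz -!exprnP /w /v mulf_div !invf_div mulf_div mulf_div.
  by rewrite [_ * q.[t]]mulrC.
have vU : v \in place_unit Q by apply: unit_1M.
have v0 := place_unit_nz vU.
have -> : w / v - 1 = v^-1 * ((w - 1) - (v - 1)).
  by rewrite opprB addrA subrK mulrBr mulVf // mulrC.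
by apply: place_maxMr; [rewrite place_unitO // rpredV|rewrite rpredB].
Qed.

Lemma tadic_value f : f \in ratf E t -> f != 0 ->
  exists k : int, f / t ^ k \in place_unit Q.
Proof.
move=> fE f0; have [k [c [cE c0 h]]] := tadic_form fE f0; exists k.
have -> : f / t ^ k = f / (t ^ k * c) * c by rewrite invfM mulrA divfK.
by apply: rpredM; [apply: unit_1M|apply: trivial_unit].
Qed.

Lemma tadic_pow_unit (k : int) : t ^ k \in O -> k != 0 -> t ^ k \in M.
Proof.
case: k => [[|k]|k] //; first by rewrite -exprnP exprn_place_max.
rewrite /exprz => h _; have := exprn_place_max k tM.
by rewrite -[t ^+ _]invrK place_maxV ?h // invr_eq0 expf_neq0.
Qed.

(** Up to an element [c] of [E] and a factor congruent to 1, [f] is a power of [t],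
    whose exponent is 0 unless the residue vanishes. *)
Lemma tadic_res : {subset res_subfield (ratf E t) <= res_subfield E}.
Proof.
move=> a /res_subfieldP[f [fE fO] ->].
case: (eqVneq f 0) => [->|f0]; first by rewrite res0 rpred0.
have [k [c [cE c0 h]]] := tadic_form fE f0.
have tkO : t ^ k \in O.
  have wU := unit_1M h; move: fO.
  have -> : f = (f / (t ^ k * c) * c) * t ^ k.
    by rewrite -mulrA [c * _]mulrC divfK // mulf_neq0 // expfz_neq0.
  by rewrite place_ring_unitM // rpredM // trivial_unit.
case: (eqVneq k 0) => [k0|k0].
  move: h; rewrite k0 expr0z mul1r => h.
  have -> : res f = res c; last by rewrite res_subfield_mem ?EO.
  have cO := EO cE; apply/eqP; rewrite -subr_eq0 -(resB fO cO) res_eq0; last exact: rpredB.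
  have -> : f - c = c * (f / c - 1) by rewrite mulrBr mulr1 mulrC divfK.
  by rewrite place_maxMr.
have tkM := tadic_pow_unit tkO k0.
have /eqP-> : res f == 0; last exact: rpred0.
rewrite res_eq0 //; have -> : f = (f / (t ^ k * c) * c) * t ^ k.
  by rewrite -mulrA [c * _]mulrC divfK // mulf_neq0 // expfz_neq0.
apply: place_maxMr => //; apply: rpredM; last exact: EO.
by apply: place_unitO; apply: unit_1M.
Qed.

End Tadic.

Section TowerResidue.
Variables (E : subfield F) (u : nat -> F) (n : nat).
Hypothesis ru : forall k, (k < n)%N -> res_transc Q (tower E u k) (u k).

Lemma tower_value f : f \in tower E u n -> f != 0 ->
  exists2 c, c \in E /\ c != 0 & f / c \in place_unit Q.
Proof.
elim: n ru f => [|m IH] hu f /= fE f0.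
  by exists f => //; rewrite divff // rpred1.
have [c [cE c0] fc] := gauss_value (hu m (ltnSn m)) fE f0.
have [d [dE d0] cd] := IH (fun k km => hu k (ltnW km)) c cE c0.
by exists d => //; rewrite -[f](divfK c0) -[_ * _ / d]mulrA rpredM.
Qed.

Lemma res_tower :
  res_subfield (tower E u n) = tower (res_subfield E) (fun k => res (u k)) n.
Proof.
elim: n ru => [//|m IH] hu.
have -> : tower (res_subfield E) (fun k => res (u k)) m.+1 =
    ratf (res_subfield (tower E u m)) (res (u m)).
  by rewrite /= IH // => k km; apply/hu/ltnW.
apply: subfield_ext => a; apply/idP/idP; move: a; first exact: gauss_res (hu m (ltnSn m)).
apply: ratf_min; first exact: res_subfieldS (@ratf_sub _ _ _).
by apply: res_subfield_mem; [apply: ratf_gen|case: (hu m (ltnSn m))].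
Qed.

End TowerResidue.

End Residues.

(** * Values and residues in a finite extension *)

Section Span.
Variable F : fieldType.
Implicit Types (E D : subfield F) (S : seq F) (p q : {poly F}).

Inductive in_span E S : F -> Prop :=
| In_span0 : in_span E S 0
| In_spanD c s f : c \in E -> s \in S -> in_span E S f -> in_span E S (c * s + f).

Lemma in_spanZD E S c f g : c \in E -> in_span E S f -> in_span E S g -> in_span E S (c * f + g).
Proof.
move=> cE hf hg; elim: hf => [|d s f' dE sS _ IH]; first by rewrite mulr0 add0r.
rewrite mulrDr -addrA mulrA; apply: In_spanD => //; exact: rpredM.
Qed.

Lemma in_span_sum E S (I : Type) (r : seq I) (c f : I -> F) :
  (forall j, c j \in E) -> (forall j, in_span E S (f j)) ->
  in_span E S (\sum_(j <- r) c j * f j).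
Proof.
move=> cE hf; elim: r => [|j r IH]; first by rewrite big_nil; apply: In_span0.
by rewrite big_cons; apply: in_spanZD.
Qed.

(** This is the step for a tower of two finite extensions: products of generators
    generate. *)
Lemma in_span_mul E S S' x y : in_span E S x -> y \in S' ->
  in_span E [seq a * b | a <- S, b <- S'] (x * y).
Proof.
move=> hx yS; elim: hx => [|c s f cE sS _ IH]; first by rewrite mul0r; apply: In_span0.
rewrite mulrDl -mulrA; apply: In_spanD => //.
by apply/allpairsP; exists (s, y).
Qed.

Lemma in_span_coef E S f : in_span E S f ->
  exists a : 'I_(size S) -> F, (forall j, a j \in E) /\ f = \sum_j a j * S`_j.
Proof.
elim=> [|c s f' cE sS _ [a [aE ->]]].
  by exists (fun=> 0); split=> [j|]; rewrite ?rpred0 // big1 // => j _; rewrite mul0r.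
have sz : (index s S < size S)%N by rewrite index_mem.
exists (fun j => (if j == Ordinal sz then c else 0) + a j); split=> [j|].
  by rewrite rpredD //; case: ifP => _; rewrite ?rpred0.
apply: esym; under eq_bigr => j _ do rewrite mulrDl.
rewrite big_split /=; congr (_ + _).
rewrite (bigD1 (Ordinal sz)) //= eqxx nth_index // big1 ?addr0 // => j /negPf ->.
by rewrite mul0r.
Qed.

(** More vectors than generators: the matrix of coefficients has a kernel. *)
Lemma span_dependent E S (f : 'I_(size S).+1 -> F) : (forall j, in_span E S (f j)) ->
  exists c : 'I_(size S).+1 -> F, [/\ forall j, c j \in E, exists j, c j != 0 &
    \sum_j c j * f j = 0].
Proof.
move=> /(_ _)/in_span_coef h; have /choice[a aP] := h.
pose A : 'M[subfield_type E]_((size S).+1, size S) :=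
  \matrix_(k, j) exist _ (a k j) ((aP k).1 j).
have kA : kermx A != 0.
  by rewrite -mxrank_eq0 mxrank_ker subn_eq0 -ltnNge ltnS rank_leq_col.
have /rowV0Pn[v /sub_kermxP vA v0] := kA.
exists (fun k => val (v 0 k)); split.
- by move=> k; case: (v 0 k).
- apply/existsP; apply: contraNT v0 => /existsPn h0; apply/eqP/rowP => k.
  by rewrite mxE; apply: val_inj; rewrite raddf0; apply/eqP; rewrite -[_ == _]negbK h0.
- under eq_bigr => k _ do rewrite (aP k).2 mulr_sumr.
  rewrite exchange_big big1 //= => j _.
  have /(congr1 val) := congr1 (fun B : 'rV_(size S) => B 0 j) vA.
  rewrite !mxE => e0.
  have e : \sum_k val (v 0 k * A k j) = 0.
    by rewrite -[RHS]e0; elim/big_rec2: _ => // k x y _ ->.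
  transitivity ((\sum_k val (v 0 k * A k j)) * S`_j); last by rewrite e mul0r.
  by rewrite mulr_suml; apply: eq_bigr => k _; rewrite mxE /= mulrA.
Qed.

Lemma alg_nonzero_const D x : alg D x -> x != 0 ->
  exists p, [/\ p \is a polyOver D, p`_0 != 0 & root p x].
Proof.
move=> [p [pD p0 px]] x0; elim: {p}(size p) {-2}p (leqnn (size p)) pD p0 px => [|n IH] p sp pD p0 px.
  by rewrite leqn0 size_poly_eq0 (negPf p0) in sp.
case: (eqVneq p`_0 0) => [p00|]; last by exists p.
have Dp : p = drop_poly 1 p * 'X.
  by apply/polyP => -[|k]; rewrite coefMX coef_drop_poly ?addn1.
apply: (IH (drop_poly 1 p)).
- by rewrite size_drop_poly leq_subLR add1n.
- by apply/polyOverP => k; rewrite coef_drop_poly; move/polyOverP: pD.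
- by apply: contraNneq p0 => e; rewrite Dp e mul0r.
- by move: px; rewrite {1}Dp rootM rootX (negPf x0) orbF.
Qed.

Lemma alg_inv_poly D x : alg D x -> x != 0 ->
  exists2 p, p \is a polyOver D & x^-1 = p.[x].
Proof.
move=> xD x0; have [p [pD p0 px]] := alg_nonzero_const xD x0.
have p0D : p`_0 \in D by move/polyOverP: pD.
exists (- (p`_0)^-1 *: drop_poly 1 p).
  rewrite polyOverZ ?rpredN ?rpredV //.
  by apply/polyOverP => k; rewrite coef_drop_poly; move/polyOverP: pD.
have := rootP px; have -> : p = drop_poly 1 p * 'X + (p`_0)%:P.
  by apply/polyP => -[|k]; rewrite coefD coefMX coefC coef_drop_poly /= ?add0r ?addr0 ?addn1.
rewrite hornerD hornerM hornerX hornerC => /eqP; rewrite addr_eq0 => /eqP e.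
rewrite coefD coefMX coefC /= add0r hornerZ.
rewrite -[in RHS](mulfK x0 (drop_poly 1 _).[x]).
have -> : drop_poly 1 (drop_poly 1 p * 'X + (p`_0)%:P) = drop_poly 1 p.
  by apply/polyP => k; rewrite !coef_drop_poly coefD coefMX coefC !addn1 addr0 /= coef_drop_poly addn1.
by rewrite e mulrA mulrNN mulVf // mul1r.
Qed.

(** Inverses are polynomials by [alg_inv_poly], and degrees are bounded by division
    by an equation of [x]. *)
Lemma ratf_alg_poly D x : alg D x -> exists N, forall f, f \in ratf D x ->
  exists p, [/\ p \is a polyOver D, (size p <= N)%N & f = p.[x]].
Proof.
move=> xD; have [m [mD m0 mx]] := xD; have [m' Dm] := polyOver_lift mD.
exists (size m) => f /ratfP[p [q [pD qD q0 ->]]].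
have qA : alg D q.[x].
  apply/alg_closureP; apply: rpred_horner; last exact/alg_closureP.
  exact: polyOverS (@alg_closure_sub _ _) _ qD.
have [r rD ->] := alg_inv_poly qA q0.
pose g := p * (r \Po q); have gD : g \is a polyOver D by rewrite rpredM // polyOver_comp.
have -> : p.[x] * r.[q.[x]] = g.[x] by rewrite hornerM horner_comp.
have [g' Dg] := polyOver_lift gD.
exists (map_poly val (g' %% m')); split; first exact: polyOver_map.
  rewrite size_map_poly Dm size_map_poly; apply/ltnW/ltn_modpN0.
  by move: m0; rewrite Dm map_poly_eq0.
rewrite Dg {1}(divp_eq g' m') rmorphD rmorphM /= -Dm hornerD hornerM (rootP mx).
by rewrite mulr0 add0r.
Qed.

Definition spanned E D := exists S, forall f, f \in D -> in_span E S f.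

Lemma spanned_ratf E D x : spanned E D -> alg D x -> spanned E (ratf D x).
Proof.
move=> [S hS] /ratf_alg_poly[N hN].
exists [seq a * b | a <- S, b <- [seq x ^+ k | k <- iota 0 N]] => f /hN[p [pD sp ->]].
rewrite (horner_coef_wide x sp).
rewrite (eq_bigr (fun k : 'I_N => 1 * (p`_k * x ^+ k))) => [|k _]; last by rewrite mul1r.
apply: in_span_sum => [_|k]; first exact: rpred1.
apply: in_span_mul; first by apply: hS; move/polyOverP: pD.
by apply/mapP; exists (k : nat) => //; rewrite mem_iota /=.
Qed.

Lemma spanned_refl E : spanned E E.
Proof.
exists [:: 1] => f fE; rewrite -[f]addr0 -[f in f + _]mulr1.
by apply: In_spanD; rewrite ?mem_head //; apply: In_span0.
Qed.

Lemma spanned_all E (s : seq F) : (forall x, alg E x) ->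
  exists D, [/\ {subset E <= D}, {subset s <= D} & spanned E D].
Proof.
move=> Ea; elim: s => [|x s [D [ED sD hD]]].
  by exists E; split=> //; apply: spanned_refl.
exists (ratf D x); split.
- by move=> y /ED; apply: ratf_sub.
- by move=> y; rewrite inE => /orP[/eqP->|/sD]; [apply: ratf_gen|apply: ratf_sub].
- by apply: spanned_ratf => //; apply: algS (Ea x).
Qed.

End Span.

(** Used for the elements of distinct values and for those of independent residues,
    whose number is bounded by that of the generators of the extension. *)
Lemma exists_maximal_seq (T : Type) (I : seq T -> Prop) n : I [::] ->
  (forall s, I s -> (size s <= n)%N) -> exists2 s, I s & forall x, ~ I (rcons s x).
Proof.
move=> I0 In; pose S k := `[< exists2 s, I s & size s = k >].
have eS : exists k, S k by exists 0%N; apply/asboolP; exists [::].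
have bS k : S k -> (k <= n)%N by move=> /asboolP[s /In sn <-].
have [k /asboolP[s Is sk] mk] := ex_maxnP eS bS.
exists s => // x Ix; have := mk (size s).+1; rewrite sk ltnn => h.
suff : false by []; apply: h; apply/asboolP; exists (rcons s x) => //.
by rewrite size_rcons sk.
Qed.

Section FiniteExtension.
Variables (F : fieldType) (Q : place F) (E : subfield F) (S : seq F).
Hypothesis hS : forall f, in_span E S f.
Local Notation O := (place_ring Q).
Local Notation M := (place_max Q).

(** Equality of values modulo the value group of [E]. *)
Definition value_equiv (x y : F) : bool :=
  `[< exists c, [/\ c \in E, c != 0 & x / (y * c) \in place_unit Q] >].

(** Dividing by the term of least value leaves 1 plus elements of the maximal
    ideal. *)
Lemma sum_distinct_values (n : nat) (g : 'I_n -> F) : (exists j, g j != 0) ->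
  (forall j k, j != k -> g j != 0 -> g k != 0 -> g j / g k \notin place_unit Q) ->
  \sum_j g j != 0.
Proof.
move=> [j0 gj0] hg; pose s := [seq (g j)^-1 | j <- enum 'I_n & g j != 0].
have [||_ /mapP[j + ->]] := @seq_max_value _ Q s.
- apply/eqP => /(congr1 size)/eqP; rewrite size_map size_eq0 => /eqP e.
  have : j0 \in [seq j <- enum 'I_n | g j != 0] by rewrite mem_filter gj0 mem_enum.
  by rewrite e.
- by move=> _ /mapP[j + ->]; rewrite mem_filter invr_eq0 => /andP[].
rewrite mem_filter => /andP[gj _] mj.
have small k : k != j -> g k / g j \in M.
  move=> kj; case: (eqVneq (g k) 0) => [->|gk]; first by rewrite mul0r rpred0.
  have kO : g k / g j \in O.
    have := mj (g k)^-1; rewrite invrK mulrC; apply; apply/mapP; exists k => //.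
    by rewrite mem_filter gk mem_enum.
  by apply/contraT => h; case/negP: (hg k j kj gk gj); apply/place_unitP.
rewrite (bigD1 j) //=; apply/eqP => e.
have : g j / g j + \sum_(k < n | k != j) g k / g j \notin M.
  rewrite divff // place_unitD ?place_max1F //; exact: rpred_sum.
by rewrite -mulr_suml -mulrDl e mul0r rpred0.
Qed.

(** In a linear relation over [E] the nonzero terms cannot have distinct values, so
    elements with distinct values modulo those of [E] are independent. *)
Lemma value_equiv_bound (fs : seq F) : all (fun f => f != 0) fs ->
  pairwise (fun x y => ~~ value_equiv x y) fs -> (size fs <= size S)%N.
Proof.
move=> fs0 /(pairwiseP 0) pw; rewrite leqNgt; apply/negP => sz.
have [c [cE cn e]] := span_dependent (fun j : 'I_(size S).+1 => hS fs`_j).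
have := @sum_distinct_values _ (fun j => c j * fs`_j).
rewrite e eqxx => h; suff : false by []; apply: h.
  case: cn => j cj; exists j; rewrite mulf_neq0 //.
  by move/(all_nthP 0): fs0; apply; apply: leq_trans (ltn_ord j) sz.
move=> j k jk gj gk; apply/negP => U.
have szl (l : 'I_(size S).+1) : (l < size fs)%N by apply: leq_trans (ltn_ord l) sz.
have [cj fj] : c j != 0 /\ fs`_j != 0 by move: gj; rewrite mulf_eq0 negb_or => /andP[].
have [ck fk] : c k != 0 /\ fs`_k != 0 by move: gk; rewrite mulf_eq0 negb_or => /andP[].
wlog ltjk : j k jk gj gk U cj fj ck fk / (j < k)%N.
  move=> W; case: (ltngtP j k) => [|lt|/val_inj e']; first exact: W.
    by apply: (W k j) => //; rewrite 1?eq_sym // -invf_div rpredV.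
  by rewrite e' eqxx in jk.
case/negP: (pw j k (szl j) (szl k) ltjk); apply/asboolP.
exists (c k / c j); rewrite rpred_div // mulf_neq0 ?invr_eq0 //; split=> //.
by rewrite mulrA [fs`_k * _]mulrC invf_div mulrA [fs`_j * _]mulrC.
Qed.

Lemma finite_values : exists fs : seq F, all (fun f => f != 0) fs /\
  forall f, f != 0 -> exists2 g, g \in fs & value_equiv g f.
Proof.
have [||fs /andP[fs0 pw] mx] := @exists_maximal_seq F
  (fun s => all (fun f => f != 0) s && pairwise (fun x y => ~~ value_equiv x y) s) (size S).
- by [].
- by move=> s /andP[s0 ps]; apply: value_equiv_bound.
exists fs; split=> // f f0; apply: contrapT => h; apply: (mx f).
rewrite all_rcons f0 fs0 /= pairwise_rcons pw andbT; apply/allP => g gfs.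
by apply/negP => ve; apply: h; exists g.
Qed.

Definition res_free (rs : seq F) : Prop := {subset rs <= O} /\
  forall c : 'I_(size rs) -> residue_field Q, (forall j, c j \in res_subfield Q E) ->
    \sum_j c j * res Q rs`_j = 0 -> forall j, c j = 0.

(** A linear relation over [E], divided by its content, induces one between the
    residues. *)
Lemma res_free_bound rs : res_free rs -> (size rs <= size S)%N.
Proof.
move=> [rsO fr]; rewrite leqNgt; apply/negP => sz.
have [c [cE [j0 cj0] e]] := span_dependent (fun j : 'I_(size S).+1 => hS rs`_j).
have szl (l : 'I_(size S).+1) : (l < size rs)%N by apply: leq_trans (ltn_ord l) sz.
pose p := \poly_(j < (size S).+1) (if insub j is Some j' then c j' else 0).
have sp : (size p <= (size S).+1)%N by apply: size_poly.
have pc (j : 'I_(size S).+1) : p`_j = c j by rewrite coef_poly ltn_ord valK.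
have p0 : p != 0 by apply: contraNneq cj0 => p0; rewrite -pc p0 coef0.
have pE k : p`_k \in E.
  by rewrite coef_poly; case: ifP => _; rewrite ?rpred0 //; case: insub => [?|]; rewrite ?rpred0.
have [k pk pp] := primitive_content Q p0.
have [l ql _] := primitive_low pp; have /polyOverP qO := primitiveO pp.
set q := _ *: p in pp ql qO.
have qE j : q`_j \in E by rewrite coefZ rpredM ?rpredV.
have lS : (l < (size S).+1)%N.
  rewrite ltnNge; apply: contra ql => h; rewrite coefZ.
  by rewrite (nth_default 0 (leq_trans sp h)) mulr0 rpred0.
have ls : (l < size rs)%N := leq_trans lS sz.
have rO j : (j < size rs)%N -> rs`_j \in O by move=> h; apply/rsO/mem_nth.
have big0 j : (size S < j)%N -> q`_j = 0.
  by move=> h; rewrite coefZ (nth_default 0 (leq_trans sp h)) mulr0.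
have lc := fr (fun j => res Q q`_j) _ _ (Ordinal ls).
case/negP: ql; rewrite -res_eq0 //; apply/eqP; apply: lc => [j|].
  exact: res_subfield_mem.
have -> : \sum_(j < size rs) res Q q`_j * res Q rs`_j = res Q (\sum_(j < size rs) q`_j * rs`_j).
  by rewrite res_sum => [|j]; [apply: eq_bigr => j _; rewrite resM|rewrite rpredM] => //; apply: rO.
rewrite (_ : \sum_(j < size rs) _ = 0) ?res0 //.
rewrite -(big_mkord xpredT (fun j => q`_j * rs`_j)) (big_cat_nat (n := (size S).+1)) //=.
rewrite [X in _ + X]big_nat_cond [X in _ + X]big1 ?addr0; last first.
  by move=> j /andP[/andP[h _] _]; rewrite big0 // mul0r.
transitivity ((p`_k)^-1 * \sum_(j < (size S).+1) c j * rs`_j); last by rewrite e mulr0.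
rewrite big_mkord mulr_sumr; apply: eq_bigr => j _.
by rewrite coefZ pc mulrA.
Qed.

Lemma finite_residues : exists rs : seq (residue_field Q),
  forall a, exists c : 'I_(size rs) -> residue_field Q,
    (forall j, c j \in res_subfield Q E) /\ a = \sum_j c j * rs`_j.
Proof.
have [||rs [rsO fr] mx] := @exists_maximal_seq F res_free (size S).
- by split=> // c _ _ [].
- exact: res_free_bound.
exists [seq res Q r | r <- rs]; rewrite size_map => a.
have [x xO <-] := res_surj a.
apply: contrapT => hn; apply: (mx x); split.
  by move=> y; rewrite mem_rcons inE => /orP[/eqP->|/rsO].
rewrite size_rcons => c cE; rewrite big_ord_recr /= nth_rcons ltnn eqxx => e.
have cl : c ord_max = 0.
  apply: contrapT => /eqP cm; apply: hn.
  exists (fun j => - (c ord_max)^-1 * c (widen_ord (leqnSn _) j)); split=> [j|].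
    by rewrite rpredM ?rpredN ?rpredV.
  apply: (mulfI cm); move/eqP: e; rewrite addrC addr_eq0 => /eqP->.
  rewrite -sumrN mulr_sumr; apply: eq_bigr => j _.
  rewrite (nth_map 0) // nth_rcons ltn_ord mulrA mulrA mulrN mulfV // mulN1r.
  by rewrite mulNr.
move: e; rewrite cl mul0r addr0 => e k.
have := fr (fun j => c (widen_ord (leqnSn _) j)) _ _.
move=> fr'; case: (unliftP ord_max k) => [k'|] -> //.
have -> : lift ord_max k' = widen_ord (leqnSn _) k'.
  by apply: val_inj; rewrite /= /bump leqNgt ltn_ord.
apply: fr' => [j //|]; rewrite -[RHS]e; apply: eq_bigr => j _.
by rewrite nth_rcons ltn_ord.
Qed.


End FiniteExtension.

(** * Algebraic independence along a tower *)

Section AlgIndep.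
Variables (K L : fieldType) (i : {rmorphism K -> L}) (u : nat -> L).
Local Notation E k := (tower (image_subfield i (full_subfield K)) u k).

Lemma mmap_tower n (p : mpoly n K) : mmap i (fun k : 'I_n => u k) p \in E n.
Proof.
rewrite /mmap; apply: rpred_sum => m _; apply: rpredM.
  by apply: tower_sub; rewrite mem_image.
by apply: rpred_prod => k _; apply/rpredX/tower_mem.
Qed.

Lemma mmap_last n (p : mpoly n.+1 K) :
  mmap i (fun k : 'I_n.+1 => u k) p = (map_poly (mmap i (fun k : 'I_n => u k)) (muni p)).[u n].
Proof.
rewrite muniE rmorph_sum horner_sum /mmap; apply: eq_bigr => m _.
rewrite /= map_polyZ /= map_polyXn hornerZ hornerXn mmapZ mmapX -mulrA; congr (_ * _).
rewrite /mmap1 big_ord_recr /=; congr (_ * _); apply: eq_bigr => k _.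
by rewrite mnmE.
Qed.

Lemma muni_eq0 n (p : mpoly n.+1 K) : muni p = 0 -> p = 0.
Proof.
move=> p0; apply/eqP/contraT => /mlead_supp; set m0 := mlead p => m0p.
pose r (m : multinom n.+1) : multinom n := Multinom (mktuple (fun k => m (widen_ord (leqnSn n) k))).
have rI m : r m = r m0 -> m ord_max = m0 ord_max -> m = m0.
  move=> e1 e2; apply/mnmP => k; case: (unliftP ord_max k) => [k'|] ->; last by [].
  have := congr1 (fun m' : multinom n => m' k') e1; rewrite !mnmE.
  have -> : widen_ord (leqnSn n) k' = lift ord_max k'; last by [].
  by apply: val_inj; rewrite /= /bump leqNgt ltn_ord.
move: (m0p); rewrite -[_ \in _]negbK -mcoeff_eq0 => /negP[]; rewrite -[X in X == _](_ : mcoeff (r m0) (muni p)`_(m0 ord_max) = _).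
  by rewrite p0 coef0 mcoeff0.
rewrite muniE coef_sum raddf_sum /= (bigD1_seq m0) ?msupp_uniq //=.
rewrite coefZ coefXn eqxx mulr1 mcoeffZ mcoeffX eqxx mulr1 big1 ?addr0 // => m mm0.
rewrite coefZ coefXn; case: eqP => [e2|]; last by rewrite mulr0 mcoeff0.
rewrite mulr1 mcoeffZ mcoeffX; case: eqP => [e1|]; last by rewrite mulr0.
by case/eqP: mm0; apply: rI.
Qed.

(** A relation between [u 0], ..., [u n] with a nonzero coefficient, as a polynomial
    in the last variable, makes [u n] algebraic over the preceding field. *)
Lemma alg_indep_tower n :
  (forall k, (k < n)%N -> ~ alg (E k) (u k)) -> alg_indep i (fun k : 'I_n => u k).
Proof.
elim: n => [|n IH] h p.
  have [c ->] : exists c, p = mpolyC 0 c.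
    exists (mcoeff mnm0 p); apply/mpolyP => m; rewrite mcoeffC.
    have -> : m = mnm0 by apply/mnmP => -[].
    by rewrite eqxx mulr1.
  rewrite mmapC => /eqP; rewrite fmorph_eq0 => /eqP ->; exact: raddf0.
rewrite mmap_last => e; apply: muni_eq0; apply/polyP => k; rewrite coef0.
have {}IH := IH (fun k kn => h k (ltnW kn)).
apply: IH; apply/eqP/contraT => nz; case: (h n (ltnSn n)).
exists (map_poly (mmap i (fun k : 'I_n => u k)) (muni p)); split.
- by apply/polyOverP => j; rewrite coef_map; apply: mmap_tower.
- by apply: contraNneq nz => e0; rewrite -coef_map e0 coef0.
- exact/rootP.
Qed.

End AlgIndep.

(** * Transcendence degree and rational rank *)

Section Adjoin.
Variables (K L : fieldType) (i : {rmorphism K -> L}).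

Lemma is_subfieldP (S : set L) : is_subfield S <->
  [/\ S 1, forall x y, S x -> S y -> S (x - y) & forall x y, S x -> S y -> S (x / y)].
Proof.
have e x : (x \in mem S) <-> S x by rewrite -[S x]in_setE; split.
split=> [[h1 hB hV]|[h1 hB hV]]; split.
- exact/e.
- by move=> x y /e xS /e yS; apply/e/hB.
- by move=> x y /e xS /e yS; apply/e/hV.
- exact/e.
- by move=> x y /e xS /e yS; apply/e/hB.
- by move=> x y /e xS /e yS; apply/e/hV.
Qed.

Lemma adjoin_is_subfield (S : set L) : is_subfield (adjoin i S).
Proof.
apply/is_subfieldP; split=> [D [hD SD]|x y xA yA D [hD SD]|x y xA yA D [hD SD]];
  have /is_subfieldP[h1 hB hV] := hD.
- exact: h1.
- exact: (hB _ _ (xA D (conj hD SD)) (yA D (conj hD SD))).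
- exact: (hV _ _ (xA D (conj hD SD)) (yA D (conj hD SD))).
Qed.

Lemma subfield_is_subfield (D : subfield L) : is_subfield [set x | x \in D].
Proof.
have [h1 hB hV] := subfield_closed D.
by apply/is_subfieldP; split=> [|x y|x y]; [exact: h1|exact: hB|exact: hV].
Qed.

Lemma adjoin_min (S : set L) (D : subfield L) :
  {subset image_subfield i (full_subfield K) <= D} -> (forall x, S x -> x \in D) ->
  forall x, adjoin i S x -> x \in D.
Proof.
move=> iD SD x xA; apply: (xA [set x | x \in D]); split; first exact: subfield_is_subfield.
by move=> y [[c _ <-]|/SD //]; apply: iD; rewrite mem_image.
Qed.

Lemma adjoin_closed_subproof (S : set L) : divring_closed (fun x => `[< adjoin i S x >] : bool).
Proof.
have /is_subfieldP[h1 hB hV] := adjoin_is_subfield S.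
split=> [|x y|x y]; rewrite -!topredE /=; first exact/asboolP.
  by move=> /asboolP xA /asboolP yA; apply/asboolP; exact: (hB _ _ xA yA).
by move=> /asboolP xA /asboolP yA; apply/asboolP; exact: (hV _ _ xA yA).
Qed.

Definition adjoin_subfield (S : set L) : subfield L := Subfield (adjoin_closed_subproof S).

Lemma adjoin_subfieldP (S : set L) x : reflect (adjoin i S x) (x \in adjoin_subfield S).
Proof. exact: asboolP. Qed.

Lemma adjoin_base (S : set L) c : i c \in adjoin_subfield S.
Proof. by apply/adjoin_subfieldP => D [_]; apply; left; exists c. Qed.

Lemma adjoin_gen (S : set L) x : S x -> x \in adjoin_subfield S.
Proof. by move=> Sx; apply/adjoin_subfieldP => D [_]; apply; right. Qed.

Lemma tower_adjoin (S : set L) (u : nat -> L) n : (forall k, (k < n)%N -> S (u k)) ->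
  {subset tower (image_subfield i (full_subfield K)) u n <= adjoin_subfield S}.
Proof.
move=> uS; apply: tower_min => [_ /image_subfieldP[c _ ->]|k /uS]; first exact: adjoin_base.
exact: adjoin_gen.
Qed.

Lemma algebraic_overP (S : set L) y :
  algebraic_over (adjoin i S) y <-> alg (adjoin_subfield S) y.
Proof.
have e x : (x \in mem (adjoin i S)) = (x \in adjoin_subfield S).
  by apply/idP/adjoin_subfieldP; rewrite -[adjoin i S x]in_setE.
split=> -[p [/allP pE p0 py]]; exists p; split=> //; apply/allP => x /pE h.
  by have : x \in adjoin_subfield S by rewrite -e.
have {}h : x \in adjoin_subfield S := h.
by have : x \in mem (adjoin i S) by rewrite e.
Qed.

Lemma tower_transcendence_basis (u : nat -> L) n :
  (forall k, (k < n)%N -> ~ alg (tower (image_subfield i (full_subfield K)) u k) (u k)) ->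
  (forall y, alg (tower (image_subfield i (full_subfield K)) u n) y) -> has_trdeg i n.
Proof.
move=> tr al; exists (fun k : 'I_n => u k); split; first exact: alg_indep_tower.
move=> y; apply/algebraic_overP; apply: algS (al y); apply: tower_adjoin => k kn.
by exists (Ordinal kn).
Qed.

Lemma trdeg_tower n : has_trdeg i n -> exists ts : seq L,
  forall y, alg (tower (image_subfield i (full_subfield K)) (nth 0 ts) (size ts)) y.
Proof.
move=> [t [_ al]]; exists [seq t k | k <- enum 'I_n] => y.
have /algebraic_overP := al y; apply: algS => x /adjoin_subfieldP.
apply: adjoin_min => [z|_ [k _ <-]]; first exact: tower_sub.
have <- : nth 0 [seq t k | k <- enum 'I_n] k = t k.
  by rewrite (nth_map k) ?size_enum_ord // nth_ord_enum.
by apply: tower_mem; rewrite size_map size_enum_ord.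
Qed.

End Adjoin.

Section RationalRank.
Variable A : zmodType.

Lemma biadditive_mulrn (B C D : zmodType) (b : B -> C -> D) : biadditive b ->
  forall x y n, b (x *+ n) y = b x (y *+ n).
Proof.
move=> [bl br] x y; have bl0 : b 0 y = 0 by apply: (addrI (b 0 y)); rewrite -bl !addr0.
have br0 : b x 0 = 0 by apply: (addrI (b x 0)); rewrite -br !addr0.
by elim=> [|n IH]; rewrite ?mulr0n ?bl0 ?br0 // !mulrS bl br IH.
Qed.

Lemma biadditive0 (B C D : zmodType) (b : B -> C -> D) x : biadditive b -> b x 0 = 0.
Proof. by move=> [_ br]; apply: (addrI (b x 0)); rewrite -br !addr0. Qed.

(** The tensor product vanishes: divide the rational factor by an exponent that
    kills the other one. *)
Lemma torsion_rational_rank : (forall a : A, exists2 N, (0 < N)%N & a *+ N = 0) ->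
  has_rational_rank A 0.
Proof.
move=> tA; exists ('rV[rat]_0 : vectType rat), (fun _ _ => 0); split; last first.
  by rewrite dimvf /dim /=.
split=> [|q r a|W b hb]; first by split=> x y z; rewrite addr0.
- by rewrite scaler0.
- exists (\0 : {additive 'rV[rat]_0 -> W}); split=> [q a|h' _ v]; last first.
    by rewrite (_ : v = 0) ?raddf0 //; apply/rowP => -[].
  have [N N0 aN] := tA a.
  have -> : q = (q / N%:R) *+ N by rewrite -mulr_natr divfK // pnatr_eq0 -lt0n.
  by rewrite (biadditive_mulrn hb) aN biadditive0.
Qed.

(** The tensor product is the rational line with basis [1 (x) t]; an element [a] with
    [N a = k t] corresponds to [k / N]. *)
Lemma rational_rank1 (t : A) :
  (forall a : A, exists (N : nat) (k : int), (0 < N)%N /\ a *+ N = t *~ k) ->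
  (forall k : int, t *~ k = 0 -> k = 0) -> has_rational_rank A 1.
Proof.
move=> hA tk.
have /choice[Nk NkP] : forall a, exists Nk : nat * int, (0 < Nk.1)%N /\ a *+ Nk.1 = t *~ Nk.2.
  by move=> a; have [N [k h]] := hA a; exists (N, k).
pose l (a : A) : rat := (Nk a).2%:~R / (Nk a).1%:R.
have N0 a : (Nk a).1%:R != 0 :> rat by rewrite pnatr_eq0 -lt0n; case: (NkP a).
have tinj (k m : int) : t *~ k = t *~ m -> k = m.
  by move=> e; apply/eqP; rewrite -subr_eq0; apply/eqP/tk; rewrite mulrzBr e subrr.
have lE a (N : nat) (k : int) : (0 < N)%N -> a *+ N = t *~ k -> l a = k%:~R / N%:R.
  move=> Npos e; have [Mpos e'] := NkP a.
  have Nn : N%:R != 0 :> rat by rewrite pnatr_eq0 -lt0n.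
  apply/eqP; rewrite /l eqr_div //; apply/eqP.
  have : (Nk a).2 * N%:Z = k * (Nk a).1%:Z.
    by apply: tinj; rewrite !mulrzA -e -e' -!pmulrn -!mulrnA mulnC.
  by move/(congr1 (fun m : int => m%:~R : rat)); rewrite !rmorphM /= !pmulrn.
have lD : {morph l : a a' / a + a'}.
  move=> a a'; have [M0 eM] := NkP a; have [M0' eM'] := NkP a'.
  have -> : l (a + a') = ((Nk a).2 * (Nk a').1%:Z + (Nk a').2 * (Nk a).1%:Z)%:~R /
      ((Nk a).1 * (Nk a').1)%:R.
    apply: lE; first by rewrite muln_gt0 M0.
    rewrite mulrzDr !mulrzA -eM -eM' -!pmulrn mulrnDl -!mulrnA.
    by rewrite [((Nk a').1 * _)%N]mulnC.
  rewrite rmorphD !rmorphM /= ?natrM mulrDl /l; congr (_ + _).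
    by rewrite -mulf_div (divff (N0 a')) mulr1.
  by rewrite [(Nk a).1%:R * _]mulrC -mulf_div (divff (N0 a)) mulr1.
have lt : l t = 1 by rewrite (lE t 1%N 1) // divr1.
exists (rat^o : vectType rat), (fun q a => q * l a); split; last first.
  by rewrite dimvf /dim /=.
split=> [|q r a|W b hb].
- by split=> [y x x'|x y y']; rewrite ?lD (mulrDl, mulrDr).
- by rewrite -mulrA.
have [bl br] := hb.
have hadd : zmod_morphism (fun q : rat^o => b q t).
  move=> q r; have bN x : b (- x) t = - b x t.
    apply: (addrI (b x t)); rewrite -bl !subrr.
    by apply: (addrI (b 0 t)); rewrite -bl !addr0.
  by rewrite bl bN.
pose hZ := GRing.isZmodMorphism.Build rat^o W (fun q => b q t) hadd.
pose h : {additive rat^o -> W} := HB.pack (fun q : rat^o => b q t) hZ.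
have b0 x y n : b (x *+ n) y = b x (y *+ n) := biadditive_mulrn hb x y n.
have bz x (n : int) : b (x *~ n) t = b x (t *~ n).
  case: n => n; first exact: b0.
  have bN y : b x (- y) = - b x y.
    apply: (addrI (b x y)); rewrite -br !subrr; exact: biadditive0.
  rewrite NegzE !mulrNz bN -pmulrn -pmulrn -b0.
  by rewrite -[LHS]/(h (- (x *+ n.+1))) raddfN.
exists h; split=> [q a|h' hh' v].
  rewrite /h /= /l; have [N1 e] := NkP a.
  have -> : q * ((Nk a).2%:~R / (Nk a).1%:R) = (q / (Nk a).1%:R) *~ (Nk a).2.
    by rewrite -[RHS]mulrzr mulrA mulrAC.
  have qN : (q / (Nk a).1%:R) *+ (Nk a).1 = q by rewrite -[LHS]mulr_natr divfK.
  by rewrite bz -e -b0 qN.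
by have := hh' v t; rewrite lt mulr1 => ->.
Qed.

End RationalRank.

(** * Value group and residue field of a place over the ground field *)

Section Values.
Variables (K F : fieldType) (i : {rmorphism K -> F}) (wp : place K) (P : places_over i wp).
Local Notation A := (relative_value_group P).
Local Notation iK := (image_subfield i (full_subfield K)).

Definition rel_value (x : mult_group F) : A :=
  \pi_(@Quotient.quot (value_group P) (@base_values K F i wp P)) (valuation P x).

Lemma rel_value_zmod : zmod_morphism rel_value.
Proof. by move=> x y; rewrite /rel_value /valuation !raddfB. Qed.
HB.instance Definition _ :=
  GRing.isZmodMorphism.Build (mult_group F) A rel_value rel_value_zmod.

Lemma rel_value_surj (a : A) : exists x, rel_value x = a.
Proof.
by exists (repr (repr a : value_group P)); rewrite /rel_value /valuation !reprK.
Qed.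

Lemma rel_value_eq0 x : rel_value x = 0 <->
  exists2 c : K, c != 0 & val x / i c \in place_unit P.
Proof.
rewrite /rel_value; split=> [/eqP|[c c0 cU]].
  rewrite -[0](raddf0 (\pi_(@Quotient.quot (value_group P) (@base_values K F i wp P)))).
  rewrite -Quotient.idealrBE subr0 => /asboolP[c e].
  exists (val c); first by case: c {e}.
  move/eqP: e; rewrite /valuation -Quotient.idealrBE -topredE /= /place_units /=.
  by rewrite place_unitE // mulf_neq0 ?invr_eq0 ?fmorph_eq0; [|case: x|case: c].
apply/eqP; rewrite -[0](raddf0 (\pi_(@Quotient.quot (value_group P) (@base_values K F i wp P)))).
rewrite -Quotient.idealrBE subr0; apply/asboolP; exists (exist _ c c0).
apply/eqP; rewrite /valuation -Quotient.idealrBE -topredE /= /place_units /=.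
by rewrite -place_unitE //; apply: place_unit_nz cU.
Qed.

(** Values modulo those of [K], for field elements; the value of 0 is junk. *)
Definition value_mod (f : F) : A := rel_value (insubd (0 : mult_group F) f).

Lemma value_modE f (f0 : f != 0) : value_mod f = rel_value (exist _ f f0).
Proof. by congr rel_value; apply: val_inj; rewrite val_insubd f0. Qed.

Lemma value_modM f g : f != 0 -> g != 0 -> value_mod (f * g) = value_mod f + value_mod g.
Proof.
move=> f0 g0; have fg0 : f * g != 0 by rewrite mulf_neq0.
rewrite (value_modE f0) (value_modE g0) (value_modE fg0) -raddfD; congr rel_value; exact: val_inj.
Qed.

Lemma value_mod_eq0 f : f != 0 -> value_mod f = 0 <-> exists2 c : K, c != 0 & f / i c \in place_unit P.
Proof. by move=> f0; rewrite (value_modE f0) rel_value_eq0. Qed.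

Lemma value_mod_unit f : f \in place_unit P -> value_mod f = 0.
Proof.
move=> fU; apply/value_mod_eq0; first exact: place_unit_nz fU.
by exists 1; rewrite ?oner_neq0 // rmorph1 divr1.
Qed.

Lemma value_mod_base c : c != 0 -> value_mod (i c) = 0.
Proof.
move=> c0; apply/value_mod_eq0; rewrite ?fmorph_eq0 //.
by exists c => //; rewrite divff ?fmorph_eq0 // rpred1.
Qed.

Lemma value_modV f : f != 0 -> value_mod f^-1 = - value_mod f.
Proof.
move=> f0; apply/eqP; rewrite -addr_eq0 -value_modM ?invr_eq0 // mulVf //.
by rewrite value_mod_unit ?rpred1.
Qed.

Lemma value_modX f n : f != 0 -> value_mod (f ^+ n) = value_mod f *+ n.
Proof.
move=> f0; elim: n => [|n IH]; first by rewrite expr0 mulr0n value_mod_unit ?rpred1.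
by rewrite exprS mulrS value_modM ?expf_neq0 // IH.
Qed.

Lemma value_modXz f (k : int) : f != 0 -> value_mod (f ^ k) = value_mod f *~ k.
Proof.
move=> f0; case: k => k; first exact: value_modX.
by rewrite NegzE mulrNz -invr_expz value_modV ?expf_neq0 // value_modX.
Qed.

Lemma value_mod_surj (a : A) : exists2 f, f != 0 & value_mod f = a.
Proof.
have [x <-] := rel_value_surj a; exists (val x); first by case: x.
by congr rel_value; apply: val_inj; rewrite val_insubd; case: x => x /= ->.
Qed.

Section FiniteOver.
Variables (E : subfield F) (t : F).
Hypothesis valE : forall f, f \in E -> f != 0 -> exists k : int, value_mod f = value_mod t *~ k.

(** Generators are the value of [t] and those of the finitely many classes of
    [finite_values]. *)
Lemma value_group_fg_of_finite S : (forall f, in_span E S f) -> value_group_fg P.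
Proof.
move=> hS; have [fs [/allP fs0 hfs]] := finite_values P hS.
exists (value_mod t :: map value_mod fs) => a; have [f f0 <-] := value_mod_surj a.
have [g gfs /asboolP[c [cE c0 gU]]] := hfs f f0.
have g0 := fs0 g gfs; have [k ck] := valE cE c0.
have e : value_mod f = value_mod g - value_mod t *~ k.
  have := value_mod_unit gU; rewrite value_modM ?invr_eq0 ?mulf_neq0 // value_modV ?mulf_neq0 // value_modM //.
  by move=> /eqP; rewrite subr_eq0 ck => /eqP->; rewrite addrK.
have gi : (index g fs < size fs)%N by rewrite index_mem.
exists (fun l : 'I_(size (value_mod t :: map value_mod fs)) =>
  if l == 0%N :> nat then - k else if l == (index g fs).+1 :> nat then 1 else 0).
rewrite /= big_ord_recl /= mulrNz e addrC; congr (_ + _).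
have gi' : (index g fs < size (map value_mod fs))%N by rewrite size_map.
rewrite (bigD1 (Ordinal gi')) //= eqxx mulr1z (nth_map 0) // nth_index // big1 ?addr0 //.
by move=> j; rewrite -val_eqE /= /bump /= add1n eqSS => /negPf->; rewrite mulr0z.
Qed.

(** In an equation of [f] two different nonzero terms have the same value, and this
    gives a multiple of the value of [f]. *)
Lemma value_torsion f : f != 0 -> alg E f ->
  exists (N : nat) (k : int), (0 < N)%N /\ value_mod f *+ N = value_mod t *~ k.
Proof.
move=> f0 [p [/polyOverP pE p0 pf]].
have [j [k [jk pj pk U]]] : exists j k : 'I_(size p), [/\ j != k, p`_j * f ^+ j != 0,
    p`_k * f ^+ k != 0 & p`_j * f ^+ j / (p`_k * f ^+ k) \in place_unit P].
  apply: contrapT => h.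
  have := @sum_distinct_values _ P _ (fun j : 'I_(size p) => p`_j * f ^+ j).
  rewrite -horner_coef (rootP pf) eqxx => h'; suff : false by []; apply: h'.
    have sp : ((size p).-1 < size p)%N by rewrite prednK // size_poly_gt0.
    exists (Ordinal sp); rewrite mulf_neq0 ?expf_neq0 //=.
    by rewrite -lead_coefE lead_coef_eq0.
  by move=> j k jk pj pk; apply/negP => U; apply: h; exists j, k.
wlog ltjk : j k jk pj pk U / (k < j)%N.
  move=> W; case: (ltngtP k j) => [|lt|/val_inj e]; first exact: W.
    by apply: (W k j) => //; rewrite 1?eq_sym // -invf_div rpredV.
  by rewrite e eqxx in jk.
have [cj ck] : p`_j != 0 /\ p`_k != 0.
  by move: pj pk; rewrite !mulf_eq0 !negb_or => /andP[-> _] /andP[-> _].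
have [l el] := valE (pE j) cj; have [m em] := valE (pE k) ck.
exists (j - k)%N, (m - l); split; first by rewrite subn_gt0.
have := value_mod_unit U; rewrite value_modM ?invr_eq0 // value_modV // !value_modM ?expf_neq0 // !value_modX // el em => /eqP.
rewrite subr_eq0 mulrnBr ?(ltnW ltjk) // mulrzBr => /eqP e.
by rewrite -[value_mod f *+ j](addKr (value_mod t *~ l)) e addrA addrK addrC.
Qed.

End FiniteOver.

End Values.

Section ResidueField.
Variables (K F : fieldType) (i : {rmorphism K -> F}) (wp : place K) (P : places_over i wp).
Local Notation iK := (image_subfield i (full_subfield K)).
Local Notation kres := (image_subfield (residue_map P) (full_subfield (residue_field wp))).

Lemma res_base_sub (E : subfield F) : {subset iK <= E} -> {subset kres <= res_subfield P E}.
Proof.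
move=> iE _ /image_subfieldP[a _ ->]; have [c <-] := residue_surj a.
rewrite /= residue_mapE -res_val /=; apply: res_subfield_mem.
  by apply: iE; rewrite mem_image.
by rewrite place_overE; case: c.
Qed.

Lemma res_base : {subset res_subfield P iK <= kres}.
Proof.
move=> _ /res_subfieldP[_ [/image_subfieldP[c _ ->] cO] ->].
have cw : c \in place_ring wp by rewrite -(place_overE P).
apply/image_subfieldP; exists (residue (exist _ c cw : vring wp)) => //.
by rewrite /= residue_mapE -res_val.
Qed.

Variables (E : subfield F) (zs : seq F).
Hypothesis iE : {subset iK <= E}.
Hypothesis resE : {subset res_subfield P E <= kres}.
Local Notation T := (tower E (nth 0 zs)).
Hypothesis rz : forall k, (k < size zs)%N -> res_transc P (T k) (nth 0 zs k).
Hypothesis az : forall x, alg (T (size zs)) x.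

Lemma res_subfield_base : res_subfield P E = kres.
Proof. by apply: subfield_ext => a; apply/idP/idP; [exact: resE|exact: res_base_sub]. Qed.

Lemma res_T k : (k <= size zs)%N ->
  res_subfield P (T k) = tower kres (fun j => res P (nth 0 zs j)) k.
Proof.
move=> kz; rewrite res_tower ?res_subfield_base // => j jk.
by apply: rz; apply: leq_trans jk kz.
Qed.

Lemma residue_dim : has_dim P (size zs).
Proof.
apply: (@tower_transcendence_basis _ _ _ (fun j => res P (nth 0 zs j))) => [k kz|a].
  by rewrite -res_T 1?ltnW //; apply/res_transc_res/rz.
by rewrite -res_T //; have [x xO <-] := res_surj a; apply: alg_res.
Qed.

Lemma residue_fg S : (forall f, in_span (T (size zs)) S f) -> residue_field_fg P.
Proof.
move=> hS; have [rs hrs] := finite_residues P hS.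
exists (map (res P) zs ++ rs); apply/seteqP; split=> // a _.
set G := [set` _]; suff : a \in adjoin_subfield (residue_map P) G by move/adjoin_subfieldP.
have [c [cR ->]] := hrs a; apply: rpred_sum => j _; apply: rpredM.
  have := cR j; rewrite res_T //; apply: tower_adjoin => k kz.
  by rewrite /G /= mem_cat map_f ?mem_nth.
by apply: adjoin_gen; rewrite /G /= mem_cat mem_nth ?orbT.
Qed.

End ResidueField.

(** * Density of the Abhyankar places *)

Section Conclusion.
Variables (K F : fieldType) (i : {rmorphism K -> F}) (wp : place K).
Hypothesis hF : algebraic_function_field i.
Local Notation iK := (image_subfield i (full_subfield K)).

Definition fg_abhyankar (P : places_over i wp) : Prop :=
  (value_group_fg P /\ residue_field_fg P) /\ abhyankar P.

Lemma alg_spanned (E : subfield F) : {subset iK <= E} -> (forall x, alg E x) ->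
  exists S, forall f, in_span E S f.
Proof.
move=> iE Ea; have [[s hs] _] := hF.
have [D [ED sD [S hS]]] := spanned_all s Ea.
exists S => f; apply: hS; have : adjoin i [set` s] f by rewrite hs.
by apply: adjoin_min => [x /iE/ED|x /sD].
Qed.

Section Tower.
Variables (P : places_over i wp) (E : subfield F) (t : F) (zs : seq F).
Hypothesis iE : {subset iK <= E}.
Hypothesis valE : forall f, f \in E -> f != 0 -> exists k : int, value_mod P f = value_mod P t *~ k.
Local Notation T := (tower E (nth 0 zs)).
Hypothesis rz : forall k, (k < size zs)%N -> res_transc P (T k) (nth 0 zs k).
Hypothesis az : forall x, alg (T (size zs)) x.

Lemma tower_value_mod f : f \in T (size zs) -> f != 0 -> exists k : int, value_mod P f = value_mod P t *~ k.
Proof.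
move=> fT f0; have [c [cE c0] U] := tower_value rz fT f0.
have [k e] := valE cE c0; exists k; rewrite -e -[f in LHS](divfK c0).
by rewrite (value_modM _ (place_unit_nz U) c0) (value_mod_unit U) add0r.
Qed.

Lemma tower_fg : {subset res_subfield P E <= image_subfield (residue_map P) (full_subfield _)} ->
  value_group_fg P /\ residue_field_fg P.
Proof.
move=> rE; have [|S hS] := alg_spanned _ az; first by move=> x /iE; apply: tower_sub.
split; first exact: (value_group_fg_of_finite (@tower_value_mod) hS).
exact: (residue_fg iE rE rz hS).
Qed.

Lemma tower_torsion (a : relative_value_group P) :
  exists (N : nat) (k : int), (0 < N)%N /\ a *+ N = value_mod P t *~ k.
Proof. by have [f f0 <-] := value_mod_surj a; apply: (value_torsion (@tower_value_mod) f0 (az f)). Qed.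

End Tower.

(** Here the values of [E = K] vanish modulo those of [K], so that the parameter [t]
    of the preceding lemmas can be taken to be 1. *)
Lemma fg_abhyankar_of_res_transc (P : places_over i wp) (zs : seq F) :
  (forall k, (k < size zs)%N -> res_transc P (tower iK (nth 0 zs) k) (nth 0 zs k)) ->
  (forall x, alg (tower iK (nth 0 zs) (size zs)) x) -> fg_abhyankar P.
Proof.
move=> rz az.
have valE f : f \in iK -> f != 0 -> exists k : int, value_mod P f = value_mod P 1 *~ k.
  move=> /image_subfieldP[c _ ->]; rewrite fmorph_eq0 => c0.
  by exists 0; rewrite value_mod_base.
have iE : {subset iK <= iK} by [].
split; first exact: (tower_fg iE valE rz az (@res_base _ _ _ _ P)).
exists (size zs), (size zs), 0%N; split; last by rewrite addn0.
- apply: (@tower_transcendence_basis _ _ _ (nth 0 zs)) => // k kz.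
  exact/res_transc_transc/rz.
- exact: residue_dim iE (@res_base _ _ _ _ P) rz az.
- apply: torsion_rational_rank => a.
  have [N [k [N0 e]]] := tower_torsion valE rz az a.
  by exists N; rewrite // e value_mod_unit ?rpred1 // mul0rz.
Qed.

(** The value of [t] generates that of [K(t)] and is not torsion, since a power of [t]
    that is a unit up to a constant has exponent 0. *)
Lemma fg_abhyankar_of_tadic (P : places_over i wp) (t : F) (zs : seq F) :
  {subset iK <= place_ring P} -> t != 0 -> t \in place_max P ->
  (forall k, (k < size zs)%N -> res_transc P (tower (ratf iK t) (nth 0 zs) k) (nth 0 zs k)) ->
  (forall x, alg (tower (ratf iK t) (nth 0 zs) (size zs)) x) -> fg_abhyankar P.
Proof.
move=> iO t0 tM rz az.
have valE f : f \in ratf iK t -> f != 0 -> exists k : int, value_mod P f = value_mod P t *~ k.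
  move=> fE f0; have [k U] := tadic_value iO t0 tM fE f0; exists k.
  have tk0 : t ^ k != 0 by rewrite expfz_neq0.
  by rewrite -value_modXz // -[f in LHS](divfK tk0) (value_modM _ (place_unit_nz U) tk0) (value_mod_unit U) add0r.
have iE : {subset iK <= ratf iK t} by apply: ratf_sub.
have rE : {subset res_subfield P (ratf iK t) <= image_subfield (residue_map P) (full_subfield _)}.
  by move=> a /(tadic_res iO t0 tM)/res_base.
split; first exact: (tower_fg iE valE rz az rE).
exists (size (t :: zs)), (size zs), 1%N; split; last by rewrite addn1.
- have TE k : tower iK (nth 0 (t :: zs)) k.+1 = tower (ratf iK t) (nth 0 zs) k.
    by rewrite -add1n tower_add.
  apply: (@tower_transcendence_basis _ _ _ (nth 0 (t :: zs))) => [[_|k kz]|y].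
  + move=> [p [pE p0 pt]]; have [k [c [_ _]]] := tadic_poly iO t0 tM pE p0.
    by rewrite (rootP pt) mul0r sub0r rpredN place_max1F.
  + by rewrite TE; apply/res_transc_transc/rz.
  + by rewrite [size _]/= TE.
- exact: residue_dim iE rE rz az.
- apply: (@rational_rank1 _ (value_mod P t)); first exact: tower_torsion valE rz az.
  move=> k; rewrite -value_modXz // => /value_mod_eq0[|c c0 U]; first exact: expfz_neq0.
  have cU : i c \in place_unit P.
    by apply: (trivial_unit iO); rewrite ?fmorph_eq0 ?mem_image.
  have tkU : t ^ k \in place_unit P.
    by rewrite -[t ^ k](divfK (place_unit_nz cU)) rpredM.
  apply/eqP/contraT => k0; case/place_unitP: tkU => tkO.
  by rewrite (tadic_pow_unit t0 tM tkO k0).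
Qed.

(** The three cases are those of a place that is nontrivial on [K], trivial on [K]
    but not on [F], and trivial on [F]. *)
Lemma fg_abhyankar_dense (P : places_over i wp) (A B : seq F) : satisfies P A B ->
  exists2 Q : places_over i wp, satisfies Q A B & fg_abhyankar Q.
Proof.
move=> sP; have [_ [n n0 /trdeg_tower[ts tsF]]] := hF.
case: (pselect (exists2 c : K, c != 0 & i c \in place_max P)) => [[c c0 cM]|Ktriv].
  have cE : i c \in iK by rewrite mem_image.
  have ic0 : i c != 0 by rewrite fmorph_eq0.
  have [Q [agQ sQ] [zs [rz az]]] := residually_transcendental_near cE ic0 cM tsF sP.
  have QE d : (i d \in place_ring Q) = (d \in place_ring wp).
    by rewrite -agQ ?mem_image // place_overE.
  by exists (PlaceOver QE) => //; exact: (@fg_abhyankar_of_res_transc (PlaceOver QE) zs rz az).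
have iKO : {subset iK <= place_ring P}.
  move=> _ /image_subfieldP[c _ ->]; apply/contraT => cO; case: Ktriv.
  exists c^-1; last by rewrite fmorphV; apply: place_notinV.
  by rewrite invr_eq0; apply: contraNneq cO => ->; rewrite rmorph0 rpred0.
case: (pselect (exists2 t, t != 0 & t \in place_max P)) => [[t t0 tM]|Ptriv].
  have tE : t \in ratf iK t by apply: ratf_gen.
  have tsF' x : alg (tower (ratf iK t) (nth 0 ts) (size ts)) x.
    apply: algS (tsF x); apply: tower_min => [y yK|k]; last exact: tower_mem.
    by apply/tower_sub/ratf_sub.
  have [Q [agQ sQ] [zs [rz az]]] := residually_transcendental_near tE t0 tM tsF' sP.
  have iKE : {subset iK <= ratf iK t} by apply: ratf_sub.
  have QE d : (i d \in place_ring Q) = (d \in place_ring wp).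
    by rewrite -agQ ?place_overE //; apply: iKE; rewrite mem_image.
  exists (PlaceOver QE) => //; apply: (@fg_abhyankar_of_tadic _ t zs) => //=.
    by move=> x xK; rewrite -agQ ?iKO //; apply: iKE.
  by rewrite -(agree_max agQ).
exists P => //; have [zs [_ tr al]] := transc_sublist iK ts.
have PO x : x \in place_ring P.
  apply/contraT => xO; case: Ptriv; exists x^-1; last exact: place_notinV.
  by rewrite invr_eq0; apply: contraNneq xO => ->; rewrite rpred0.
apply: (@fg_abhyankar_of_res_transc P zs) => [k kz|x].
  split=> // p pE /primitive_neq0 p0; apply/negP => pM; apply: (tr k kz).
  exists p; split=> //; apply/rootP/eqP/contraT => px; case: Ptriv.
  by exists p.[nth 0 zs k].
apply: alg_closure_idem; apply: algS (tsF x).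
apply: tower_min => [y yK|k kts]; first by apply/alg_closure_sub/tower_sub.
by apply/alg_closureP/al/mem_nth.
Qed.

End Conclusion.

Theorem corollary2 (K F : fieldType) (i : {rmorphism K -> F})
    (hF : algebraic_function_field i) (wp : place K) :
  dense [set P : places_over i wp | value_group_fg P /\ residue_field_fg P] /\
  dense [set P : places_over i wp |
          (value_group_fg P /\ residue_field_fg P) /\ abhyankar P].
Proof.
have D : dense [set P : places_over i wp | fg_abhyankar P].
  move=> O [P OP] [I _ e]; move: OP; rewrite -e => -[ab Iab [hA hB]].
  have [Q sQ gQ] := fg_abhyankar_dense hF (conj hA hB : satisfies P ab.1 ab.2).
  by exists Q; split=> //; exists ab.
split=> // O O0 Oo; have [Q [OQ [gQ _]]] := D O O0 Oo.
by exists Q.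
Qed.
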